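(* Let $T>0$. Assume that $(L_\Lambda)_{\Lambda\subset\{1,\dots,N\}}$ is a collection of convex functions $L_\Lambda:\mathbb{R}^N\to[0,+\infty]$ satisfying the following three conditions. (A1) For any $\Lambda\subset\{1,\dots,N\}$ and $S>0$, and for any function $\phi:[0,S]\to\mathbb{R}_+^N$ with constant velocity $\dot\phi(t)=v$ and such that $\phi(t)\in B_\Lambda$ for $0<t<S$, $$\lim_{\delta\to0}\lim_{\varepsilon\to0}\liminf_{n\to\infty}\inf_{z\in\mathcal{E}_n:\,|z-\phi(0)|<\varepsilon}\frac1n\log\mathbb{P}_z\Big(\sup_{t\in[0,S]}|\phi(t)-Z_n(t)|<\delta\Big)\ge -S\,L_\Lambda(v).$$ (A2) The function $L_{\{1,\dots,N\}}$ is finite in a neighborhood of zero. (A3) For any $\Lambda\subset\{1,\dots,N\}$ and $S>0$, and for any $x,y\in B_\Lambda$, $$\lim_{\delta\to0}\limsup_{n\to\infty}\sup_{z\in\mathcal{E}_n:\,|z-x|<\delta}\frac1n\log\mathbb{P}_z\big(|Z_n(S)-y|<\delta\text{ and }\tau_{\Lambda,n}>S\big)\le -S\,L_\Lambda\Big(\frac{y-x}{S}\Big).$$ Suppose moreover that there is a good rate function $\tilde I_{[0,T]}$ on $D([0,T],\mathbb{R}_+^N)$ satisfying the upper large deviation bound: for any $x\in\mathbb{R}_+^N$ and any closed set $F\subset D([0,T],\mathbb{R}_+^N)$, $$\lim_{\varepsilon\to0}\limsup_{n\to\infty}\sup_{z\in\mathcal{E}_n:|z-x|<\varepsilon}\frac1n\log\mathbb{P}_z(Z_n\in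 F)\le-\inf_{\phi\in F:\phi(0)=x}\tilde I_{[0,T]}(\phi).$$ Then the family $(Z_n(t),t\in[0,T])$ satisfies the sample path large deviation principle with the rate function $I_{[0,T]}$, and $I_{[0,T]}$ is also a good rate function.
   Context: Let $N\ge1$, $\mathbb{R}_+=[0,\infty)$, $E\subset\mathbb{R}_+^N$, and let $(X(t,x))_{t\ge0}$ be a Markov process on $E$ with a given transition kernel and initial state $X(0,x)=x$, with paths that are right-continuous with left limits. For $n\ge1$ let $\mathcal{E}_n=\frac1nE$ and, for $z\in\mathcal{E}_n$, let $Z_n(t,z)=X(nt,nz)/n$, a rescaled Markov process on $\mathcal{E}_n$ with $Z_n(0,z)=z$. One writes $Z_n(t)$ for $Z_n(t,z)$, and $\mathbb{P}_z$ indicates that the initial state is $z$. It is assumed that for any $x\in\mathbb{R}_+^N$ there is a sequence $x_n\in\mathcal{E}_n$ converging to $x$. For $x\in\mathbb{R}_+^N$, $\Lambda(x)=\{i: x_i>0\}$. For $\Lambda\subset\{1,\dots,N\}$, $B_\Lambda=\{x\in\mathbb{R}_+^N:\Lambda(x)=\Lambda\}$, and $\tau_{\Lambda,n}$ is the hitting time of the set $\bigcup_{i\in\Lambda}\{x:x_i=0\}$ by the process $(Z_n(t))$. Put $L(x,v)=L_{\Lambda(x)}(v)$ for $x\in\mathbb{R}_+^N$, $v\in\mathbb{R}^N$. $D([0,T],\mathbb{R}_+^N)$ is the set of functions $[0,T]\to\mathbb{R}_+^N$ that are right-continuous with left limits, endowed with the Skorohod metric $d_S$. For a continuous piecewise linear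 (finitely many pieces) $\psi:[0,T]\to\mathbb{R}_+^N$ put $J_{[0,T]}(\psi)=\int_0^TL(\psi(s),\dot\psi(s))\,ds$, and for $\phi\in D([0,T],\mathbb{R}_+^N)$ put $$I_{[0,T]}(\phi)=\lim_{\delta\to0}\inf_\psi J_{[0,T]}(\psi),$$ the infimum being over all continuous piecewise linear $\psi:[0,T]\to\mathbb{R}_+^N$ with $d_S(\phi,\psi)<\delta$. A rate function is a lower semicontinuous map $I:D([0,T],\mathbb{R}_+^N)\to[0,+\infty]$. It is a good rate function if (a) for any compact $V\subset\mathbb{R}_+^N$ and any $c>0$, the set of all $\phi\in D([0,T],\mathbb{R}_+^N)$ with $\phi(0)\in V$ and $I(\phi)\le c$ is compact in $D([0,T],\mathbb{R}_+^N)$; and (b) every $\phi\in D([0,T],\mathbb{R}_+^N)$ with $I(\phi)<\infty$ is absolutely continuous. The family $(Z_n(t),t\in[0,T])$ satisfies the sample path large deviation principle with rate function $I$ if for any $x\in\mathbb{R}_+^N$: (i) for any open set $\mathcal{O}\subset D([0,T],\mathbb{R}_+^N)$, $$\lim_{\varepsilon\to0}\liminf_{n\to\infty}\inf_{z\in\mathcal{E}_n:|z-x|<\varepsilon}\frac1n\log\mathbb{P}_z(Z_n\in\mathcal{O})\ge-\inf_{\phi\in\mathcal{O}:\phi(0)=x}I(\phi);$$ (ii) for any closed set $F\subset D([0,T],\mathbb{R}_+^N)$, $$\lim_{\varepsilon\to0}\limsup_{n\to\infty}\sup_{z\in\mathcal{E}_n:|z-x|<\varepsilon}\frac1n\log\mathbb{P}_z(Z_n\in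 F)\le-\inf_{\phi\in F:\phi(0)=x}I(\phi).$$ The infimum over the empty set is $+\infty$. *)

(* Defs.v *)
From HB Require Import structures.
From mathcomp Require Import all_boot all_order all_algebra.
From mathcomp Require Import all_classical all_reals all_analysis.

Set Implicit Arguments.
Unset Strict Implicit.
Unset Printing Implicit Defensive.

Import Order.TTheory GRing.Theory Num.Theory.
Import numFieldNormedType.Exports.
Local Open Scope classical_set_scope.
Local Open Scope ring_scope.

(* R^N is 'rV[R]_N.  The norm `|.| on it is the library's (maximum) norm. *)

Definition orthant (R : realType) (N : nat) : set 'rV[R]_N :=
  [set x | forall i, 0 <= x ord0 i].

(* The set of positive coordinates Lambda(x). *)
Definition posc (R : realType) (N : nat) (x : 'rV[R]_N) : {set 'I_N} :=
  finset (fun i => 0 < x ord0 i).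

(* The face B_Lambda of the orthant. *)
Definition face (R : realType) (N : nat) (La : {set 'I_N}) : set 'rV[R]_N :=
  [set x | orthant x /\ posc x = La].

(* R^N with its Borel sigma-algebra. *)
Definition borelRV (R : realType) (N : nat) :=
  g_sigma_algebraType (@open 'rV[R]_N).

(* Right-continuity with left limits on [0, b] if b is finite, and on
   [0, +oo[ if b = +oo. *)
Definition cadlag (R : realType) (N : nat) (b : \bar R) (f : R -> 'rV[R]_N) :=
  (forall t : R, 0 <= t -> (t%:E < b)%E -> f s @[s --> t^'+] --> f t) /\
  (forall t : R, 0 < t -> (t%:E <= b)%E -> cvg (f s @[s --> t^'-])).

(* The space D([0, T], R_+^N).  A function on [0, T] is encoded as a function
   on R that vanishes outside [0, T], so that two elements of the type are
   equal as soon as they agree on [0, T]. *)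
Record skorohod (R : realType) (N : nat) (T : R) := Skorohod {
  spath :> R -> 'rV[R]_N ;
  _ : forall t : R, t \in `[0, T] -> orthant (spath t) ;
  _ : cadlag T%:E spath ;
  _ : forall t : R, t \notin `[0, T] -> spath t = 0 }.

(* The increasing homeomorphisms of [0, T]: a strictly increasing map of
   [0, T] onto itself is automatically continuous. *)
Definition time_change (R : realType) (T : R) (l : R -> R) :=
  {in `[0, T] &, {homo l : s t / s < t}} /\ l @` `[0, T]%classic = `[0, T]%classic.

Section SkorohodMetric.
Context {R : realType} {N : nat} {T : R}.
Implicit Types (x y z : skorohod N T) (l : R -> R).

Definition warp_cost x y l : \bar R :=
  maxe (ereal_sup [set `|l t - t|%:E | t in `[0, T]%classic])
       (ereal_sup [set `|x t - y (l t)|%:E | t in `[0, T]%classic]).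

Definition dS x y : \bar R :=
  ereal_inf [set warp_cost x y l | l in [set l | time_change T l]].

Lemma dS_lt x y (e : R) : (dS x y < e%:E)%E <->
  exists l, time_change T l /\ exists2 r, r < e &
    forall t : R, t \in `[0, T] -> `|l t - t| <= r /\ `|x t - y (l t)| <= r.
Proof.
split=> [/ereal_inf_lt[_ [l /= tl <-]] cl|[l [tl [r re h]]]].
  exists l; split=> //.
  have [r re cr] : exists2 r, r < e & (warp_cost x y l <= r%:E)%E.
    case: (warp_cost x y l) cl => [r|//|_].
      by rewrite lte_fin => re; exists r.
    by exists (e - 1) => //; [rewrite gtrBl|rewrite leNye].
  exists r => // t tT; move: cr; rewrite /warp_cost ge_max => /andP[h1 h2].
  split; rewrite -lee_fin.
    by apply: le_trans h1; apply: ereal_sup_ubound; exists t.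
  by apply: le_trans h2; apply: ereal_sup_ubound; exists t.
apply: (@le_lt_trans _ _ r%:E); last by rewrite lte_fin.
apply: (@le_trans _ _ (warp_cost x y l)).
  by apply: ereal_inf_lbound; exists l.
rewrite /warp_cost ge_max; apply/andP; split.
  by apply: ub_ereal_sup => _ [t /= tT <-]; rewrite lee_fin; case: (h t).
by apply: ub_ereal_sup => _ [t /= tT <-]; rewrite lee_fin; case: (h t).
Qed.

Definition dSball x (e : R) : set (skorohod N T) := [set y | (dS x y < e%:E)%E].

Lemma dSball_center x (e : R) : 0 < e -> dSball x e x.
Proof.
move=> e0; apply/dS_lt; exists id; split; first by split => //; rewrite image_id.
by exists 0 => // t _; rewrite !subrr !normr0.
Qed.

Lemma dSball_sym x y (e : R) : dSball x e y -> dSball y e x.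
Proof.
move=> /dS_lt[l [[ml il] [r re h]]]; apply/dS_lt.
have inv s : s \in `[0, T] -> exists t, t \in `[0, T] /\ l t = s.
  by move=> sT; have : `[0, T]%classic s by []; rewrite -il => -[t tT ts]; exists t.
pose g s := xget 0 [set t | t \in `[0, T] /\ l t = s].
have gP s : s \in `[0, T] -> g s \in `[0, T] /\ l (g s) = s.
  by move=> /inv[t tP]; rewrite /g; case: xgetP => [u _ //|/(_ t)].
have lT t : t \in `[0, T] -> l t \in `[0, T].
  move=> tT; have ltT : (l @` `[0, T]%classic) (l t) by exists t.
  by move: ltT; rewrite il.
exists g; split; first split.
- move=> s t sT tT st; have [gs ls] := gP _ sT; have [gt lt] := gP _ tT.
  rewrite ltNge le_eqVlt; apply/negP => /orP[/eqP E|/(ml _ _ gt gs)].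
    by move: st; rewrite -ls -lt E ltxx.
  by rewrite ls lt => /(lt_trans st); rewrite ltxx.
- apply/seteqP; split=> [_ [s /= sT <-]|t /= tT]; first by case: (gP _ sT).
  exists (l t); first exact: lT.
  have [gt lgt] := gP _ (lT _ tT).
  case: (ltgtP (g (l t)) t) => [/(ml _ _ gt tT)|/(ml _ _ tT gt)|//].
    by rewrite lgt ltxx.
  by rewrite lgt ltxx.
- exists r => // t tT; have [gt lgt] := gP _ tT.
  by have := h _ gt; rewrite lgt => -[h1 h2]; rewrite distrC (distrC (y t)).
Qed.

Lemma dSball_triangle x y z (e1 e2 : R) :
  dSball x e1 y -> dSball y e2 z -> dSball x (e1 + e2) z.
Proof.
move=> /dS_lt[l [[ml il] [r re h]]] /dS_lt[l' [[ml' il'] [r' re' h']]].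
have lT t : t \in `[0, T] -> l t \in `[0, T].
  move=> tT; have ltT : (l @` `[0, T]%classic) (l t) by exists t.
  by move: ltT; rewrite il.
apply/dS_lt; exists (l' \o l); split; first split.
- by move=> s t sT tT st /=; apply: ml'; [exact: lT|exact: lT|exact: ml].
- by rewrite -image_comp il il'.
exists (r + r'); first exact: ltrD.
move=> t tT /=; have [h1 h2] := h _ tT; have [h3 h4] := h' _ (lT _ tT).
split; first by rewrite [leRHS]addrC (le_trans (ler_distD (l t) _ _))// lerD.
by rewrite (le_trans (ler_distD (y (l t)) _ _))// lerD.
Qed.

HB.instance Definition _ := gen_eqMixin (skorohod N T).
HB.instance Definition _ := gen_choiceMixin (skorohod N T).
HB.instance Definition _ :=
  hasNbhs.Build (skorohod N T) (nbhs_ (entourage_ dSball)).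
(* The topology of D([0, T], R_+^N) is that of the metric dS:
   ball x e = [set y | dS x y < e]. *)
HB.instance Definition _ := @Nbhs_isPseudoMetric.Build R (skorohod N T)
  (entourage_ dSball) erefl dSball dSball_center dSball_sym dSball_triangle
  erefl.

End SkorohodMetric.

Section RateFunctions.
Context {R : realType} {N : nat} {T : R}.

Definition piecewise_linear (psi : skorohod N T) :=
  {within `[0, T]%classic, continuous psi} /\
  exists s : seq R, [/\ path <%R 0 s, last 0 s = T &
    forall i, (i < size s)%N -> exists v : 'rV[R]_N,
      let a := nth 0 (0 :: s) i in
      forall t : R, t \in `[a, nth 0 s i] -> psi t = psi a + (t - a) *: v].

Definition absolutely_continuous (phi : skorohod N T) :=
  forall e : R, 0 < e -> exists2 d : R, 0 < d &
    forall (n : nat) (a b : nat -> R),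
      (forall k, (k < n)%N -> 0 <= a k <= b k /\ b k <= T) ->
      trivIset `I_n (fun k => `]a k, b k[%classic) ->
      \sum_(k < n) (b k - a k) < d ->
      \sum_(k < n) `|phi (b k) - phi (a k)| < e.

Definition rate_function (I : skorohod N T -> \bar R) :=
  (forall phi, (0 <= I phi)%E) /\ lower_semicontinuous I.

Definition good_rate_function (I : skorohod N T -> \bar R) :=
  [/\ rate_function I,
      (forall (V : set 'rV[R]_N) (c : R), V `<=` @orthant R N -> compact V ->
         0 < c ->
         compact [set phi : skorohod N T | V (phi 0) /\ (I phi <= c%:E)%E]) &
      (forall phi, (I phi < +oo)%E -> absolutely_continuous phi)].

(* derive1 takes junk values only at the finitely many points where psi is not
   differentiable, which do not affect the integral. *)
Definition Jfun (L : {set 'I_N} -> 'rV[R]_N -> \bar R) (psi : skorohod N T) :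
    \bar R :=
  (\int[lebesgue_measure]_(s in `[0%R, T]) L (posc (psi s)) (derive1 psi s))%E.

Definition Ifun (L : {set 'I_N} -> 'rV[R]_N -> \bar R) (phi : skorohod N T) :
    \bar R :=
  lim (ereal_inf [set Jfun L psi | psi in
         [set psi | piecewise_linear psi /\ (dS phi psi < delta%:E)%E]]
       @[delta --> 0%R^'+]).

End RateFunctions.

(* Convexity of a function with values in [0, +oo], where 0 * +oo = 0. *)
Definition convex_ereal (R : realType) (N : nat) (f : 'rV[R]_N -> \bar R) :=
  forall (u v : 'rV[R]_N) (t : R), 0 <= t <= 1 ->
    (f (t *: u + (1 - t) *: v)%R <= t%:E * f u + (1 - t)%:E * f v)%E.

Section Process.
Context {R : realType} {N : nat} {d : measure_display} {Om : measurableType d}.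
Variables (E : set 'rV[R]_N) (P : 'rV[R]_N -> probability Om R)
  (X : R -> 'rV[R]_N -> Om -> 'rV[R]_N).

(* The sigma-algebra of the events observable up to time s. *)
Definition history (x : 'rV[R]_N) (s : R) : set (set Om) :=
  <<s [set B | exists (u : R) (A : set (borelRV R N)),
         [/\ 0 <= u <= s, measurable A & B = X u x @^-1` A] ] >>.

(* The time-homogeneous Markov process X(t, x) on E with transition kernel
   (K_t), started at x, is considered under the probability P x; a single
   probability space for all x (P constant) and a canonical space (X
   independent of x) are both allowed.  K_t is a Borel kernel on R^N that only
   matters at the points of E.  There is no loss of generality in this, even
   if E is not Borel: a kernel on E with its trace Borel sigma-algebra is a
   measurable map from E to the Polish space of probabilities on R^N, hence
   extends to R^N. *)
Record markov_process (K : R -> R.-pker (borelRV R N) ~> (borelRV R N)) :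
    Prop := {
  markov_state : forall x (t : R) w, E x -> 0 <= t -> E (X t x w) ;
  markov_init : forall x, E x -> {ae P x, forall w, X 0 x w = x} ;
  markov_meas : forall x (t : R), E x -> 0 <= t ->
    measurable_fun setT (X t x : Om -> borelRV R N) ;
  markov_prop : forall x (s t : R) (A : set (borelRV R N))
    (B : set Om),
    E x -> 0 <= s -> 0 <= t -> measurable A -> history x s B ->
    P x (B `&` X (s + t) x @^-1` A) =
      (\int[P x]_(w in B) K t (X s x w) A)%E ;
  markov_paths : forall x w, E x -> cadlag +oo%E (fun t => X t x w) }.

(* The index n = 0 is meaningless below; it only occurs inside limits as n
   tends to infinity. *)
Definition En (n : nat) : set 'rV[R]_N := [set n%:R^-1 *: x | x in E].

Definition Zn (n : nat) (t : R) (z : 'rV[R]_N) (w : Om) : 'rV[R]_N :=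
  n%:R^-1 *: X (n%:R * t) (n%:R *: z) w.

Definition path_event (T : R) (n : nat) (z : 'rV[R]_N)
    (A : set (skorohod N T)) : set Om :=
  [set w | exists2 phi, A phi & forall t : R, t \in `[0, T] -> phi t = Zn n t z w].

(* The infimum of an empty set of times is +oo. *)
Definition hitting_time (La : {set 'I_N}) (n : nat) (z : 'rV[R]_N) (w : Om) :
    \bar R :=
  ereal_inf [set t%:E | t in
    [set t | 0 <= t /\ exists2 i, i \in La & Zn n t z w ord0 i = 0]].

(* (1/n) log P_z(A).  The outer measure of P is P on measurable sets; it gives
   the value of the completion of P on the event that a hitting time of a
   closed set by a cadlag process is > S, which is universally measurable but
   need not be measurable. *)
Definition log_prob (n : nat) (z : 'rV[R]_N) (A : set Om) : \bar R :=
  ((n%:R^-1)%:E * lne (mu_ext (P (n%:R *: z)) A))%E.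

Definition liminf_log_prob (x : 'rV[R]_N) (e : R)
    (A : nat -> 'rV[R]_N -> set Om) : \bar R :=
  limn_einf (fun n => ereal_inf
    [set log_prob n z (A n z) | z in [set z | En n z /\ `|z - x| < e]]).

Definition limsup_log_prob (x : 'rV[R]_N) (e : R)
    (A : nat -> 'rV[R]_N -> set Om) : \bar R :=
  limn_esup (fun n => ereal_sup
    [set log_prob n z (A n z) | z in [set z | En n z /\ `|z - x| < e]]).

Definition lower_ld_bound (T : R) (I : skorohod N T -> \bar R) :=
  forall (x : 'rV[R]_N) (O : set (skorohod N T)), orthant x -> open O ->
    (- ereal_inf [set I phi | phi in [set phi | O phi /\ phi 0%R = x]] <=
     lim (liminf_log_prob x e (fun n z => path_event n z O) @[e --> 0%R^'+]))%E.

Definition upper_ld_bound (T : R) (I : skorohod N T -> \bar R) :=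
  forall (x : 'rV[R]_N) (F : set (skorohod N T)), orthant x -> closed F ->
    (lim (limsup_log_prob x e (fun n z => path_event n z F) @[e --> 0%R^'+]) <=
     - ereal_inf [set I phi | phi in [set phi | F phi /\ phi 0%R = x]])%E.

Definition sample_path_ldp (T : R) (I : skorohod N T -> \bar R) :=
  [/\ rate_function I, lower_ld_bound I & upper_ld_bound I].

Definition local_lower_bound (L : {set 'I_N} -> 'rV[R]_N -> \bar R) :=
  forall (La : {set 'I_N}) (S : R) (phi : R -> 'rV[R]_N) (v : 'rV[R]_N),
    0 < S ->
    (forall t : R, t \in `[0, S] -> orthant (phi t) /\ phi t = phi 0 + t *: v) ->
    (forall t : R, t \in `]0, S[ -> face La (phi t)) ->
    (- (S%:E * L La v) <=
     lim (lim (liminf_log_prob (phi 0%R) e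
                 (fun n z => [set w |
                    ereal_sup [set `|phi t - Zn n t z w|%:E | t in `[0%R, S]%classic]
                      < delta%:E])
               @[e --> 0%R^'+])
          @[delta --> 0%R^'+]))%E.

Definition local_upper_bound (L : {set 'I_N} -> 'rV[R]_N -> \bar R) :=
  forall (La : {set 'I_N}) (S : R) (x y : 'rV[R]_N),
    0 < S -> face La x -> face La y ->
    (lim (limsup_log_prob x delta
            (fun n z => [set w | (`|Zn n S z w - y| < delta)%R /\
                                 S%:E < hitting_time La n z w])
          @[delta --> 0%R^'+]) <=
     - (S%:E * L La (S^-1 *: (y - x))%R))%E.

End Process.

(* Main.v *)
(* Lower bound: a piecewise linear path crosses finitely many faces; on each
   segment (A1) gives an exponential lower bound for the probability of a thin
   tube, and the Markov property multiplies these bounds. A path close to phi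
   need not start at phi(0), but by (A2) and convexity L is bounded near zero
   velocity in the interior of the orthant, so the starting point can be
   corrected by a short detour whose cost tends to 0.

   Good rate function: comparing the lower bound for I with the upper bound for
   the given rate function on small neighbourhoods of phi gives It <= I, so the
   level sets of I are closed subsets of compact sets.

   Upper bound: where It is large the given upper bound suffices; what remains
   is a compact set of absolutely continuous paths phi, so a local estimate is
   enough. Cut [0, T] into equal cells. In a cell, let s <= t be the extreme
   times at which phi has as few positive coordinates as possible, namely only
   those positive throughout the cell. The tube around phi avoids the faces
   x_i = 0 for these i, hence (A3) applies between s and t. For fine
   subdivisions the discarded times [a, s] and [t, b] have small total length,
   so phi has small total variation on them by absolute continuity, and
   replacing them by detours through the interior turns the estimates into the
   cost of a piecewise linear path close to phi. *)

Require Import Defs.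
From HB Require Import structures.
From mathcomp Require Import all_boot all_order all_algebra.
From mathcomp Require Import all_classical all_reals all_analysis.
From mathcomp Require Import measurable_realfun.
From mathcomp Require Import ring lra zify.

Set Implicit Arguments.
Unset Strict Implicit.
Unset Printing Implicit Defensive.

Import Order.TTheory GRing.Theory Num.Theory.
Import numFieldNormedType.Exports.
Local Open Scope classical_set_scope.
Local Open Scope ring_scope.

(** * The Markov property along tubes *)

(** The Markov property is given only for events at a single later time, whereas the argument needs
    it for tubes. By right continuity a closed tube is the decreasing limit of its restrictions to
    dyadic times, so the Markov property on finite grids passes to the limit.

    The functions [L La] of different faces need not be related to each other, and each may be
    infinite. Hence nothing controls the cost of perturbing a velocity or of moving a path to
    another face: the only affordable moves are slow ones in the interior. Bridging a displacement a
    in this way takes a time proportional to a, so a repaired path lags behind the original one. The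
    modulus of continuity of the original path makes the lag harmless, and the surplus at the end is
    cut off at T, which cannot increase the cost.

    In the upper bound the discarded intervals contribute nothing, their probability being bounded
    by 1, whereas the action of the approximating path pays for them in full. The proof lives on the
    fact that the difference, proportional to the total size of the gaps, can be made smaller than
    any given margin. *)

Section Disintegration.
Local Open Scope ereal_scope.
Context d1 d2 (Y : measurableType d1) (Z : measurableType d2) (R : realType).
Variables (nu : {measure set Y -> \bar R}) (D : set Y) (phi : Y -> Z)
  (k : Y -> {measure set Z -> \bar R}).
Hypotheses (mD : measurable D) (mphi : measurable_fun [set: Y] phi)
  (mk : forall A : set Z, measurable A ->
     measurable_fun [set: Y] (fun y => k y A : \bar R))
  (nuE : forall A, measurable A ->
     nu (D `&` phi @^-1` A) = \int[nu]_(y in D) k y A).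

Import HBNNSimple.

Let mkD A : measurable A -> measurable_fun D (fun y => k y A : \bar R).
Proof. by move=> mA; apply: measurable_funTS; exact: mk. Qed.

Let disint_nnsfun (f : {nnsfun Z >-> R}) :
  \int[nu]_(y in D) (f (phi y))%:E = \int[nu]_(y in D) \int[k y]_z (f z)%:E.
Proof.
have fE (m : {measure set Z -> \bar R}) :
    \int[m]_z (f z)%:E = \sum_(r \in range f) r%:E * m (f @^-1` [set r]).
  by rewrite integralT_nnsfun sintegralE.
under [RHS]eq_integral do rewrite fE.
have f0 (m : {measure set Z -> \bar R}) r : 0 <= r%:E * m (f @^-1` [set r]).
  have [r0|r0] := leP 0%R r; first by rewrite mule_ge0 ?lee_fin.
  by rewrite preimage_nnfun0// measure0 mule0.
rewrite ge0_integral_fsum//; last first.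
  by move=> r; apply: measurable_funeM; exact: mkD.
under eq_integral do rewrite fimfunE -fsumEFin//.
have mi (A : set Z) : measurable A -> measurable_fun D (fun y => (\1_A (phi y))%:E : \bar R).
  move=> mA; apply/measurable_EFinP; apply: measurable_funTS.
  by apply: (measurableT_comp _ mphi); exact: measurable_indic.
rewrite ge0_integral_fsum//.
- apply: eq_fsbigr => r _.
  have [r0|r0] := leP 0%R r.
    rewrite [RHS]ge0_integralZl//; last exact: mkD.
    under eq_integral do rewrite EFinM.
    rewrite ge0_integralZl//; last exact: mi.
    by rewrite -nuE// setIC -integral_indic//; rewrite -[X in measurable X]setTI; exact: mphi.
  rewrite preimage_nnfun0// !integral0_eq//.
  - by move=> y _; rewrite measure0 mule0.
  - by move=> y _; rewrite indic0 mulr0.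
- by move=> r; under eq_fun do rewrite EFinM; apply: measurable_funeM; exact: mi.
- by move=> r y _; rewrite EFinM nnfun_muleindic_ge0.
Qed.

(** Extends the Markov identity from indicators, for which it is assumed, to nonnegative functions,
    as the iteration of kernels requires. *)
Lemma integral_disintegration (f : Z -> \bar R) :
  (forall z, 0 <= f z) -> measurable_fun [set: Z] f ->
  \int[nu]_(y in D) f (phi y) = \int[nu]_(y in D) \int[k y]_z f z.
Proof.
move=> f0 mf; pose f_ := nnsfun_approx measurableT mf.
have mf_ n : measurable_fun [set: Z] (EFin \o f_ n) by exact/measurable_EFinP.
have ndf_ z : {homo (fun n => (f_ n z)%:E) : a b / (a <= b)%N >-> a <= b}.
  by move=> a b ab; rewrite lee_fin; exact/lefP/nd_nnsfun_approx.
have fE z : f z = limn (fun n => (f_ n z)%:E).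
  by apply/esym/cvg_lim => //; exact: cvg_nnsfun_approx.
have kE y : \int[k y]_z f z = limn (fun n => \int[k y]_z (f_ n z)%:E).
  rewrite -monotone_convergence//.
    by apply: eq_integral => z _; exact: fE.
  by move=> n z _; rewrite lee_fin.
under [LHS]eq_integral do rewrite fE.
under [RHS]eq_integral do rewrite kE.
rewrite !monotone_convergence//.
- by congr (limn _); apply/funext => n; exact: disint_nnsfun.
- move=> n; apply: measurable_funTS; apply: measurable_fun_integral_kernel => //.
  - by move=> z; rewrite lee_fin.
  - exact: mf_.
- by move=> n y _; apply: integral_ge0 => z _; rewrite lee_fin.
- move=> y _ a b ab; apply: ge0_le_integral => //.
  + by move=> z _; rewrite lee_fin.
  + exact: mf_.
  + exact: mf_.
  + by move=> z _; exact: ndf_.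
- by move=> n; apply: measurable_funTS; exact: (measurableT_comp (mf_ n) mphi).
- by move=> n y _; rewrite lee_fin.
Qed.

End Disintegration.

Lemma cvg_at_right_distP (R : realType) (V : normedModType R) (f : R -> V) (t : R) (l : V) :
  f u @[u --> t^'+] --> l <->
  forall e : R, 0 < e -> exists2 d : R, 0 < d &
    forall u, t < u < t + d -> `|l - f u| < e.
Proof.
split=> [/cvgrPdist_lt h e e0|h].
  have /nbhs_ballP[d d0 hd] := h e e0; exists d => // u /andP[tu utd].
  by apply: hd => //=; rewrite /ball/= distrC gtr0_norm ?subr_gt0// ltrBlDl.
apply/cvgrPdist_lt => e /h[d d0 hd]; apply/nbhs_ballP; exists d => //= u.
rewrite /ball/= distrC => utd tu; apply: hd; rewrite tu/=.
by move: utd; rewrite gtr0_norm ?subr_gt0// ltrBlDl.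
Qed.

Lemma cvg_at_left_distP (R : realType) (V : normedModType R) (f : R -> V) (t : R) (l : V) :
  f u @[u --> t^'-] --> l <->
  forall e : R, 0 < e -> exists2 d : R, 0 < d &
    forall u, t - d < u < t -> `|l - f u| < e.
Proof.
split=> [/cvgrPdist_lt h e e0|h].
  have /nbhs_ballP[d d0 hd] := h e e0; exists d => // u /andP[tu utd].
  by apply: hd => //=; rewrite /ball/= gtr0_norm ?subr_gt0// ltrBlDl -ltrBlDr.
apply/cvgrPdist_lt => e /h[d d0 hd]; apply/nbhs_ballP; exists d => //= u.
rewrite /ball/= => utd tu; apply: hd; rewrite tu andbT.
by move: utd; rewrite gtr0_norm ?subr_gt0// ltrBlDl -ltrBlDr.
Qed.

(** Right continuity can only use points strictly to the right of [t]; [b <= S] keeps them in the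
    grid of [0, S]. *)
Lemma dyadic_between (R : realType) (S t b : R) : 0 <= t -> t < b -> b <= S ->
  exists m i, (i <= 2 ^ m)%N /\ t < i%:R * (S / (2 ^ m)%:R) < b.
Proof.
move=> t0 tb bS; have S0 : 0 < S by rewrite (lt_le_trans _ bS)// (le_lt_trans t0).
have bt : 0 < b - t by rewrite subr_gt0.
pose m := (Num.truncn (S / (b - t))).+1.
have m0 : 0 < (2 ^ m)%:R :> R by rewrite ltr0n expn_gt0.
have Sm : S / (2 ^ m)%:R < b - t.
  rewrite ltr_pdivrMr// mulrC -ltr_pdivrMr//.
  have /andP[_ /lt_le_trans] := truncn_itv (divr_ge0 (ltW S0) (ltW bt)); apply.
  by rewrite ler_nat ltnW// ltn_expl.
have tS0 : 0 <= t * (2 ^ m)%:R / S by rewrite divr_ge0// ?mulr_ge0// ltW.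
have /andP[h1 h2] := truncn_itv tS0.
pose i := (Num.truncn (t * (2 ^ m)%:R / S)).+1.
have ti : t < i%:R * (S / (2 ^ m)%:R).
  by rewrite mulrA ltr_pdivlMr// -ltr_pdivrMr.
have ib : i%:R * (S / (2 ^ m)%:R) < b.
  rewrite /i -natr1 mulrDl mul1r -ltrBrDr.
  apply: le_lt_trans (_ : t < _); last by rewrite ltrBrDr addrC -ltrBrDr.
  by rewrite mulrA ler_pdivrMr// -ler_pdivlMr.
exists m, i; split; last by rewrite ti.
have := lt_le_trans ib bS; rewrite mulrCA gtr_pMr// ltr_pdivrMr// mul1r.
by rewrite ltr_nat => /ltnW.
Qed.

Section Markov.
Context {R : realType} {N : nat} {d : measure_display} {Om : measurableType d}.
Context {E : set 'rV[R]_N} {P : 'rV[R]_N -> probability Om R}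
  {X : R -> 'rV[R]_N -> Om -> 'rV[R]_N}
  {K : R -> R.-pker (borelRV R N) ~> (borelRV R N)}.
Hypothesis hX : markov_process E P X K.
Implicit Types (s t u h r S : R) (x y z : 'rV[R]_N).

Lemma history_measurable x s B : E x -> history X x s B -> measurable B.
Proof.
move=> Ex; apply: smallest_sub => //; first exact: sigma_algebra_measurable.
move=> _ [u [A [/andP[u0 us] mA ->]]].
by rewrite -[_ @^-1` _]setTI; exact: (markov_meas hX).
Qed.

Lemma historyI x s B C : history X x s B -> history X x s C ->
  history X x s (B `&` C).
Proof.
exact: (@measurableI _ (g_sigma_algebraType _)).
Qed.

Lemma historyT x s : history X x s setT.
Proof. exact: (@measurableT _ (g_sigma_algebraType _)). Qed.

Lemma history_bigcap x s (B : nat -> set Om) :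
  (forall n, history X x s (B n)) -> history X x s (\bigcap_n B n).
Proof. by move=> h; apply: (@bigcapT_measurable _ (g_sigma_algebraType _)). Qed.

Lemma historyS x s t : s <= t -> history X x s `<=` history X x t.
Proof.
move=> st; apply: sub_smallest2r; first exact: smallest_sigma_algebra.
move=> B [u [A [/andP[u0 us] mA ->]]]; exists u, A; split => //.
by rewrite u0 (le_trans us).
Qed.

Lemma history_state x s u (A : set (borelRV R N)) : 0 <= u <= s ->
  measurable A -> history X x s (X u x @^-1` A).
Proof. by move=> us mA; apply: sub_gen_smallest; exists u, A. Qed.

Lemma markov_integral x s t (f : borelRV R N -> \bar R) B :
  E x -> 0 <= s -> 0 <= t -> (forall y, 0 <= f y)%E ->
  measurable_fun setT f -> history X x s B ->
  (\int[P x]_(w in B) f (X (s + t) x w) =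
   \int[P x]_(w in B) \int[K t (X s x w)]_y f y)%E.
Proof.
move=> Ex s0 t0 f0 mf hB.
have mB : measurable B by exact: history_measurable hB.
have st0 : 0 <= s + t by rewrite addr_ge0.
have mXs : measurable_fun setT (X s x : Om -> borelRV R N).
  exact: (markov_meas hX).
apply: (@integral_disintegration _ _ _ _ _ _ _ _ (fun w => K t (X s x w))) => //.
- exact: (markov_meas hX).
- by move=> A mA; exact: (measurableT_comp (measurable_kernel (K t) _ mA) mXs).
- by move=> A mA; exact: (markov_prop hX).
Qed.

Let meas_state x s : E x -> 0 <= s ->
  measurable_fun setT (X s x : Om -> borelRV R N).
Proof. by move=> Ex s0; exact: (markov_meas hX). Qed.

(** [q y] is the probability that the process started at [y] meets the sets [A i] on the grid, built
    by recursion on the first step: the indicator of [A 0] times the integral under [K h y] of the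
    function of the shifted sequence. It does not depend on [x], [s] and [B], so that it can be
    identified later by taking [s = 0]. *)
Lemma markov_grid h k (A : nat -> set (borelRV R N)) : 0 <= h ->
  (forall i, measurable (A i)) ->
  exists q : borelRV R N -> \bar R,
    [/\ measurable_fun setT q, forall y, (0 <= q y)%E &
     forall x s B, E x -> 0 <= s -> history X x s B ->
     (P x (B `&` [set w | forall i, (i <= k)%N -> A i (X (s + i%:R * h) x w)])
      = \int[P x]_(w in B) q (X s x w))%E].
Proof.
move=> h0; elim: k A => [|k IHk] A mA.
  exists (fun y => (\1_(A 0%N) y)%:E); split.
  - by apply/measurable_EFinP; exact: measurable_indic.
  - by move=> y; rewrite lee_fin.
  - move=> x s B Ex s0 hB.
    have mB : measurable B by exact: history_measurable hB.
    rewrite (eq_integral (fun w => (\1_(X s x @^-1` A 0%N) w)%:E))//.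
    rewrite integral_indic//.
      rewrite setIC; congr (P x (_ `&` B)); apply/seteqP; split => [w /=|w /= Aw i].
        by move=> /(_ 0%N isT); rewrite mul0r addr0.
      by rewrite leqn0 => /eqP ->; rewrite mul0r addr0.
    by rewrite -[X in measurable X]setTI; exact: meas_state.
have [q [mq q0 qE]] := IHk (A \o S) (fun i => mA i.+1).
pose g y := (\int[K h y]_u q u)%E.
have mg : measurable_fun setT (g : borelRV R N -> \bar R).
  apply: measurable_fun_integral_kernel => //.
  by move=> U mU; exact: measurable_kernel.
have g0 y : (0 <= g y)%E by apply: integral_ge0.
exists (fun y => (\1_(A 0%N) y)%:E * g y)%E; split.
- by apply: emeasurable_funM => //; apply/measurable_EFinP; exact: measurable_indic.
- by move=> y; rewrite mule_ge0// lee_fin.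
- move=> x s B Ex s0 hB.
  have mB : measurable B by exact: history_measurable hB.
  pose A0 := X s x @^-1` A 0%N.
  have hA0 : history X x s A0 by apply: history_state => //; rewrite s0 lexx.
  have -> : B `&` [set w | forall i, (i <= k.+1)%N -> A i (X (s + i%:R * h) x w)]
    = (B `&` A0) `&`
      [set w | forall i, (i <= k)%N -> (A \o S) i (X ((s + h) + i%:R * h) x w)].
    apply/seteqP; split=> w /=.
      move=> [Bw h1]; split; first split => //.
        by have := h1 0%N isT; rewrite mul0r addr0.
      move=> i ik; have := h1 i.+1 ik; congr (A _ (X _ _ _)).
      by rewrite -natr1 mulrDl mul1r -addrA (addrC h).
    move=> [[Bw A0w] h1]; split => // -[_|i ik]; first by rewrite mul0r addr0.
    have := h1 i ik; congr (A _ (X _ _ _)).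
    by rewrite -natr1 mulrDl mul1r -addrA (addrC h).
  rewrite qE//; last 2 first.
  - by rewrite addr_ge0.
  - by apply: (@historyS _ s); [rewrite lerDl|exact: historyI].
  rewrite (markov_integral Ex s0 h0 q0 mq (historyI hB hA0)) -/g.
  rewrite integral_mkcondr; apply: eq_integral => w _.
  rewrite /patch indicE /A0.
  have -> : (w \in X s x @^-1` A 0%N) = (X s x w \in A 0%N) by [].
  by case: ifP => _; rewrite ?mul1e ?mul0e.
Qed.

Lemma En_state n z : (0 < n)%N -> En E n z -> E (n%:R *: z).
Proof.
move=> n0 [x Ex <-]; rewrite scalerA divff ?scale1r//.
by rewrite pnatr_eq0 -lt0n.
Qed.

Lemma scale_Zn n t z w : (0 < n)%N ->
  n%:R *: Zn X n t z w = X (n%:R * t) (n%:R *: z) w.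
Proof.
by move=> n0; rewrite /Zn scalerA divff ?scale1r// pnatr_eq0 -lt0n.
Qed.

Lemma Zn_En n t z w : (0 < n)%N -> 0 <= t -> En E n z -> En E n (Zn X n t z w).
Proof.
move=> n0 t0 Ez; exists (X (n%:R * t) (n%:R *: z) w) => //.
by apply: (markov_state hX); [exact: En_state|rewrite mulr_ge0].
Qed.

(** Time in [f] is counted from the start [s] of the tube, which suits restarting the process. The
    non-strict bound is the one that passes to limits of times. *)
Definition tube n s S (f : R -> 'rV[R]_N) r z : set Om :=
  [set w | forall t, 0 <= t <= S -> `|Zn X n (s + t) z w - f t| <= r].

Definition gridtube m n s S (f : R -> 'rV[R]_N) r z : set Om :=
  [set w | forall i, (i <= 2 ^ m)%N ->
    `|Zn X n (s + i%:R * (S / (2 ^ m)%:R)) z w - f (i%:R * (S / (2 ^ m)%:R))| <= r].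

Definition right_continuous_on S (f : R -> 'rV[R]_N) :=
  forall t, 0 <= t < S -> f u @[u --> t^'+] --> f t.

Lemma Zn_right_continuous n s z w : (0 < n)%N -> 0 <= s -> En E n z ->
  forall t, 0 <= t -> Zn X n (s + u) z w @[u --> t^'+] --> Zn X n (s + t) z w.
Proof.
move=> n0 s0 Ez t t0; have nR : 0 < n%:R :> R by rewrite ltr0n.
have [+ _] := markov_paths hX w (En_state n0 Ez).
move=> /(_ (n%:R * (s + t))); rewrite mulr_ge0 ?addr_ge0// ltry => /(_ isT isT).
move=> /cvg_at_right_distP h; apply/cvg_at_right_distP => e e0.
have [a a0 ha] := h (n%:R * e) (mulr_gt0 nR e0).
exists (a / n%:R) => [|u /andP[tu utd]]; first by rewrite divr_gt0.
rewrite /Zn -scalerBr normrZ ger0_norm ?invr_ge0// ltr_pdivrMl//.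
apply: ha; rewrite ltr_pM2l// ltrD2l tu/= -ltr_pdivlMl//.
rewrite mulrDr mulKf ?gt_eqF// -addrA ltrD2l (lt_le_trans utd)// lerD2l mulrC//.
Qed.

Lemma gridtube_nonincreasing m n s S f r z :
  gridtube m.+1 n s S f r z `<=` gridtube m n s S f r z.
Proof.
move=> w h i im.
have := h (2 * i)%N; rewrite expnS leq_mul2l/= im => /(_ isT).
have -> : (2 * i)%N%:R * (S / (2 * 2 ^ m)%N%:R) = i%:R * (S / (2 ^ m)%:R) :> R.
  by rewrite !natrM; field; rewrite pnatr_eq0 expn_eq0.
by [].
Qed.

Lemma tube_bigcap n s S f r z : (0 < n)%N -> 0 <= s -> 0 <= S -> En E n z ->
  right_continuous_on S f ->
  tube n s S f r z = \bigcap_m gridtube m n s S f r z.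
Proof.
move=> n0 s0 S0 Ez hf; apply/seteqP; split => [w h m _ i im|w h t /andP[t0]].
  apply: h; rewrite mulr_ge0 ?divr_ge0//= mulrCA ler_piMr//.
  by rewrite ler_pdivrMr ?mul1r ?ler_nat// ltr0n expn_gt0.
rewrite le_eqVlt => /predU1P[->|tS].
  (* [S] is itself a grid point ([m = 0], [i = 1]), so right continuity is only used before [S]. *)
  by have := h 0%N I 1%N isT; rewrite expn0 divr1 mul1r.
rewrite leNgt; apply/negP => rlt.
(* Half of the excess: the process and [f] may each move by less than [e] without re-entering the
   radius [r]. *)
pose e := (`|Zn X n (s + t) z w - f t| - r) / 2.
have e0 : 0 < e by rewrite divr_gt0// subr_gt0.
have /cvg_at_right_distP/(_ e e0)[d1 d10 h1] := @Zn_right_continuous n s z w n0 s0 Ez t t0.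
have tS' : 0 <= t < S by rewrite t0.
have /cvg_at_right_distP/(_ e e0)[d2 d20 h2] := hf _ tS'.
have tb : t < Num.min S (Num.min (t + d1) (t + d2)).
  by rewrite !lt_min tS !ltrDl d10 d20.
have bS : Num.min S (Num.min (t + d1) (t + d2)) <= S by rewrite ge_min lexx.
have [m [i [im /andP[ti]]]] := dyadic_between t0 tb bS.
rewrite !lt_min => /and3P[iS id1 id2].
have /h1 k1 : t < i%:R * (S / (2 ^ m)%:R) < t + d1 by rewrite ti.
have /h2 k2 : t < i%:R * (S / (2 ^ m)%:R) < t + d2 by rewrite ti.
have k3 := h m I i im.
move: k1 k2 k3; set u := i%:R * _; set a := Zn _ _ _ _ _; set b := Zn _ _ _ _ _.
move=> k1 k2 k3.
have h3 := ler_distD b a (f t); have h4 := ler_distD (f u) b (f t).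
by move: k1 k2 k3 h3 h4; rewrite /e -/a (distrC (f u)); lra.
Qed.

Lemma measurable_tube_state n (a : 'rV[R]_N) r :
  measurable ([set y | `|n%:R^-1 *: y - a| <= r] : set (borelRV R N)).
Proof.
rewrite -[X in measurable X]setCK; apply: measurableC; apply: sub_gen_smallest.
apply: closed_openC.
rewrite (_ : [set y | _] = (fun y : 'rV[R]_N => `|n%:R^-1 *: y - a|) @^-1` [set v | v <= r])//.
apply: preimage_closed; last exact: closed_le.
move=> y _; apply: continuous_comp; last exact: norm_continuous.
apply: continuousB; last exact: cst_continuous.
exact: (@scaler_continuous R 'rV[R]_N).
Qed.

Lemma history_gridtube m n s S f r z t : (0 < n)%N -> 0 <= s -> 0 <= S ->
  En E n z -> s + S <= t -> history X (n%:R *: z) (n%:R * t) (gridtube m n s S f r z).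
Proof.
move=> n0 s0 S0 Ez st.
rewrite (_ : gridtube _ _ _ _ _ _ _ = \bigcap_i
   (if (i <= 2 ^ m)%N then
     X (n%:R * (s + i%:R * (S / (2 ^ m)%:R))) (n%:R *: z) @^-1`
      [set y | `|n%:R^-1 *: y - f (i%:R * (S / (2 ^ m)%:R))| <= r] else setT)).
  apply: history_bigcap => i; case: ifPn => [im|_]; last exact: historyT.
  apply: history_state; last exact: measurable_tube_state.
  rewrite ler_pM2l ?ltr0n// mulr_ge0//=; last first.
    by rewrite addr_ge0// mulr_ge0// divr_ge0.
  rewrite (le_trans _ st)// lerD2l mulrCA ler_piMr//.
  by rewrite ler_pdivrMr ?mul1r ?ler_nat// ltr0n expn_gt0.
apply/seteqP; split=> [w h i _|w h i im]; first by case: ifPn => // im; exact: h.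
by have := h i I; rewrite im.
Qed.

Lemma history_tube n s S f r z t : (0 < n)%N -> 0 <= s -> 0 <= S ->
  right_continuous_on S f ->
  En E n z -> s + S <= t -> history X (n%:R *: z) (n%:R * t) (tube n s S f r z).
Proof.
move=> n0 s0 S0 hf Ez st; rewrite tube_bigcap//.
by apply: history_bigcap => m; exact: history_gridtube.
Qed.

Lemma measurable_tube n s S f r z : (0 < n)%N -> 0 <= s -> 0 <= S ->
  right_continuous_on S f -> En E n z -> measurable (tube n s S f r z).
Proof.
move=> n0 s0 S0 hf Ez; apply: (@history_measurable (n%:R *: z)); first exact: En_state.
by apply: (@history_tube _ _ _ _ _ _ (s + S)).
Qed.

Lemma cvg_gridtube n s S f r z B : (0 < n)%N -> 0 <= s -> 0 <= S ->
  right_continuous_on S f -> En E n z -> measurable B ->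
  P (n%:R *: z) (B `&` gridtube m n s S f r z) @[m --> \oo] -->
  P (n%:R *: z) (B `&` tube n s S f r z).
Proof.
move=> n0 s0 S0 hf Ez mB; rewrite tube_bigcap//.
have mG m : measurable (B `&` gridtube m n s S f r z).
  apply: measurableI => //; apply: (@history_measurable (n%:R *: z)).
    exact: En_state.
  exact: (@history_gridtube _ _ _ _ _ _ _ (s + S)).
have -> : B `&` \bigcap_m gridtube m n s S f r z =
    \bigcap_m (B `&` gridtube m n s S f r z).
  apply/seteqP; split=> [w [Bw h] m _|w h]; first by split => //; exact: h.
  by split=> [|m _]; [case: (h 0%N I)|case: (h m I)].
apply: (@nonincreasing_cvg_mu _ _ _ (P (n%:R *: z)) (fun m => B `&` gridtube m n s S f r z)) => //.
- by rewrite (le_lt_trans (probability_le1 _ _))// ltry.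
- exact: bigcapT_measurable.
- apply/nonincreasing_seqP => m; apply/subsetPset; apply: setIS.
  exact: gridtube_nonincreasing.
Qed.

(** At the states of [En] the grid functions converge to the tube probability; elsewhere nothing is
    known. Their upper limit is measurable on the whole space and agrees with the limit on [En], and
    bounded convergence passes the Markov identity from grids to tubes. *)
Lemma markov_tube n S f r : (0 < n)%N -> 0 <= S -> right_continuous_on S f ->
  exists q : borelRV R N -> \bar R,
    [/\ measurable_fun setT q,
     forall z, En E n z -> q (n%:R *: z) = P (n%:R *: z) (tube n 0 S f r z) &
     forall z s B, En E n z -> 0 <= s -> history X (n%:R *: z) (n%:R * s) B ->
     (P (n%:R *: z) (B `&` tube n s S f r z)
      = \int[P (n%:R *: z)]_(w in B) q (X (n%:R * s)%R (n%:R *: z) w))%E].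
Proof.
move=> n0 S0 hf; have nR : 0 < n%:R :> R by rewrite ltr0n.
have grid m : exists q : borelRV R N -> \bar R,
    [/\ measurable_fun setT q, forall y, (0 <= q y)%E &
     forall z s B, En E n z -> 0 <= s -> history X (n%:R *: z) (n%:R * s) B ->
     (P (n%:R *: z) (B `&` gridtube m n s S f r z)
      = \int[P (n%:R *: z)]_(w in B) q (X (n%:R * s)%R (n%:R *: z) w))%E].
  have h0 : 0 <= n%:R * (S / (2 ^ m)%:R) by rewrite mulr_ge0// divr_ge0.
  pose A i := [set y : 'rV[R]_N | `|n%:R^-1 *: y - f (i%:R * (S / (2 ^ m)%:R))| <= r].
  have [q [mq q0 qE]] := @markov_grid _ (2 ^ m)%N A h0 (fun i => measurable_tube_state _ _ _).
  exists q; split => // z s B Ez s0 hB; rewrite -qE//; last 2 first.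
  - exact: En_state.
  - by rewrite mulr_ge0// ltW.
  congr (P _ (B `&` _)); apply/seteqP; split => w /= h i im; have := h i im;
    by rewrite /A/= /Zn (mulrDr n%:R) (mulrCA n%:R i%:R).
have {grid}[q qP] := choice grid.
(* At time 0 the integrand is almost surely the constant [q m (n%:R *: z)]. *)
have qE m z : En E n z -> q m (n%:R *: z) = P (n%:R *: z) (gridtube m n 0 S f r z).
  move=> Ez; have hT : history X (n%:R *: z) (n%:R * 0) setT by exact: historyT.
  have [mq q0 /(_ z 0 setT Ez (lexx _) hT)] := qP m.
  rewrite setTI => ->; rewrite -[LHS]mule1 -(@probability_setT _ _ _ (P (n%:R *: z))).
  rewrite -integral_cst//; apply: ae_eq_integral => //.
  - apply: (measurableT_comp mq); apply: meas_state; first exact: En_state.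
    by rewrite mulr0.
  - have := markov_init hX (En_state n0 Ez); apply: filterS => w /=.
    by rewrite mulr0 => ->.
exists (fun y => limn_esup (q ^~ y)); split.
- apply: measurable_fun_limn_esup => m; by case: (qP m).
- move=> z Ez.
  have := @cvg_gridtube n 0 S f r z setT n0 (lexx _) S0 hf Ez measurableT.
  under eq_cvg do rewrite setTI -qE//.
  by rewrite setTI => /cvg_limn_einf_sup[].
move=> z s B Ez s0 hB.
have Ez' := En_state n0 Ez.
have mB : measurable B by exact: history_measurable hB.
have c1 := @cvg_gridtube n s S f r z B n0 s0 S0 hf Ez mB.
have XE w : X (n%:R * s) (n%:R *: z) w = n%:R *: Zn X n s z w by rewrite scale_Zn.
have ms : measurable_fun setT (X (n%:R * s) (n%:R *: z) : Om -> borelRV R N).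
  by apply: meas_state => //; rewrite mulr_ge0// ltW.
have c2 : (\int[P (n%:R *: z)]_(w in B) q m (X (n%:R * s)%R (n%:R *: z) w))%E @[m --> \oo]
   --> (\int[P (n%:R *: z)]_(w in B) limn_esup (q ^~ (X (n%:R * s)%R (n%:R *: z) w)))%E.
  apply: (@dominated_cvg _ _ _ _ _ mB _ _ (cst 1%E)).
  - move=> m; apply: measurable_funTS; apply: (measurableT_comp _ ms).
    by case: (qP m).
  - move=> w _; rewrite XE; set y := Zn _ _ _ _ _.
    have Ey : En E n y by exact: Zn_En.
    have := @cvg_gridtube n 0 S f r y setT n0 (lexx _) S0 hf Ey measurableT.
    under eq_cvg do rewrite setTI -qE//.
    by move=> c; rewrite (cvg_limn_einf_sup c).2.
  - by [].
  - by apply: finite_measure_integrable_cst.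
  - move=> m w _; rewrite XE qE; last exact: Zn_En.
    rewrite gee0_abs//; set y := Zn _ _ _ _ _.
    have Ey : En E n y by exact: Zn_En.
    apply: probability_le1; apply: (@history_measurable (n%:R *: y)).
      exact: En_state.
    by apply: (@history_gridtube _ _ _ _ _ _ _ S) => //; rewrite add0r.
apply: cvg_unique c1 _ => //; move: c2.
under eq_cvg => m do [have [_ _ <-//] := qP m].
by [].
Qed.

(** The product rule for exponential bounds. The second estimate must hold from every state reached
    on [B], which is why bounds uniform over a ball of starting points are carried throughout. *)
Lemma tube_ge n s S f r z B (b : \bar R) : (0 < n)%N -> 0 <= s -> 0 <= S ->
  right_continuous_on S f -> En E n z -> history X (n%:R *: z) (n%:R * s) B ->
  (0 <= b)%E ->
  (forall w, B w -> (b <= P (n%:R *: Zn X n s z w) (tube n 0 S f r (Zn X n s z w)))%E) ->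
  (b * P (n%:R *: z) B <= P (n%:R *: z) (B `&` tube n s S f r z))%E.
Proof.
move=> n0 s0 S0 hf Ez hB b0 hb.
have mB : measurable B by apply: history_measurable hB; exact: En_state.
have [q [mq qE ->//]] := markov_tube r n0 S0 hf.
rewrite -integral_cst//; apply: ge0_le_integral => //.
- apply: measurable_funTS; apply: (measurableT_comp mq).
  by apply: meas_state; [exact: En_state|rewrite mulr_ge0].
- by move=> w Bw; rewrite -scale_Zn// qE; [exact: hb|exact: Zn_En].
Qed.

Lemma tube_le n s S f r z B (b : \bar R) : (0 < n)%N -> 0 <= s -> 0 <= S ->
  right_continuous_on S f -> En E n z -> history X (n%:R *: z) (n%:R * s) B ->
  (0 <= b)%E ->
  (forall w, B w -> (P (n%:R *: Zn X n s z w) (tube n 0 S f r (Zn X n s z w)) <= b)%E) ->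
  (P (n%:R *: z) (B `&` tube n s S f r z) <= b * P (n%:R *: z) B)%E.
Proof.
move=> n0 s0 S0 hf Ez hB b0 hb.
have mB : measurable B by apply: history_measurable hB; exact: En_state.
have [q [mq qE ->//]] := markov_tube r n0 S0 hf.
rewrite -integral_cst//; apply: ge0_le_integral => //.
- move=> w Bw; rewrite -scale_Zn// qE ?measure_ge0//; exact: Zn_En.
- apply: measurable_funTS; apply: (measurableT_comp mq).
  by apply: meas_state; [exact: En_state|rewrite mulr_ge0].
- by move=> w Bw; rewrite -scale_Zn// qE; [exact: hb|exact: Zn_En].
Qed.

End Markov.
Arguments tube {R N d Om} X n s S f r z _.

(** * Exponential bounds *)

Section Limits.
Context {R : realType}.
Local Open Scope ereal_scope.
Implicit Types (u : nat -> \bar R) (c : \bar R) (f : R -> \bar R).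

Lemma limn_esup_lt u c : limn_esup u < c -> \forall n \near \oo, u n < c.
Proof.
move=> /ereal_inf_lt[_ [V VF <-]] h; near=> n.
apply: le_lt_trans h; apply: ereal_sup_ubound; exists n => //.
by near: n.
Unshelve. all: by end_near. Qed.

Lemma limn_esup_le u c : (\forall n \near \oo, u n <= c) -> limn_esup u <= c.
Proof.
move=> h; apply: (@le_trans _ _ (ereal_sup [set u n | n in [set n | u n <= c]])).
  by apply: ereal_inf_lbound; exists [set n | u n <= c].
by apply: ge_ereal_sup => _ [n /= un <-].
Qed.

Lemma limn_esup_homo u v : (\forall n \near \oo, u n <= v n) ->
  limn_esup u <= limn_esup v.
Proof.
move=> uv; apply: le_ereal_inf_tmp => _ [V VF <-].
apply: (@le_trans _ _ (ereal_sup [set u n | n in V `&` [set n | u n <= v n]])).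
  by apply: ereal_inf_lbound; exists (V `&` [set n | u n <= v n]) => //; exact: filterI.
apply: ge_ereal_sup => _ [n [Vn /= uvn] <-]; apply: (le_trans uvn).
by apply: ereal_sup_ubound; exists n.
Qed.

Lemma limn_einf_homo u v : (\forall n \near \oo, u n <= v n) ->
  limn_einf u <= limn_einf v.
Proof.
move=> uv; rewrite /limn_einf leeN2; apply: limn_esup_homo.
by apply: filterS uv => n; rewrite leeN2.
Qed.

Lemma limn_einf_gt u c : c < limn_einf u -> \forall n \near \oo, c < u n.
Proof.
rewrite /limn_einf lteNr => /limn_esup_lt; apply: filterS => n.
by rewrite lteN2.
Qed.

Lemma limn_einf_ge u c : (\forall n \near \oo, c <= u n) -> c <= limn_einf u.
Proof.
move=> h; rewrite /limn_einf leeNr; apply: limn_esup_le; apply: filterS h => n.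
by rewrite leeN2.
Qed.

(** Each limit at 0 in the definitions is monotone in its parameter, hence exists and is a supremum
    or an infimum. *)
Lemma lim_right0_nonincreasing f :
  (forall a b : R, (0 < a)%R -> (a <= b)%R -> f b <= f a) ->
  lim (f e @[e --> 0%R^'+]) = ereal_sup [set f e | e in [set e | (0 < e)%R]].
Proof.
move=> h; apply/cvg_lim => //.
have := @nonincreasing_at_right_cvge R f 0%R (BInfty _ false) isT.
rewrite set_itvoy; apply => a b; rewrite !in_itv/= !andbT => a0 b0 ab.
exact: h.
Qed.

Lemma lim_right0_nondecreasing f :
  (forall a b : R, (0 < a)%R -> (a <= b)%R -> f a <= f b) ->
  lim (f e @[e --> 0%R^'+]) = ereal_inf [set f e | e in [set e | (0 < e)%R]].
Proof.
move=> h; apply/cvg_lim => //.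
have := @nondecreasing_at_right_cvge R f 0%R (BInfty _ false) isT.
rewrite set_itvoy; apply => a b; rewrite !in_itv/= !andbT => a0 b0 ab.
exact: h.
Qed.

End Limits.

Section LogProb.
Context {R : realType} {N : nat} {d : measure_display} {Om : measurableType d}.
Context {E : set 'rV[R]_N} {P : 'rV[R]_N -> probability Om R}.
Implicit Types (c e : R) (x z : 'rV[R]_N).

Lemma mu_ext_prob_ge0 z (A : set Om) : (0 <= mu_ext (P z) A)%E.
Proof. exact: outer_measure_ge0. Qed.

Lemma log_prob_ge n z (A : set Om) c : (0 < n)%N ->
  ((- c)%:E <= log_prob P n z A)%E =
  ((expR (- (n%:R * c)))%:E <= mu_ext (P (n%:R *: z)) A)%E.
Proof.
move=> n0; have nR : 0 < n%:R :> R by rewrite ltr0n.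
rewrite /log_prob lee_pdivlMl// -EFinM mulrN -[LHS]lee_expeR lneK//.
by rewrite in_itv/= mu_ext_prob_ge0 leey.
Qed.

Lemma log_prob_le n z (A : set Om) c : (0 < n)%N ->
  (log_prob P n z A <= (- c)%:E)%E =
  (mu_ext (P (n%:R *: z)) A <= (expR (- (n%:R * c)))%:E)%E.
Proof.
move=> n0; have nR : 0 < n%:R :> R by rewrite ltr0n.
rewrite /log_prob lee_pdivrMl// -EFinM mulrN -[LHS]lee_expeR lneK//.
by rewrite in_itv/= mu_ext_prob_ge0 leey.
Qed.

Lemma log_probS n z (A B : set Om) : (0 < n)%N -> A `<=` B ->
  (log_prob P n z A <= log_prob P n z B)%E.
Proof.
move=> n0 AB; rewrite /log_prob lee_pmul2l ?lte_fin ?invr_gt0 ?ltr0n//.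
rewrite lee_lne ?in_itv/= ?mu_ext_prob_ge0 ?leey//.
exact: le_outer_measure.
Qed.

(** With an explicit radius and all large [n], such bounds can be multiplied and added. Strict
    inequalities between limits yield them, and they yield back non-strict ones, so rates are
    compared up to an arbitrarily small loss. *)
Definition exp_lower x (A : nat -> 'rV[R]_N -> set Om) c :=
  exists2 e, 0 < e & \forall n \near \oo, forall z, En E n z -> `|z - x| < e ->
    ((expR (- (n%:R * c)))%:E <= mu_ext (P (n%:R *: z)) (A n z))%E.

Definition exp_upper x (A : nat -> 'rV[R]_N -> set Om) c :=
  exists2 e, 0 < e & \forall n \near \oo, forall z, En E n z -> `|z - x| < e ->
    (mu_ext (P (n%:R *: z)) (A n z) <= (expR (- (n%:R * c)))%:E)%E.

Lemma liminf_log_prob_homo x (A B : nat -> 'rV[R]_N -> set Om) a b : a <= b ->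
  (forall n z, A n z `<=` B n z) ->
  (liminf_log_prob E P x b A <= liminf_log_prob E P x a B)%E.
Proof.
move=> ab AB; apply: limn_einf_homo; near=> n.
have n0 : (0 < n)%N by near: n; exact: nbhs_infty_gt.
apply: le_ereal_inf_tmp => _ [z [Ez za] <-].
apply: (@le_trans _ _ (log_prob P n z (A n z))); last exact: log_probS.
apply: ereal_inf_lbound.
by exists z => //; split => //; exact: lt_le_trans ab.
Unshelve. all: by end_near. Qed.

Lemma limsup_log_prob_homo x (A B : nat -> 'rV[R]_N -> set Om) a b : a <= b ->
  (forall n z, A n z `<=` B n z) ->
  (limsup_log_prob E P x a A <= limsup_log_prob E P x b B)%E.
Proof.
move=> ab AB; apply: limn_esup_homo; near=> n.
have n0 : (0 < n)%N by near: n; exact: nbhs_infty_gt.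
apply: ge_ereal_sup => _ [z [Ez za] <-].
apply: (@le_trans _ _ (log_prob P n z (B n z))); first exact: log_probS.
apply: ereal_sup_ubound.
by exists z => //; split => //; exact: lt_le_trans ab.
Unshelve. all: by end_near. Qed.

Lemma lim_liminf_homo x (A B : nat -> 'rV[R]_N -> set Om) :
  (forall n z, A n z `<=` B n z) ->
  (lim (liminf_log_prob E P x e A @[e --> 0%R^'+]) <=
   lim (liminf_log_prob E P x e B @[e --> 0%R^'+]))%E.
Proof.
move=> AB; rewrite (@lim_right0_nonincreasing _ (liminf_log_prob E P x ^~ A)); last first.
  by move=> a b _ ab; apply: liminf_log_prob_homo => // n z.
rewrite (@lim_right0_nonincreasing _ (liminf_log_prob E P x ^~ B)); last first.
  by move=> a b _ ab; apply: liminf_log_prob_homo => // n z.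
apply: ge_ereal_sup => _ [e e0 <-].
apply: (@le_trans _ _ (liminf_log_prob E P x e B)).
  exact: liminf_log_prob_homo.
by apply: ereal_sup_ubound; exists e.
Qed.

Lemma lim_liminf_gt x A c :
  ((- c)%:E < lim (liminf_log_prob E P x e A @[e --> 0%R^'+]))%E ->
  exp_lower x A c.
Proof.
rewrite lim_right0_nonincreasing; last first.
  by move=> a b _ ab; apply: liminf_log_prob_homo => // n z.
move=> /ereal_sup_gt[_ [e e0 <-]] /limn_einf_gt h; exists e => //.
apply: filterS2 h (nbhs_infty_gt 0%N) => n h n0 z Ez ze; rewrite -log_prob_ge//.
by apply: (le_trans (ltW h)); apply: ereal_inf_lbound; exists z.
Qed.

Lemma lim_liminf_ge x A c : exp_lower x A c ->
  ((- c)%:E <= lim (liminf_log_prob E P x e A @[e --> 0%R^'+]))%E.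
Proof.
move=> [e e0 h].
rewrite lim_right0_nonincreasing; last first.
  by move=> a b _ ab; apply: liminf_log_prob_homo => // n z.
apply: (@le_trans _ _ (liminf_log_prob E P x e A)); last first.
  by apply: ereal_sup_ubound; exists e.
apply: limn_einf_ge; apply: filterS2 h (nbhs_infty_gt 0%N) => n h n0.
by apply: le_ereal_inf_tmp => _ [z [Ez ze] <-]; rewrite log_prob_ge//; exact: h.
Qed.

(** Stated for a single radius because in (A3) the event shrinks together with the ball of starting
    points, so that no fixed event is available. *)
Lemma limsup_lt x A c e : 0 < e ->
  (limsup_log_prob E P x e A < (- c)%:E)%E -> exp_upper x A c.
Proof.
move=> e0 /limn_esup_lt h; exists e => //.
apply: filterS2 h (nbhs_infty_gt 0%N) => n h n0 z Ez ze; rewrite -log_prob_le//.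
by apply: le_trans (ltW h); apply: ereal_sup_ubound; exists z.
Qed.

Lemma lim_limsup_lt x A c :
  (lim (limsup_log_prob E P x e A @[e --> 0%R^'+]) < (- c)%:E)%E ->
  exp_upper x A c.
Proof.
rewrite lim_right0_nondecreasing; last first.
  by move=> a b _ ab; apply: limsup_log_prob_homo => // n z.
by move=> /ereal_inf_lt[_ [e e0 <-]]; exact: limsup_lt.
Qed.

Lemma lim_limsup_le x A c : exp_upper x A c ->
  (lim (limsup_log_prob E P x e A @[e --> 0%R^'+]) <= (- c)%:E)%E.
Proof.
move=> [e e0 h].
rewrite lim_right0_nondecreasing; last first.
  by move=> a b _ ab; apply: limsup_log_prob_homo => // n z.
apply: (@le_trans _ _ (limsup_log_prob E P x e A)).
  by apply: ereal_inf_lbound; exists e.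
apply: limn_esup_le; apply: filterS2 h (nbhs_infty_gt 0%N) => n h n0.
by apply: ge_ereal_sup => _ [z [Ez ze] <-]; rewrite log_prob_le//; exact: h.
Qed.

End LogProb.

Arguments exp_lower {R N d Om} E P x A c.
Arguments exp_upper {R N d Om} E P x A c.

(** * Polygonal paths *)

Section PolygonalPaths.
Context {R : realType} {N : nat}.
Implicit Types (p q v : 'rV[R]_N) (s : seq (R * 'rV[R]_N)) (t h : R).

(* A polygonal path is its starting point together with the list of the
   durations and endpoints of its segments. *)
Fixpoint polypath p s t : 'rV[R]_N :=
  if s is (h, q) :: s' then
    if t <= h then p + (t / h) *: (q - p) else polypath q s' (t - h)
  else p.

(* posc (p + q) is the face containing the open segment from p to q. *)
Fixpoint polycost (L : {set 'I_N} -> 'rV[R]_N -> \bar R) p s : \bar R :=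
  if s is (h, q) :: s' then
    (h%:E * L (posc (p + q)) (h^-1 *: (q - p)) + polycost L q s')%E
  else 0%E.

Fixpoint duration s : R := if s is (h, _) :: s' then h + duration s' else 0.

Fixpoint admissible s : Prop :=
  if s is (h, q) :: s' then [/\ 0 < h, orthant q & admissible s'] else True.

Lemma duration_ge0 s : admissible s -> 0 <= duration s.
Proof.
elim: s => [//|[h q] s IH /= [h0 _ /IH s0]].
by rewrite addr_ge0// ltW.
Qed.

Lemma polycost_ge0 L p s : (forall La v, (0 <= L La v)%E) -> admissible s ->
  (0 <= polycost L p s)%E.
Proof.
move=> L0; elim: s p => [//|[h q] s IH p /= [h0 _ /IH s0]].
by rewrite adde_ge0// mule_ge0// lee_fin ltW.
Qed.

Lemma polypath0 p s : admissible s -> polypath p s 0 = p.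
Proof.
case: s => [//|[h q] s /= [/ltW -> _ _]].
by rewrite mul0r scale0r addr0.
Qed.

Lemma orthant_segment p q (u : R) : orthant p -> orthant q -> 0 <= u <= 1 ->
  orthant (p + u *: (q - p)).
Proof.
move=> p0 q0 /andP[u0 u1] i; rewrite !mxE.
have := p0 i; have := q0 i; nra.
Qed.

Lemma posc_segment p q (u : R) : orthant p -> orthant q -> 0 < u < 1 ->
  posc (p + u *: (q - p)) = posc (p + q).
Proof.
move=> p0 q0 /andP[u0 u1]; apply/setP => i; rewrite !inE !mxE.
have := p0 i; have := q0 i; set a := p ord0 i; set b := q ord0 i => b0 a0.
apply/idP/idP => h; [have : 0 < a \/ 0 < b|have : 0 < a \/ 0 < b].
- by case: (ltP 0 a) => [|?]; [left|right; nra].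
- by nra.
- by case: (ltP 0 a) => [|?]; [left|right; nra].
- by nra.
Qed.

Lemma orthant_polypath p s t : orthant p -> admissible s -> 0 <= t ->
  orthant (polypath p s t).
Proof.
elim: s p t => [//|[h q] s IH p t p0 /= [h0 q0 s0] t0].
case: leP => [th|/ltW ht]; last by apply: IH; rewrite ?subr_ge0.
by apply: orthant_segment => //; rewrite divr_ge0 ?(ltW h0)//= ler_pdivrMr// mul1r.
Qed.

Lemma polypath_lipschitz p s : admissible s -> exists2 M : R, 0 <= M &
  forall t u, `|polypath p s t - polypath p s u| <= M * `|t - u|.
Proof.
elim: s p => [|[h q] s IH] p /=.
  by exists 0 => // t u; rewrite subrr normr0 mul0r.
move=> [h0 _ s0]; have [M M0 hM] := IH q s0.
pose M1 := `|q - p| / h.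
have M10 : 0 <= M1 by rewrite divr_ge0// ltW.
have seg t u : `|p + (t / h) *: (q - p) - (p + (u / h) *: (q - p))| = M1 * `|t - u|.
  rewrite opprD addrACA subrr add0r -scalerBl -mulrBl normrZ normrM normfV.
  by rewrite (gtr0_norm h0) /M1; field; rewrite gt_eqF.
exists (Num.max M M1); first by rewrite le_max M0.
(* For times on both sides of the first breakpoint, compare with its position [q]. *)
have key t u : t <= h < u -> `|p + (t / h) *: (q - p) - polypath q s (u - h)|
   <= Num.max M M1 * `|t - u|.
  move=> /andP[th hu]; rewrite (le_trans (ler_distD q _ _))//.
  have -> : `|p + (t / h) *: (q - p) - q| = M1 * `|t - h|.
    rewrite -seg divff ?gt_eqF// scale1r; congr (`|_|); congr (_ - _).
    by rewrite addrC subrK.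
  have := hM 0 (u - h); rewrite polypath0// => h2.
  rewrite (le_trans (lerD (lexx _) h2))//.
  have -> : `|t - u| = `|t - h| + `|0 - (u - h)|.
    have tu : t <= u by rewrite (le_trans th)// ltW.
    rewrite sub0r normrN (distrC t u) (distrC t h) !ger0_norm ?subr_ge0// ?(ltW hu)//.
    by lra.
  by rewrite mulrDr lerD// ler_wpM2r// le_max lexx ?orbT.
move=> t u; case: (leP t h) => th; case: (leP u h) => uh.
- by rewrite seg ler_wpM2r// le_max lexx orbT.
- by apply: key; rewrite th.
- by rewrite distrC [`|t - u|]distrC; apply: key; rewrite uh.
- have := hM (t - h) (u - h); rewrite opprB addrA subrK => /le_trans; apply.
  by rewrite ler_wpM2r// le_max lexx.
Qed.

Lemma lipschitz_continuous (V : normedModType R) (f : R -> V) (M : R) :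
  (forall t u, `|f t - f u| <= M * `|t - u|) -> continuous f.
Proof.
move=> h t; apply/cvgrPdist_lt => e e0.
have M1 : 0 < `|M| + 1 by rewrite ltr_wpDl.
apply/nbhs_ballP; exists (e / (`|M| + 1)) => /=; first by rewrite divr_gt0.
move=> u; rewrite /ball/= ltr_pdivlMr// => tu.
apply: le_lt_trans (h _ _) _; apply: le_lt_trans tu.
by rewrite mulrC ler_wpM2l// (le_trans (ler_norm _))// lerDl.
Qed.

Lemma polypath_continuous p s : admissible s -> continuous (polypath p s).
Proof. by move=> /(polypath_lipschitz p)[M _]; exact: lipschitz_continuous. Qed.

Lemma polypath_right_continuous p s S : admissible s ->
  right_continuous_on S (polypath p s).
Proof.
move=> s0 t _; apply: cvg_at_right_filter; exact: polypath_continuous.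
Qed.

End PolygonalPaths.

Lemma ereal_split_lt (R : realType) (a b : \bar R) (c : R) :
  (0 <= a)%E -> (0 <= b)%E -> (a + b < c%:E)%E ->
  exists c1 c2 : R, [/\ (a < c1%:E)%E, (b < c2%:E)%E & c1 + c2 = c].
Proof.
case: a => [a| |]//; case: b => [b| |]// _ _; rewrite -EFinD lte_fin => h.
exists (a + (c - (a + b)) / 2), (b + (c - (a + b)) / 2).
by rewrite !lte_fin; split; lra.
Qed.

(** * Lower bounds for tubes around polygonal paths *)

Section LowerTube.
Context {R : realType} {N : nat} {d : measure_display} {Om : measurableType d}.
Context {E : set 'rV[R]_N} {P : 'rV[R]_N -> probability Om R}
  {X : R -> 'rV[R]_N -> Om -> 'rV[R]_N}
  {K : R -> R.-pker (borelRV R N) ~> (borelRV R N)}.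
Hypothesis hX : markov_process E P X K.
Context {L : {set 'I_N} -> 'rV[R]_N -> \bar R}.
Hypothesis hL0 : forall La v, (0 <= L La v)%E.
Hypothesis hA1 : local_lower_bound E P X L.
Implicit Types (p q v z : 'rV[R]_N) (s : seq (R * 'rV[R]_N)) (t h S r : R).

Lemma mu_ext_tube n u S (f : R -> 'rV[R]_N) r z : (0 < n)%N -> 0 <= u -> 0 <= S ->
  right_continuous_on S f -> En E n z ->
  mu_ext (P (n%:R *: z)) (tube X n u S f r z) = P (n%:R *: z) (tube X n u S f r z).
Proof.
by move=> n0 s0 S0 hf Ez; rewrite measurable_mu_extE//; exact: (measurable_tube hX).
Qed.

Lemma tube0_prob n (f : R -> 'rV[R]_N) r z : (0 < n)%N -> En E n z ->
  `|z - f 0| <= r -> P (n%:R *: z) (tube X n 0 0 f r z) = 1%E.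
Proof.
move=> n0 Ez zr; have Ez' := En_state n0 Ez.
have mt : measurable (tube X n 0 0 f r z).
  by apply: (measurable_tube hX) => // t /andP[/le_lt_trans h /h]; rewrite ltxx.
have : P (n%:R *: z) (~` tube X n 0 0 f r z) = 0%E.
  apply/negligibleP; first exact: measurableC.
  have := markov_init hX Ez'; apply: negligibleS => w /=.
  apply: contra_not => Xw t; rewrite -eq_le => /eqP <-.
  by rewrite add0r /Zn mulr0 Xw scalerA mulVf ?scale1r// pnatr_eq0 -lt0n.
move=> h; rewrite -[tube X n 0 0 f r z]setCK probability_setC; last exact: measurableC.
by rewrite h sube0.
Qed.

Lemma exp_lowerS x (A B : nat -> 'rV[R]_N -> set Om) c :
  (forall n z, (0 < n)%N -> En E n z -> A n z `<=` B n z) ->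
  exp_lower E P x A c -> exp_lower E P x B c.
Proof.
move=> AB [e e0 h]; exists e => //.
apply: filterS2 h (nbhs_infty_gt 0%N) => n h n0 z Ez ze.
by apply: le_trans (h z Ez ze) _; apply: le_outer_measure; exact: AB.
Qed.

(** The outer limit in (A1) is monotone, hence an infimum over the radii, so the bound holds at
    every radius [r]. The open segment from [p] to [q] stays in the single face [posc (p + q)]. *)
Lemma local_lower_tube p q h c r : orthant p -> orthant q -> 0 < h -> 0 < r ->
  (h%:E * L (posc (p + q)) (h^-1 *: (q - p)) < c%:E)%E ->
  exp_lower E P p (fun n z => tube X n 0 h (polypath p [:: (h, q)]) r z) c.
Proof.
move=> p0 q0 h0 r0 hc.
pose phi t := p + (t / h) *: (q - p).
pose A r n z := [set w | (ereal_sup [set `|phi t - Zn X n t z w|%:E | t in `[0%R, h]%classic] < r%:E)%E].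
have phi0 : phi 0 = p by rewrite /phi mul0r scale0r addr0.
have seg t : t \in `[0, h] -> orthant (phi t) /\ phi t = phi 0 + t *: (h^-1 *: (q - p)).
  rewrite in_itv/= => /andP[t0 th]; rewrite phi0 scalerA; split => //.
  by apply: orthant_segment => //; rewrite divr_ge0 ?(ltW h0)//= ler_pdivrMr// mul1r.
have fac t : t \in `]0, h[ -> face (posc (p + q)) (phi t).
  rewrite in_itv/= => /andP[t0 th]; split.
    by apply: (seg t _).1; rewrite in_itv/= !ltW.
  by apply: posc_segment => //; rewrite divr_gt0//= ltr_pdivrMr// mul1r.
have := hA1 h0 seg fac; rewrite phi0 lim_right0_nondecreasing; last first.
  move=> a b a0 ab.
  have AS n z : A a n z `<=` A b n z.
    by move=> w /= /lt_le_trans; apply; rewrite lee_fin.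
  exact: lim_liminf_homo.
move=> A1.
have /lim_liminf_gt : ((- c)%:E < lim (liminf_log_prob E P p e (A r) @[e --> 0%R^'+]))%E.
  apply: (@lt_le_trans _ _ (- (h%:E * L (posc (p + q)) (h^-1 *: (q - p))))%E).
    by rewrite EFinN lteN2.
  by apply: (le_trans A1); apply: ereal_inf_lbound; exists r.
apply: exp_lowerS => n z _ _ w /= hw t /andP[t0 th]; rewrite th add0r -lee_fin distrC.
apply: le_trans (ltW hw); apply: ereal_sup_ubound; exists t => //=.
by rewrite in_itv/= t0.
Qed.

Lemma lower_tube p s c r : orthant p -> admissible s -> 0 < r ->
  (polycost L p s < c%:E)%E ->
  exp_lower E P p (fun n z => tube X n 0 (duration s) (polypath p s) r z) c.
Proof.
move=> p0; elim: s p p0 c => [|[h q] s IH] p p0 c.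
  move=> _ r0; rewrite lte_fin => c0; exists r => //; near=> n => z Ez zr.
  have n0 : (0 < n)%N by near: n; exact: nbhs_infty_gt.
  rewrite mu_ext_tube//=; last first.
    by move=> t /andP[/le_lt_trans h /h]; rewrite ltxx.
  rewrite tube0_prob//; last exact: ltW.
  by rewrite lee_fin -expR0 ler_expR oppr_le0 mulr_ge0// ltW.
move=> adm r0; have [h0 q0 s0] : admissible ((h, q) :: s) by [].
rewrite [X in (X < _)%E]/= => /ereal_split_lt[| |c1 [c2 [hc1 hc2 <-]]].
- by rewrite mule_ge0// lee_fin ltW.
- exact: polycost_ge0.
have [e e0 he] := IH q q0 c2 s0 r0 hc2.
(* The first tube is narrowed so that it ends within [e] of [q], where the induction hypothesis
   applies. *)
pose r1 := Num.min r (e / 2).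
have r10 : 0 < r1 by rewrite lt_min r0 divr_gt0.
have [e1 e10 he1] := local_lower_tube p0 q0 h0 r10 hc1.
exists e1 => //; near=> n => z Ez ze.
have n0 : (0 < n)%N by near: n; exact: nbhs_infty_gt.
set f1 := polypath p [:: (h, q)]; set f2 := polypath q s.
have adm1 : admissible [:: (h, q)] by [].
have D0 : 0 <= duration s by exact: duration_ge0.
have rc S : right_continuous_on S f1 by exact: polypath_right_continuous.
have rc2 S : right_continuous_on S f2 by exact: polypath_right_continuous.
have hn1 : ((expR (- (n%:R * c1)))%:E <= P (n%:R *: z) (tube X n 0 h f1 r1 z))%E.
  rewrite -mu_ext_tube ?(ltW h0)//; move: z Ez ze; near: n; exact: he1.
have hB : history X (n%:R *: z) (n%:R * h) (tube X n 0 h f1 r1 z).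
  by apply: (history_tube hX) => //; rewrite ?(ltW h0) ?add0r.
have b0 : (0 <= (expR (- (n%:R * c2)))%:E)%E by rewrite lee_fin expR_ge0.
have hb w : tube X n 0 h f1 r1 z w -> ((expR (- (n%:R * c2)))%:E <=
    P (n%:R *: Zn X n h z w) (tube X n 0 (duration s) f2 r (Zn X n h z w)))%E.
  move=> Bw; have Ew : En E n (Zn X n h z w) by apply: (Zn_En hX) => //; exact: ltW.
  have we : `|Zn X n h z w - q| < e.
    have := Bw h; rewrite (ltW h0) lexx add0r => /(_ isT).
    rewrite /f1/= lexx divff ?gt_eqF// scale1r (addrC p) subrK => /le_lt_trans; apply.
    by rewrite gt_min; apply/orP; right; lra.
  rewrite -mu_ext_tube//; move: (Zn X n h z w) Ew we; near: n; exact: he.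
have := tube_ge hX n0 (ltW h0) D0 (rc2 _) Ez hB b0 hb.
rewrite mu_ext_tube//; [|exact: duration_ge0|exact: polypath_right_continuous].
move=> h12; apply: le_trans (le_trans _ h12) _.
  rewrite mulrDr opprD expRD EFinM muleC.
  by apply: lee_pmul.
apply: le_measure; rewrite ?inE.
- apply: measurableI; last by apply: (measurable_tube hX) => //; exact: ltW.
  by apply: (measurable_tube hX) => //; exact: ltW.
- apply: (measurable_tube hX) => //; first by rewrite (duration_ge0 adm).
  exact: polypath_right_continuous.
move=> w [w1 w2] t /andP[t0 tD] /=; case: (leP t h) => th.
  have := w1 t; rewrite /f1/= th => h1; apply: le_trans (h1 _) _; first by rewrite t0.
  by rewrite ge_min lexx.
have := w2 (t - h); rewrite add0r addrCA subrr addr0; apply.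
by rewrite subr_ge0 (ltW th)/= lerBlDl.
Unshelve. all: by end_near. Qed.
End LowerTube.

(** * Detours through the interior, tracking and truncation *)

Section Polygonal.
Context {R : realType} {N : nat}.
Implicit Types (p q v w : 'rV[R]_N) (s : seq (R * 'rV[R]_N)) (t h r u : R).

Lemma row_norm_leP v r : 0 <= r -> (`|v| <= r <-> forall i, `|v ord0 i| <= r).
Proof.
move=> r0; rewrite [`|v|]mx_normrE; split.
  by move=> /bigmax_leP[_ h] i; exact: (h (ord0, i)).
by move=> h; apply/bigmax_leP; split => // -[j i] _; rewrite ord1; exact: h.
Qed.

(** A ball of the maximum norm is a cube, and a convex function on a cube is bounded by its values
    at the vertices. The induction frees the coordinates below [k] one by one: a point is a convex
    combination of the two points obtained by setting one coordinate to [r] and to [- r]. *)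
Lemma convex_bounded_near0 (f : 'rV[R]_N -> \bar R) : convex_ereal f ->
  (forall v, (0 <= f v)%E) -> (\forall v \near (0 : 'rV[R]_N), (f v < +oo)%E) ->
  exists r C, [/\ 0 < r, r <= 1, 0 <= C & forall v, `|v| <= r -> (f v <= C%:E)%E].
Proof.
move=> cf f0 /nbhs_ballP[e /= e0 he].
(* The bound [r <= 1] will ensure that a detour of size a lasts at least the time a. *)
pose r := Num.min 1 (e / 2).
have r0 : 0 < r by rewrite lt_min ltr01 divr_gt0.
have r1 : r <= 1 by rewrite ge_min lexx.
have rfin w : `|w| <= r -> (f w < +oo)%E.
  move=> wr; apply: he; rewrite -ball_normE/= sub0r normrN.
  by rewrite (le_lt_trans wr)// gt_min; apply/orP; right; lra.
have key k : (k <= N)%N -> forall w, `|w| <= r -> exists C : R,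
    forall v, `|v| <= r -> (forall i : 'I_N, (k <= i)%N -> v ord0 i = w ord0 i) -> (f v <= C%:E)%E.
  elim: k => [_ w wr|k IH kN w wr].
    exists (fine (f w)) => v vr vw.
    have -> : v = w by apply/rowP => i; exact: vw.
    by rewrite fineK// ge0_fin_numE//; exact: rfin.
  pose i0 := Ordinal kN.
  pose put (a : R) (x : 'rV[R]_N) : 'rV[R]_N := \row_i (if i == i0 then a else x ord0 i).
  have put_r a x : `|a| <= r -> `|x| <= r -> `|put a x| <= r.
    move=> ar /(row_norm_leP _ (ltW r0)) h; apply/(row_norm_leP _ (ltW r0)) => i.
    by rewrite mxE; case: ifP.
  have rr : `|r| <= r by rewrite gtr0_norm.
  have rNr : `|- r| <= r by rewrite normrN gtr0_norm.
  have [C1 h1] := IH (ltnW kN) (put r w) (put_r _ _ rr wr).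
  have [C2 h2] := IH (ltnW kN) (put (- r) w) (put_r _ _ rNr wr).
  exists (Num.max C1 C2) => v vr vw.
  pose t := (v ord0 i0 + r) / (2 * r).
  have /andP[v1 v2] : - r <= v ord0 i0 <= r.
    by rewrite -ler_norml; move/(row_norm_leP _ (ltW r0)) : vr; exact.
  have t01 : 0 <= t <= 1.
    by rewrite /t; apply/andP; split; [apply: divr_ge0; lra|rewrite ler_pdivrMr; lra].
  have vE : v = t *: put r v + (1 - t) *: put (- r) v.
    apply/rowP => i; rewrite !mxE; case: eqP => [->|_]; last by ring.
    by rewrite /t; field; rewrite gt_eqF.
  have put_w a (i : 'I_N) : (k <= i)%N -> put a v ord0 i = put a w ord0 i.
    rewrite !mxE; case: eqP => // /eqP ii ki; apply: vw.
    by rewrite ltn_neqAle ki andbT; apply: contra ii => /eqP kk; apply/eqP/val_inj.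
  have g1 := h1 _ (put_r _ _ rr vr) (put_w _).
  have g2 := h2 _ (put_r _ _ rNr vr) (put_w _).
  rewrite vE (le_trans (cf _ _ _ t01))//.
  have /andP[t0 t1] := t01.
  pose M := Num.max C1 C2.
  apply: (@le_trans _ _ (t%:E * M%:E + (1 - t)%:E * M%:E)%E).
    apply: leeD; apply: lee_wpmul2l; rewrite ?lee_fin ?subr_ge0//.
      by apply: (le_trans g1); rewrite lee_fin le_max lexx.
    by apply: (le_trans g2); rewrite lee_fin le_max lexx orbT.
  by rewrite -!EFinM -EFinD lee_fin -mulrDl subrKC mul1r.
have [C hC] := key N (leqnn N) 0 (eq_ind_r (fun x => x <= r) (ltW r0) (normr0 _)).
exists r, (Num.max 0 C); split => //; first by rewrite le_max lexx.
move=> v vr; apply: (le_trans (hC _ vr _)) => [i|]; first by rewrite leqNgt ltn_ord.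
by rewrite lee_fin le_max lexx orbT.
Qed.

(* From p to q through the interior of the orthant, at speed at most r when
   |q - p| <= a. *)
Definition detour r a p q : seq (R * 'rV[R]_N) :=
  [:: (2 * a / r, p + const_mx a); (2 * a / r, q)].

(** The midpoint has all coordinates positive, so both legs run in the interior even if [p] and [q]
    lie on the boundary. The legs have length at most a and 2a, so a duration of 2a/r each keeps the
    speed below [r]. *)
Lemma detour_cost L r C a p q s : 0 < r -> 0 < a -> `|q - p| <= a ->
  (forall v, `|v| <= r -> (L [set: 'I_N]%SET v <= C%:E)%E) ->
  orthant p -> orthant q ->
  (polycost L p (detour r a p q ++ s) <= (4 * a / r * C)%:E + polycost L q s)%E.
Proof.
move=> r0 a0 pq hC p0 q0 /=.
have posa (x : 'rV[R]_N) (y : 'rV[R]_N) : (forall i, 0 < x ord0 i + y ord0 i) ->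
    posc (x + y) = [set: 'I_N]%SET.
  by move=> h; apply/setP => i; rewrite !inE mxE h.
rewrite !posa; last 2 first.
- by move=> i; rewrite !mxE; have := p0 i; have := q0 i; lra.
- by move=> i; rewrite !mxE; have := p0 i; lra.
have na : `|const_mx a : 'rV[R]_N| <= a.
  by apply/row_norm_leP; [exact: ltW|move=> i; rewrite mxE gtr0_norm].
have h0 : 0 < 2 * a / r by rewrite divr_gt0// mulr_gt0.
have vel v : `|v| <= 2 * a -> `|(2 * a / r)^-1 *: v| <= r.
  move=> va; rewrite normrZ gtr0_norm ?invr_gt0// mulrC ler_pdivrMr//.
  by rewrite (_ : r * _ = 2 * a)//; field; rewrite gt_eqF.
have b1 := hC _ (vel (p + const_mx a - p) _).
have b2 := hC _ (vel (q - (p + const_mx a)) _).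
rewrite addeA leeD2r//; apply: (@le_trans _ _ ((2 * a / r)%:E * C%:E + (2 * a / r)%:E * C%:E)%E).
  apply: leeD; apply: lee_wpmul2l; rewrite ?lee_fin ?(ltW h0)//.
    by apply: b1; rewrite addrC addKr; lra.
  by apply: b2; rewrite opprD addrA (le_trans (ler_normB _ _))//; lra.
by rewrite -!EFinM -EFinD lee_fin; lra.
Qed.

Lemma orthant_detour_point a p : 0 < a -> orthant p -> orthant (p + const_mx a).
Proof. by move=> a0 p0 i; rewrite !mxE addr_ge0// ltW. Qed.

Lemma norm_segment (x p q : 'rV[R]_N) u e : 0 <= u <= 1 ->
  `|p - x| <= e -> `|q - x| <= e -> `|p + u *: (q - p) - x| <= e.
Proof.
move=> /andP[u0 u1] pe qe.
have -> : p + u *: (q - p) - x = (1 - u) *: (p - x) + u *: (q - x).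
  by apply/rowP => i; rewrite !mxE; ring.
rewrite (le_trans (ler_normD _ _))// !normrZ (ger0_norm u0) ger0_norm ?subr_ge0//.
have : 0 <= `|p - x| by []. have : 0 <= `|q - x| by []. nra.
Qed.

(** Only the endpoints of a segment are compared with [f], but over the whole time span of the
    segment; as balls are convex, every intermediate point is then close to [f] too. The cut at [T]
    is there because the path may last longer than [f] is controlled. *)
Fixpoint tracks (f : R -> 'rV[R]_N) T e t0 p s : Prop :=
  if s is (h, q) :: s' then
    (forall t, t0 <= t <= t0 + h -> t <= T -> `|p - f t| <= e /\ `|q - f t| <= e)
    /\ tracks f T e (t0 + h) q s'
  else True.

(** The time [t0] is excluded because [tracks] says nothing about an empty path. *)
Lemma tracks_polypath f T e t0 p s : admissible s -> tracks f T e t0 p s ->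
  forall t, t0 < t <= t0 + duration s -> t <= T ->
  `|polypath p s (t - t0) - f t| <= e.
Proof.
elim: s t0 p => [|[h q] s IH] t0 p /=.
  by move=> _ _ t; rewrite addr0 => /andP[a b]; have := lt_le_trans a b; rewrite ltxx.
move=> [h0 q0 s0] [h1 h2] t /andP[t0t tD] tT; case: (leP (t - t0) h) => th.
  have tt : t0 <= t <= t0 + h by rewrite (ltW t0t)/= -lerBlDl.
  have [pe qe] := h1 _ tt tT; apply: norm_segment => //.
  by rewrite divr_ge0 ?subr_ge0 ?(ltW t0t) ?(ltW h0)//= ler_pdivrMr// mul1r.
have := IH _ _ s0 h2 t; rewrite opprD addrA; apply => //.
by rewrite -ltrBrDl th/= -addrA.
Qed.

(** The segment containing time [u] is shortened without changing its velocity or its face, so its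
    cost shrinks in proportion; the later segments have nonnegative cost. *)
Lemma truncate_polypath L p s u : (forall La v, (0 <= L La v)%E) -> orthant p ->
  admissible s -> 0 < u <= duration s ->
  exists s', [/\ admissible s', duration s' = u, (polycost L p s' <= polycost L p s)%E &
    forall t, t <= u -> polypath p s' t = polypath p s t].
Proof.
move=> L0; elim: s p u => [|[h q] s IH] p u p0 /=.
  by move=> _ /andP[a b]; have := lt_le_trans a b; rewrite ltxx.
move=> [h0 q0 s0] /andP[u0 uD]; have [uh|hu] := leP u h.
  exists [:: (u, p + (u / h) *: (q - p))] => /=; split.
  - split => //; apply: orthant_segment => //.
    by rewrite divr_ge0 ?(ltW u0) ?(ltW h0)//= ler_pdivrMr// mul1r.
  - by rewrite addr0.
  - rewrite adde0 (_ : p + _ - p = (u / h) *: (q - p)); last by rewrite addrC addKr.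
    rewrite scalerA mulrA mulVf ?gt_eqF// mul1r.
    have -> : posc (p + (p + (u / h) *: (q - p))) = posc (p + q).
      apply/setP => i; rewrite !inE !mxE; have := p0 i; have := q0 i.
      have : 0 < u / h by rewrite divr_gt0.
      have : u / h <= 1 by rewrite ler_pdivrMr// mul1r.
      move: (u / h) => x; set a := p _ _; set b := q _ _ => x1 x0 b0 a0.
      apply/idP/idP => hh.
        by case: (ltP 0 a) => [?|?]; [lra|have : 0 < b; [nra|lra]].
      by case: (ltP 0 a) => [?|?]; [nra|have : 0 < b; [lra|nra]].
    apply: (@le_trans _ _ (h%:E * L (posc (p + q)) (h^-1 *: (q - p)))%E).
      by rewrite lee_wpmul2r// lee_fin.
    by rewrite leeDl// polycost_ge0.
  - move=> t tu; rewrite tu (le_trans tu uh).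
    rewrite (_ : p + _ - p = (u / h) *: (q - p)); last by rewrite addrC addKr.
    rewrite scalerA.
    by rewrite mulrA divfK ?gt_eqF.
have hu' : 0 < u - h <= duration s by rewrite subr_gt0 hu/= lerBlDl.
have [s' [s'0 s'D s'L s'E]] := IH q (u - h) q0 s0 hu'.
exists ((h, q) :: s') => /=; split => //.
- by rewrite s'D subrKC.
- by rewrite leeD2l.
- by move=> t tu; case: (leP t h) => // _; apply: s'E; rewrite lerB.
Qed.

End Polygonal.

(** * The action of a polygonal path *)

Section Action.
Context {R : realType} {N : nat}.
Implicit Types (p q v w : 'rV[R]_N) (s : seq (R * 'rV[R]_N)) (t h r u a b : R).

Lemma derive1_affine (f : R -> 'rV[R]_N) a b c v t : t \in `]a, b[ ->
  (forall x, x \in `]a, b[ -> f x = c + x *: v) -> derive1 f t = v.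
Proof.
move=> tab fE; rewrite /derive1; apply/cvg_lim => //.
apply: (@cvg_trans _ ((fun=> v) x @[x --> (0:R)^'])); last exact: cvg_cst.
apply: near_eq_cvg.
have /andP[ta tb] : a < t < b by move: tab; rewrite in_itv.
apply/nbhs_ballP; exists (Num.min (t - a) (b - t)) => /=.
  by rewrite lt_min !subr_gt0 ta.
move=> x; rewrite /ball/= sub0r normrN lt_min !ltr_norml.
move=> /andP[/andP[x1 _] /andP[_ x2]] x0.
have txab : x + t \in `]a, b[ by rewrite in_itv/=; lra.
rewrite (fE _ txab).
rewrite fE// opprD addrACA subrr add0r -scalerBl addrK scalerA mulVf//.
by rewrite scale1r.
Qed.

(** Measurability is proved in the same induction because splitting the integral at a breakpoint
    depends on it. The integrand is constant on each open segment; its values at the breakpoints are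
    arbitrary. *)
Lemma integral_polypath L (f : R -> 'rV[R]_N) u p s :
  (forall La v, (0 <= L La v)%E) -> orthant p -> admissible s ->
  (forall t, u <= t <= u + duration s -> f t = polypath p s (t - u)) ->
  measurable_fun `[u, u + duration s] (fun t => L (posc (f t)) (derive1 f t)) /\
  (\int[lebesgue_measure]_(t in `[u, (u + duration s)%R]) L (posc (f t)) (derive1 f t)
   = polycost L p s)%E.
Proof.
move=> L0; elim: s u p => [|[h q] s IH] u p p0.
  by move=> _ _ /=; rewrite addr0 set_itv1 integral_set1; split => //; exact: measurable_fun_set1.
move=> adm; have [h0 q0 s0] : admissible ((h, q) :: s) by [].
have D0 := duration_ge0 s0.
rewrite [duration _]/= => fE; pose g t := L (posc (f t)) (derive1 f t).
have fE1 t : t \in `]u, u + h[ -> f t = p + ((t - u) / h) *: (q - p).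
  rewrite in_itv/= => /andP[ut th]; rewrite fE/=.
    by rewrite lerBlDl (ltW th).
  by rewrite (ltW ut)/= (le_trans (ltW th))// addrA lerDl.
have gE t : t \in `]u, u + h[ -> g t = L (posc (p + q)) (h^-1 *: (q - p)).
  move=> tu; rewrite /g; congr (L _ _).
    rewrite fE1//; apply: posc_segment => //.
    move: tu; rewrite in_itv/= => /andP[ut th].
    by rewrite divr_gt0 ?subr_gt0//= ltr_pdivrMr// mul1r ltrBlDl.
  apply: (derive1_affine tu (c := p - (u / h) *: (q - p))) => x xu.
  rewrite fE1// -addrA; congr (_ + _); rewrite scalerA addrC -scalerBl.
  by congr (_ *: _); field; rewrite gt_eqF.
have [IH1 IH2] : measurable_fun `[u + h, u + h + duration s] g /\
   (\int[lebesgue_measure]_(t in `[(u + h)%R, (u + h + duration s)%R]) g t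
     = polycost L q s)%E.
  apply: IH => // t /andP[ut tD]; rewrite fE/=; last first.
    by rewrite (le_trans _ ut) ?lerDl ?(ltW h0)//= addrA.
  case: (leP (t - u) h) => tuh; last by rewrite opprD addrA.
  have -> : t = u + h by apply/eqP; rewrite eq_le ut andbT -lerBlDl.
  rewrite subrr polypath0// addrAC subrr add0r divff ?gt_eqF// scale1r.
  by rewrite addrC subrK.
have m1 : measurable_fun `]u, u + h[ g.
  apply: (eq_measurable_fun (cst (L (posc (p + q)) (h^-1 *: (q - p))))) => //.
  by move=> t; rewrite inE/= => tu; rewrite gE.
have m1c : measurable_fun `[u, u + h] g.
  rewrite -(@setUitv1 _ _ (BLeft u) _ true) ?bnd_simp ?lerDl ?(ltW h0)//.
  apply/measurable_funU => //; split; last exact: measurable_fun_set1.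
  rewrite -(@setU1itv _ _ (BLeft (u + h)) u false) ?bnd_simp ?ltrDl//.
  by apply/measurable_funU => //; split => //; exact: measurable_fun_set1.
have m2 : measurable_fun `]u + h, u + (h + duration s)] g.
  by apply: measurable_funS IH1 => //; rewrite addrA; exact: subset_itv_oc_cc.
have UE : `[u, u + (h + duration s)]%classic =
    `[u, u + h]%classic `|` `]u + h, u + (h + duration s)]%classic.
  rewrite -itv_bndbnd_setU// !bnd_simp ?lerD2l ?lerDl ?(ltW h0)//.
split; first by rewrite UE; apply/measurable_funU.
rewrite UE ge0_integral_setU//=; last 2 first.
- exact/measurable_funU.
- apply/disj_set2P/seteqP; split => // t [/=]; rewrite !in_itv/= => /andP[_ t1] /andP[t2 _].
  by have := lt_le_trans t2 t1; rewrite ltxx.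
congr (_ + _)%E.
  transitivity (\int[lebesgue_measure]_(t in `]u, (u + h)%R[) g t)%E.
    rewrite -integral_itv_bndo_bndc; last first.
      by apply: measurable_funS m1c => //; exact: subset_itv_co_cc.
    by rewrite -integral_itv_obnd_cbnd.
  rewrite (eq_integral (cst (L (posc (p + q)) (h^-1 *: (q - p))))).
    rewrite integral_cst//=; have := lebesgue_measure_itv `]u, u + h[.
    rewrite /= lte_fin ltrDl h0 => ->.
    by rewrite -EFinD (addrAC u) subrr add0r muleC.
  by move=> t; rewrite inE/= => tu; rewrite gE.
by rewrite integral_itv_obnd_cbnd ?addrA// -addrA.
Qed.

Lemma Jfun_polypath T L (psi : skorohod N T) p s :
  (forall La v, (0 <= L La v)%E) -> orthant p -> admissible s -> duration s = T ->
  (forall t, t \in `[0, T] -> psi t = polypath p s t) ->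
  Jfun L psi = polycost L p s.
Proof.
move=> L0 p0 s0 sT h.
have [|_] := @integral_polypath L psi 0 p s L0 p0 s0; last by rewrite /Jfun add0r sT.
by move=> t; rewrite add0r subr0 sT => tT; rewrite h.
Qed.

Lemma piecewise_linear_polypath T (psi : skorohod N T) : 0 < T ->
  (forall t, t \in `[0, T] -> orthant (psi t)) -> piecewise_linear psi ->
  exists s, [/\ admissible s, duration s = T &
    forall t, t \in `[0, T] -> psi t = polypath (psi 0) s t].
Proof.
move=> T0 orth [_ [s [ps lT hs]]].
suff H a : 0 <= a -> path <%R a s -> last a s = T ->
   (forall i, (i < size s)%N -> exists v : 'rV[R]_N,
      let b := nth 0 (a :: s) i in
      forall t, t \in `[b, nth 0 s i] -> psi t = psi b + (t - b) *: v) ->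
  exists s', [/\ admissible s', duration s' = T - a &
    forall t, a <= t <= T -> psi t = polypath (psi a) s' (t - a)].
  have [s' [h1 h2 h3]] := H 0 (lexx _) ps lT hs; exists s'; split => //.
    by rewrite h2 subr0.
  by move=> t; rewrite in_itv/= => /h3; rewrite subr0.
elim: s a {ps lT hs} => [|b s IH] a a0 /=.
  move=> _ aT _; exists [::]; rewrite aT subrr; split => // t /=.
  by rewrite -eq_le eq_sym => /eqP ->.
move=> /andP[ab pb] lT hs.
have bT : b <= T.
  rewrite -lT; move: pb; elim: s b {IH ab lT hs} => [//|c s IHs] b /= /andP[bc /IHs].
  exact/le_trans/ltW.
have [|s' [h1 h2 h3]] := IH b (le_trans a0 (ltW ab)) pb lT.
  by move=> i si; exact: (hs i.+1 si).
have [v /= hv] := hs 0%N isT.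
have hb : 0 < b - a by rewrite subr_gt0.
have psib : psi b - psi a = (b - a) *: v.
  by rewrite hv ?in_itv/= ?lexx ?(ltW ab)// addrC addKr.
exists ((b - a, psi b) :: s') => /=; split.
- split => //; apply: orth; rewrite in_itv/= bT andbT.
  exact: le_trans (ltW ab).
- by rewrite h2; lra.
move=> t /andP[at_ tT]; case: (leP (t - a) (b - a)) => tb.
  rewrite psib scalerA divfK ?gt_eqF// hv// in_itv/= at_/=.
  by move: tb; rewrite lerD2r.
rewrite opprB addrA subrK; apply: h3; rewrite tT andbT.
by move: tb; rewrite ltrD2r => /ltW.
Qed.

Lemma skorohod_restriction T (f : R -> 'rV[R]_N) :
  (forall t, t \in `[0, T] -> orthant (f t)) -> cadlag T%:E f ->
  exists psi : skorohod N T, forall t, t \in `[0, T] -> psi t = f t.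
Proof.
move=> f1 [f2 f3]; pose g t := if t \in `[0, T] then f t else 0.
have gE t : t \in `[0, T] -> g t = f t by rewrite /g => ->.
have g1 t : t \in `[0, T] -> orthant (g t) by move=> tT; rewrite gE//; exact: f1.
have g2 : cadlag T%:E g.
  split=> t t0 tT.
    have := f2 t t0 tT; rewrite lte_fin in tT; rewrite gE ?in_itv/= ?t0 ?ltW//.
    apply: cvg_trans; apply: near_eq_cvg; near=> x.
    rewrite gE// in_itv/=; apply/andP; split.
      by apply: (le_trans t0); near: x; exact: nbhs_right_ge.
    by near: x; exact: nbhs_right_le.
  have /cvg_ex[l h] := f3 t t0 tT; rewrite lee_fin in tT.
  apply/cvg_ex; exists l; apply: cvg_trans h.
  apply: near_eq_cvg; near=> x.
  rewrite gE// in_itv/=; apply/andP; split.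
    by near: x; exact: nbhs_left_ge.
  by apply: le_trans tT; near: x; exact: nbhs_left_le.
have g3 t : t \notin `[0, T] -> g t = 0 by rewrite /g => /negPf ->.
by exists (Skorohod g1 g2 g3).
Unshelve. all: by end_near. Qed.

Lemma skorohod_polypath T p s : 0 < T -> orthant p -> admissible s -> duration s = T ->
  exists psi : skorohod N T, piecewise_linear psi /\
    forall t, t \in `[0, T] -> psi t = polypath p s t.
Proof.
move=> T0 p0 s0 sT.
have cs := polypath_continuous (p := p) s0.
have [|| psi fE] := @skorohod_restriction T (polypath p s).
- by move=> t tT; apply: orthant_polypath => //; move: tT; rewrite in_itv => /andP[].
- split=> t t0 tT; first by apply: cvg_at_right_filter; exact: cs.
  by apply/cvg_ex; exists (polypath p s t); apply: cvg_at_left_filter; exact: cs.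
exists psi; split => //; split.
  apply: (@subspace_eq_continuous _ _ _ (polypath p s)).
    by move=> t; rewrite inE => tT; rewrite [RHS]fE.
  exact: continuous_subspaceT.
have tot : forall s a q, 0 <= a -> a + duration s = T -> admissible s ->
    (forall t, a <= t <= T -> psi t = polypath q s (t - a)) ->
    exists l : seq R, [/\ path <%R a l, last a l = T &
    forall i, (i < size l)%N -> exists v : 'rV[R]_N,
      let b := nth 0 (a :: l) i in
      forall t : R, t \in `[b, nth 0 l i] -> psi t = psi b + (t - b) *: v].
  elim=> [|[h q'] s' IH] a q a0 /=; first by rewrite addr0 => -> _ _; exists [::].
  move=> aT [h0 q0 s'0] hf; have D0 := duration_ge0 s'0.
  have aT' : a + h + duration s' = T by rewrite -addrA.
  have [| |l [l1 l2 l3]] := IH (a + h) q' _ aT' s'0.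
  - by rewrite addr_ge0// ltW.
  - move=> t /andP[at_ tT]; rewrite hf; last by rewrite tT (le_trans _ at_)// lerDl ltW.
    case: (leP (t - a) h) => th; last by rewrite opprD addrA.
    have -> : t = a + h by apply/eqP; rewrite eq_le at_ andbT -lerBlDl.
    rewrite subrr polypath0// addrAC subrr add0r divff ?gt_eqF// scale1r.
    by rewrite addrC subrK.
  exists (a + h :: l); split => /=.
  - by rewrite ltrDl h0.
  - by [].
  case=> [_|i il]; last exact: l3.
  exists (h^-1 *: (q' - q)) => /= t; rewrite in_itv/= => /andP[at_ th].
  have aT2 : a + h <= T by rewrite -aT' lerDl.
  rewrite !hf ?lexx/= ?at_ ?(le_trans th aT2)//; last first.
    by rewrite (le_trans _ aT2)// lerDl ltW.
  by rewrite subrr (ltW h0) lerBlDl th mul0r scale0r addr0 scalerA.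
apply: (tot s 0 p) => //; first by rewrite add0r.
by move=> t tT; rewrite subr0 fE// in_itv.
Qed.

End Action.

(** * The Skorohod metric and the action functional *)

Section SkorohodSpace.
Context {R : realType} {N : nat} {T : R}.
Hypothesis T0 : 0 < T.
Implicit Types (phi psi : skorohod N T) (t u e : R).

Lemma skorohod_orthant phi t : t \in `[0, T] -> orthant (phi t).
Proof. by case: phi => f h ? ? /=; exact: h. Qed.

Lemma skorohod_cadlag phi : cadlag T%:E phi.
Proof. by case: phi. Qed.

Definition unif_continuous_on phi := forall e, 0 < e -> exists2 d, 0 < d &
  forall t u, t \in `[0, T] -> u \in `[0, T] -> `|t - u| < d -> `|phi t - phi u| < e.

(** Heine's theorem, through a near covering of the compact interval. *)
Lemma pointwise_unif_continuous phi :
  (forall t e, t \in `[0, T] -> 0 < e -> exists2 d, 0 < d &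
    forall u, u \in `[0, T] -> `|t - u| < d -> `|phi t - phi u| < e) ->
  unif_continuous_on phi.
Proof.
move=> h e e0.
pose Q (d t : R) := t \in `[0, T] -> forall u, u \in `[0, T] -> `|t - u| < d -> `|phi t - phi u| < e.
have : \forall d \near (0:R)^'+, `[0, T]%classic `<=` Q d.
  have /compact_near_coveringP := @segment_compact R 0 T; apply.
  move=> x /= xT; have [d d0 hd] := h x (e / 2) xT (divr_gt0 e0 (ltr0n _ 2)).
  exists (ball x (d / 2), [set d' | d' < d / 2]) => /=.
    split; first by apply: nbhsx_ballx; rewrite divr_gt0.
    by apply: nbhs_right_lt; rewrite divr_gt0.
  move=> [x' d'] /= [xx' dd'] x'T u uT x'u.
  have h1 : `|phi x - phi x'| < e / 2.
    by apply: hd => //; move: xx'; rewrite /ball/=; lra.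
  have h2 : `|phi x - phi u| < e / 2.
    apply: hd => //; apply: le_lt_trans (ler_distD x' _ _) _.
    by move: xx'; rewrite /ball/=; lra.
  apply: le_lt_trans (ler_distD (phi x) _ _) _; rewrite distrC; lra.
move=> /nbhs_ballP[d /= d0 hd]; exists (d / 2); first by rewrite divr_gt0.
move=> t u tT; apply: hd => //=.
  by rewrite /ball/= sub0r normrN gtr0_norm; lra.
by rewrite divr_gt0.
Qed.

Lemma ac_unif_continuous phi : absolutely_continuous phi -> unif_continuous_on phi.
Proof.
move=> h e e0; have [d d0 hd] := h e e0; exists d => // t u.
wlog tu : t u / t <= u.
  move=> H tT uT; case: (leP t u) => tu; first exact: H.
  by rewrite distrC [`|phi _ - _|]distrC; apply: H => //; exact: ltW.
rewrite !in_itv/= => /andP[t0 tT] /andP[u0 uT] tud.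
have := hd 1%N (fun=> t) (fun=> u); rewrite !big_ord1 distrC; apply.
- by move=> k _; rewrite t0 tu.
- by move=> [|//] [|//] _ _ _.
- by move: tud; rewrite distrC ger0_norm// subr_ge0.
Qed.

Lemma pl_unif_continuous psi : piecewise_linear psi -> unif_continuous_on psi.
Proof.
move=> /(piecewise_linear_polypath T0 (@skorohod_orthant psi))[s [s0 _ sE]] e e0.
have [M M0 hM] := polypath_lipschitz (psi 0) s0.
exists (e / (M + 1)) => [|t u tT uT tu]; first by rewrite divr_gt0// ltr_wpDl.
rewrite (sE t)// (sE u)//; apply: le_lt_trans (hM _ _) _.
have : `|t - u| * (M + 1) < e by rewrite -ltr_pdivlMr// ltr_wpDl.
have : 0 <= `|t - u| by []. by nra.
Qed.

Lemma time_change_mem (l : R -> R) t : time_change T l -> t \in `[0, T] -> l t \in `[0, T].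
Proof.
move=> [_ il] tT; have : (l @` `[0, T]%classic) (l t) by exists t.
by rewrite il.
Qed.

(** Around a uniformly continuous path, Skorohod closeness implies uniform closeness: write [t] as
    [l u] with [u] near [t], and move from [phi t] to [phi u]. This is the bridge from Skorohod
    balls to tubes. *)
Lemma dS_unif phi : unif_continuous_on phi -> forall e, 0 < e ->
  exists2 d, 0 < d & forall psi, (dS phi psi < d%:E)%E ->
    forall t, t \in `[0, T] -> `|phi t - psi t| < e.
Proof.
move=> uc e e0; have [d d0 hd] := uc (e / 2) (divr_gt0 e0 (ltr0n _ 2)).
exists (Num.min d (e / 2)); first by rewrite lt_min d0 divr_gt0.
move=> psi /dS_lt[l [[ml il] [r]]]; rewrite lt_min => /andP[rd re] h t tT.
have : `[0, T]%classic t by []; rewrite -il => -[u /= uT ut].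
have [h1 h2] := h u uT; rewrite ut in h1 h2.
have h3 : `|phi t - phi u| < e / 2 by apply: hd => //; exact: le_lt_trans rd.
apply: le_lt_trans (ler_distD (phi u) _ _) _; lra.
Qed.

Lemma unif_dS phi psi (r e : R) : r < e ->
  (forall t, t \in `[0, T] -> `|phi t - psi t| <= r) -> (dS phi psi < e%:E)%E.
Proof.
move=> re h; apply/dS_lt; exists id; split; first by split => //; rewrite image_id.
exists r => // t tT; rewrite subrr normr0 h//; split => //.
by apply: le_trans (h t tT).
Qed.

(** The path is uniformly close to a continuous one composed with a time change [l]. On the right of
    [t] continuity is part of being cadlag; on the left it comes from the left continuity of [l], a
    consequence of [l] being increasing and onto. *)
Lemma unif_continuous_dS_limit phi :
  (forall e, 0 < e -> exists2 psi, (dS phi psi < e%:E)%E & unif_continuous_on psi) ->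
  unif_continuous_on phi.
Proof.
move=> H; apply: pointwise_unif_continuous => t e tT e0.
have e40 : 0 < e / 4 by rewrite divr_gt0.
have [psi /dS_lt[l [tl [r re h]]] uc] := H _ e40.
have [d d0 hd] := uc _ e40; have [ml il] := tl.
have key u : u \in `[0, T] -> `|l t - l u| < d -> `|phi t - phi u| < e.
  move=> uT lud; have [_ h1] := h t tT; have [_ h2] := h u uT.
  have h3 := hd _ _ (time_change_mem tl tT) (time_change_mem tl uT) lud.
  have g1 := ler_distD (psi (l t)) (phi t) (phi u).
  have g2 := ler_distD (psi (l u)) (psi (l t)) (phi u).
  by rewrite distrC in h2; lra.
move: (tT); rewrite in_itv/= => /andP[t0]; rewrite le_eqVlt => tT'.
have [d1 d10 h1] : exists2 d1, 0 < d1 & forall u, u \in `[0, T] -> t < u -> u < t + d1 ->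
    `|phi t - phi u| < e.
  have [tET|tT1] := eqVneq t T.
    exists 1 => // u; rewrite in_itv/= tET => /andP[_ uT] Tu.
    by have := lt_le_trans Tu uT; rewrite ltxx.
  rewrite (negPf tT1)/= in tT'.
  have [+ _] := skorohod_cadlag phi; move=> /(_ t t0).
  rewrite lte_fin => /(_ tT')/cvg_at_right_distP/(_ e e0)[d1 d10 hd1].
  by exists d1 => // u _ tu ut; apply: hd1; rewrite tu.
have [d2 d20 h2] : exists2 d2, 0 < d2 & forall u, u \in `[0, T] -> u < t -> t - d2 < u ->
    `|phi t - phi u| < e.
  move: t0; rewrite le_eqVlt => /predU1P[t0|t0].
    exists 1 => // u; rewrite in_itv/= -t0 => /andP[u0 _] u0'.
    by have := le_lt_trans u0 u0'; rewrite ltxx.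
  have T0T : 0 \in `[0, T] by rewrite in_itv/= lexx ltW.
  have := time_change_mem tl tT; rewrite in_itv/= => /andP[lt0 ltT].
  have l0 : 0 < l t.
    apply: le_lt_trans (ml _ _ T0T tT t0).
    by have := time_change_mem tl T0T; rewrite in_itv/= => /andP[].
  (* The preimage of [y] bounds a left neighbourhood of [t] that [l] maps to within [d] of [l t]. *)
  pose y := Num.max 0 (l t - d / 2).
  have yl : y < l t by rewrite gt_max l0/=; lra.
  have yT : `[0, T]%classic y by rewrite /= in_itv/= le_max lexx/= (le_trans (ltW yl)).
  move: (yT); rewrite -il => -[u0 /= u0T u0y].
  have u0t : u0 < t.
    rewrite ltNge le_eqVlt; apply/negP => /predU1P[E|/(ml _ _ tT u0T)].
      by move: yl; rewrite -u0y -E ltxx.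
    by rewrite u0y => /(lt_trans yl); rewrite ltxx.
  exists (t - u0); first by rewrite subr_gt0.
  move=> u uT ut; rewrite opprB addrC subrK => u0u; apply: key => //.
  have g1 := ml _ _ u0T uT u0u; have g2 := ml _ _ uT tT ut.
  have g3 : l t - d / 2 <= y by rewrite le_max lexx orbT.
  rewrite gtr0_norm ?subr_gt0//; rewrite u0y in g1; lra.
exists (Num.min d1 d2); first by rewrite lt_min d10.
move=> u uT; rewrite lt_min !ltr_norml => /andP[/andP[a1 a2] /andP[a3 a4]].
case: (ltgtP t u) => [tu|ut|->]; last by rewrite subrr normr0.
- by apply: h1 => //; lra.
- by apply: h2 => //; lra.
Qed.

End SkorohodSpace.

(** * The relaxed action as a rate function *)

Section RateFunction.
Context {R : realType} {N : nat} {T : R}.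
Hypothesis T0 : 0 < T.
Variable L : {set 'I_N} -> 'rV[R]_N -> \bar R.
Hypothesis hL0 : forall La v, (0 <= L La v)%E.
Implicit Types (phi psi : skorohod N T) (t u e : R).
Local Open Scope ereal_scope.

Definition local_inf phi (delta : R) := ereal_inf [set Jfun L psi | psi in
   [set psi | piecewise_linear psi /\ dS phi psi < delta%:E]].

Lemma Ifun_sup phi :
  Ifun L phi = ereal_sup [set local_inf phi delta | delta in [set delta | (0 < delta)%R]].
Proof.
rewrite /Ifun (@lim_right0_nonincreasing _ (local_inf phi))// => a b a0 ab.
apply: ereal_inf_le_tmp => _ [psi [pl h] <-]; exists psi => //; split => //.
by apply: lt_le_trans h _; rewrite lee_fin.
Qed.

Lemma Ifun_gt phi (a : \bar R) : a < Ifun L phi ->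
  exists2 delta : R, (0 < delta)%R & a < local_inf phi delta.
Proof. by rewrite Ifun_sup => /ereal_sup_gt[_ [delta d0 <-]]; exists delta. Qed.

Lemma Ifun_lt phi (c : \bar R) : Ifun L phi < c -> forall delta : R, (0 < delta)%R ->
  exists psi, [/\ piecewise_linear psi, dS phi psi < delta%:E & Jfun L psi < c].
Proof.
rewrite Ifun_sup => h delta d0.
have : local_inf phi delta < c.
  by apply: le_lt_trans h; apply: ereal_sup_ubound; exists delta.
by move=> /ereal_inf_lt[_ [psi [pl hd] <-] hc]; exists psi.
Qed.

Lemma Ifun_ge0 phi : 0 <= Ifun L phi.
Proof.
rewrite Ifun_sup; apply: (@le_trans _ _ (local_inf phi 1)).
  by apply: le_ereal_inf_tmp => _ [psi _ <-]; apply: integral_ge0.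
by apply: ereal_sup_ubound; exists 1%R => //=.
Qed.

(** If [phi'] is within [delta / 2] of [phi], the ball of radius [delta / 2] around [phi'] lies in
    the ball of radius [delta] around [phi], so the infimum over it is at least as large. *)
Lemma Ifun_lsc : lower_semicontinuous (@Ifun R N T L).
Proof.
move=> phi a /Ifun_gt[delta d0 h].
exists (ball phi (delta / 2)); first by apply: nbhsx_ballx; rewrite divr_gt0.
move=> phi' hb; rewrite Ifun_sup.
apply: (@lt_le_trans _ _ (local_inf phi' (delta / 2))); last first.
  by apply: ereal_sup_ubound; exists (delta / 2)%R => //=; rewrite divr_gt0.
apply: (lt_le_trans h); apply: ereal_inf_le_tmp => _ [psi [pl hd] <-].
exists psi => //; split => //; rewrite [delta]splitr.
exact: (@dSball_triangle _ _ _ _ phi').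
Qed.

Lemma Ifun_rate : rate_function (@Ifun R N T L).
Proof. by split; [exact: Ifun_ge0|exact: Ifun_lsc]. Qed.

Lemma Ifun_continuous phi : Ifun L phi < +oo -> unif_continuous_on phi.
Proof.
move=> /Ifun_lt h; apply: unif_continuous_dS_limit => // e e0.
by have [psi [pl hd _]] := h e e0; exists psi => //; exact: pl_unif_continuous.
Qed.

End RateFunction.

(** * The lower bound *)

Section DetourPath.
Context {R : realType} {N : nat}.
Implicit Types (p q : 'rV[R]_N) (s : seq (R * 'rV[R]_N)).

Lemma detour_near r a p q s (t : R) : 0 < r -> 0 < a -> `|q - p| <= a ->
  0 <= t <= 4 * a / r -> `|polypath p (detour r a p q ++ s) t - p| <= a.
Proof.
move=> r0 a0 pq /andP[t0 t1] /=.
have na : `|p + const_mx a - p| <= a.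
  rewrite addrC addKr; apply/row_norm_leP; first exact: ltW.
  by move=> i; rewrite mxE gtr0_norm.
have h0 : 0 < 2 * a / r by rewrite divr_gt0// mulr_gt0.
have frac (u : R) : 0 <= u <= 2 * a / r -> 0 <= u / (2 * a / r) <= 1.
  move=> /andP[u0 u1]; rewrite divr_ge0 ?(ltW h0)//= ler_pdivrMr// mul1r//.
case: (leP t (2 * a / r)) => th.
  apply: norm_segment => //; last by rewrite subrr normr0 ltW.
  by apply: frac; rewrite t0.
have th2 : t - 2 * a / r <= 2 * a / r by rewrite lerBlDl; apply: (le_trans t1); lra.
rewrite th2; apply: norm_segment => //.
by apply: frac; rewrite subr_ge0 (ltW th).
Qed.

Lemma detour_after r a p q s (t : R) : 0 < r -> 0 < a -> 4 * a / r < t ->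
  polypath p (detour r a p q ++ s) t = polypath q s (t - 4 * a / r).
Proof.
move=> r0 a0 ht /=.
have h0 : 0 < 2 * a / r by rewrite divr_gt0// mulr_gt0.
have e4 : 4 * a / r = 2 * a / r + 2 * a / r by lra.
by rewrite !ifF; [rewrite e4 opprD addrA|apply/negbTE; rewrite -ltNge; lra|
  apply/negbTE; rewrite -ltNge; lra].
Qed.

Lemma detour_duration r a p q s :
  duration (detour r a p q ++ s) = 4 * a / r + duration s.
Proof. by rewrite /=; lra. Qed.

Lemma detour_admissible r a p q s : 0 < r -> 0 < a -> orthant p -> orthant q ->
  admissible s -> admissible (detour r a p q ++ s).
Proof.
move=> r0 a0 p0 q0 s0 /=; have h0 : 0 < 2 * a / r by rewrite divr_gt0// mulr_gt0.
by split=> //; exact: orthant_detour_point.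
Qed.

End DetourPath.

Section ApproximatingPath.
Context {R : realType} {N : nat} {T : R}.
Hypothesis T0 : 0 < T.
Context {L : {set 'I_N} -> 'rV[R]_N -> \bar R}.
Hypothesis hL0 : forall La v, (0 <= L La v)%E.
Hypothesis hLconv : forall La, convex_ereal (L La).
Hypothesis hA2 : \forall v \near (0 : 'rV[R]_N), (L [set: 'I_N]%SET v < +oo)%E.
Implicit Types (phi psi : skorohod N T).

Lemma mem_0T : 0 \in `[0, T].
Proof. by rewrite in_itv/= lexx ltW. Qed.

(* Ifun only sees paths starting near phi 0: the detour through the interior,
   on which L is bounded, repairs the starting point at a small cost. *)
Lemma approximating_path phi (c : R) : (Ifun L phi < c%:E)%E ->
  forall e, 0 < e -> exists s, [/\ admissible s, duration s = T,
    (polycost L (phi 0%R) s < c%:E)%E &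
    forall t, t \in `[0, T] -> `|polypath (phi 0) s t - phi t| <= e].
Proof.
move=> hc e e0.
have [c' [hc' cc']] : exists c', (Ifun L phi < c'%:E)%E /\ c' < c.
  move: hc (Ifun_ge0 hL0 phi); case: (Ifun L phi) => [i| |]// + _.
  by rewrite lte_fin => ic; exists ((i + c) / 2); rewrite lte_fin; split; lra.
have uc : unif_continuous_on phi.
  by apply: (Ifun_continuous T0 (L := L)); apply: lt_trans hc _; rewrite ltry.
have [r [C [r0 r1 C0 hC]]] := convex_bounded_near0 (hLconv _) (hL0 _) hA2.
have [d d0 hd] := uc (e / 4) (divr_gt0 e0 (ltr0n _ 4)).
(* The three bounds make the detour short, its delay 4a/r smaller than the modulus [d], and its cost
   smaller than the margin [c - c']; [C + 1] avoids a division by 0. *)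
pose a := Num.min (e / 4) (Num.min (d * r / 8) ((c - c') * r / (8 * (C + 1)))).
have C1 : 0 < C + 1 by rewrite ltr_wpDl.
have a0 : 0 < a.
  rewrite !lt_min; apply/and3P; split; [by rewrite divr_gt0|by rewrite divr_gt0// mulr_gt0|].
  by rewrite divr_gt0 ?mulr_gt0// subr_gt0.
have ae : a <= e / 4 by rewrite ge_min lexx.
have ad : 4 * a / r < d.
  have : a <= d * r / 8 by rewrite /a !ge_min lexx orbT.
  rewrite ltr_pdivrMr//; have : 0 < d * r by rewrite mulr_gt0. lra.
have aC : 4 * a / r * C < c - c'.
  have : a <= (c - c') * r / (8 * (C + 1)) by rewrite /a !ge_min lexx !orbT.
  rewrite ler_pdivlMr ?mulr_gt0// mulrAC ltr_pdivrMr//.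
  have : 0 < (c - c') * r by rewrite mulr_gt0// subr_gt0.
  by nra.
have [delta d'0 hdelta] := dS_unif uc a0.
have [psi [pl hpsi Jpsi]] := Ifun_lt hc' d'0.
have [s [s0 sT sE]] := piecewise_linear_polypath T0 (@skorohod_orthant _ _ _ psi) pl.
have q0 : orthant (psi 0) by exact: skorohod_orthant mem_0T.
have p0 : orthant (phi 0) by exact: skorohod_orthant mem_0T.
rewrite (Jfun_polypath hL0 q0 s0 sT sE) in Jpsi.
have close := hdelta _ hpsi.
have pq : `|psi 0 - phi 0| <= a by rewrite distrC ltW// close// mem_0T.
have H0 : 0 < 4 * a / r by rewrite divr_gt0// mulr_gt0.
have adm := detour_admissible r0 a0 p0 q0 s0.
(* The detour followed by [psi] lasts longer than [T], and the surplus is cut off. *)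
have Tdur : 0 < T <= duration (detour r a (phi 0) (psi 0) ++ s).
  by rewrite detour_duration sT T0 lerDr ltW.
have [s' [s'0 s'T s'L s'E]] := truncate_polypath hL0 p0 adm Tdur.
exists s'; split => //.
  apply: (le_lt_trans s'L); apply: le_lt_trans (detour_cost s r0 a0 pq hC p0 q0) _.
  have := polycost_ge0 (psi 0) hL0 s0; move: Jpsi; case: (polycost _ _ _) => // x.
  by rewrite -EFinD !lte_fin; lra.
move=> t tT; have /andP[t0 tT'] : 0 <= t <= T by move: tT; rewrite in_itv.
rewrite s'E//; case: (leP t (4 * a / r)) => ht.
  have h1 : `|polypath (phi 0) (detour r a (phi 0) (psi 0) ++ s) t - phi 0| <= a.
    by apply: detour_near => //; rewrite t0.
  have h2 : `|phi 0 - phi t| < e / 4.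
    apply: hd => //; first exact: mem_0T.
    by rewrite sub0r normrN ger0_norm//; lra.
  by apply: le_trans (ler_distD (phi 0) _ _) _; lra.
(* From here on the path follows [psi] with the delay 4a/r. *)
rewrite detour_after// -sE; last by rewrite in_itv/=; lra.
have tH : t - 4 * a / r \in `[0, T] by rewrite in_itv/=; lra.
have h1 := close _ tH.
have h2 : `|phi (t - 4 * a / r) - phi t| < e / 4.
  by apply: hd => //; rewrite addrAC subrr sub0r normrN gtr0_norm.
apply: le_trans (ler_distD (phi (t - 4 * a / r)) _ _) _; rewrite distrC; lra.
Qed.

End ApproximatingPath.

Section LowerBound.
Context {R : realType} {N : nat} {d : measure_display} {Om : measurableType d}.
Context {E : set 'rV[R]_N} {P : 'rV[R]_N -> probability Om R}
  {X : R -> 'rV[R]_N -> Om -> 'rV[R]_N}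
  {K : R -> R.-pker (borelRV R N) ~> (borelRV R N)}.
Hypothesis hE : E `<=` @orthant R N.
Hypothesis hX : markov_process E P X K.
Context {T : R}.
Hypothesis T0 : 0 < T.
Context {L : {set 'I_N} -> 'rV[R]_N -> \bar R}.
Hypothesis hL0 : forall La v, (0 <= L La v)%E.
Hypothesis hLconv : forall La, convex_ereal (L La).
Hypothesis hA1 : local_lower_bound E P X L.
Hypothesis hA2 : \forall v \near (0 : 'rV[R]_N), (L [set: 'I_N]%SET v < +oo)%E.
Implicit Types (phi psi : skorohod N T) (x z : 'rV[R]_N).

Lemma Zn_skorohod n z w : (0 < n)%N -> En E n z ->
  exists psi : skorohod N T, forall t, t \in `[0, T] -> psi t = Zn X n t z w.
Proof.
move=> n0 Ez; have nR : 0 < n%:R :> R by rewrite ltr0n.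
apply: (@skorohod_restriction _ _ _ (fun t => Zn X n t z w)).
  move=> t; rewrite in_itv/= => /andP[t0 _] i.
  rewrite mxE mulr_ge0 ?invr_ge0 ?ler0n//.
  by apply: hE; apply: (markov_state hX); [exact: En_state|rewrite mulr_ge0].
split=> t t0 tT.
  have := @Zn_right_continuous _ _ _ _ _ _ _ _ hX n 0 z w n0 (lexx _) Ez t t0.
  by rewrite add0r; under eq_fun do rewrite add0r.
have [_] := markov_paths hX w (En_state n0 Ez).
move=> /(_ (n%:R * t)); rewrite mulr_gt0// leey => /(_ isT isT)/cvg_ex[l hl].
apply/cvg_ex; exists (n%:R^-1 *: l); apply/cvg_at_left_distP => e e0.
have /cvg_at_left_distP/(_ (n%:R * e) (mulr_gt0 nR e0))[a a0 ha] := hl.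
exists (a / n%:R) => [|u /andP[tu ut]]; first by rewrite divr_gt0.
rewrite /Zn -scalerBr normrZ ger0_norm ?invr_ge0// ltr_pdivrMl//.
apply: ha; rewrite ltr_pM2l// ut andbT.
by move: tu; rewrite ltrBlDl -ltrBlDr ltr_pdivlMr// mulrBl; lra.
Qed.

Lemma Ifun_exp_lower phi x (O : set (skorohod N T)) (c : R) : open O -> O phi ->
  phi 0 = x -> (Ifun L phi < c%:E)%E ->
  exp_lower E P x (fun n z => path_event X n z O) c.
Proof.
move=> oO Ophi <- hc.
have /nbhs_ballP[rho /= rho0 hrho] := open_nbhs_nbhs (conj oO Ophi).
have rho4 : 0 < rho / 4 by rewrite divr_gt0.
have [s [s0 sT sL sE]] := approximating_path T0 hL0 hLconv hA2 hc rho4.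
have p0 : orthant (phi 0) by apply: skorohod_orthant; exact: mem_0T.
have := lower_tube hX hL0 hA1 p0 s0 rho4 sL; apply: exp_lowerS => n z n0 Ez w hw.
have [psi psiE] := Zn_skorohod w n0 Ez; exists psi => //.
apply: hrho; apply: (@unif_dS _ _ _ _ _ (rho / 2)); first lra.
move=> t tT; rewrite psiE//.
have h1 := sE t tT.
have := hw t; rewrite sT add0r; have -> : (0 <= t <= T) by move: tT; rewrite in_itv.
move=> /(_ isT) h2.
by rewrite (le_trans (ler_distD (polypath (phi 0) s t) _ _))// distrC; rewrite distrC in h2; lra.
Qed.

Lemma Ifun_lower_ld_bound : lower_ld_bound E P X (@Ifun R N T L).
Proof.
move=> x O x0 oO; rewrite leeNl; apply: le_ereal_inf_tmp => _ [phi [Ophi phix] <-].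
rewrite leeNl; have := Ifun_ge0 hL0 phi.
case I : (Ifun L phi) => [i| |]// _; last by rewrite leNye.
apply/lee_subgt0Pr => e e0; rewrite -EFinN -EFinB -opprD; apply: lim_liminf_ge.
by apply: (Ifun_exp_lower oO Ophi phix); rewrite I lte_fin ltrDl.
Qed.

Hypothesis happrox : forall x : 'rV[R]_N, orthant x ->
     exists2 u : nat -> 'rV[R]_N,
       (forall n, (1 <= n)%N -> En E n (u n)) & u n @[n --> \oo] --> x.

(** The two bounds are compared at points of [En] converging to [x]; for large [n] such a point lies
    in both balls, so neither bound is vacuous. *)
Lemma exp_lower_upper x (A B : nat -> 'rV[R]_N -> set Om) (c c' : R) : orthant x ->
  (forall n z, A n z `<=` B n z) ->
  exp_lower E P x A c -> exp_upper E P x B c' -> c' <= c.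
Proof.
move=> x0 AB [e e0 he] [e' e'0 he']; rewrite leNgt; apply/negP => cc'.
have [u Eu /cvgrPdist_lt ux] := happrox x0.
have [n [n0 une une' h1 h2]] : exists n, [/\ (0 < n)%N, `|u n - x| < e, `|u n - x| < e',
   (forall z, En E n z -> `|z - x| < e ->
    ((expR (- (n%:R * c)))%:E <= mu_ext (P (n%:R *: z)) (A n z))%E) &
   (forall z, En E n z -> `|z - x| < e' ->
    (mu_ext (P (n%:R *: z)) (B n z) <= (expR (- (n%:R * c')))%:E)%E)].
  near \oo => n; exists n; split.
  - by near: n; exact: nbhs_infty_gt.
  - by rewrite distrC; near: n; exact: ux.
  - by rewrite distrC; near: n; exact: ux.
  - by near: n.
  - by near: n.
have AB' : (mu_ext (P (n%:R *: u n)) (A n (u n)) <= mu_ext (P (n%:R *: u n)) (B n (u n)))%E.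
  exact: le_outer_measure.
have := le_trans (h1 _ (Eu n n0) une) (le_trans AB' (h2 _ (Eu n n0) une')).
rewrite lee_fin ler_expR lerN2 ler_pM2l ?ltr0n//.
by move=> /(lt_le_trans cc'); rewrite ltxx.
Unshelve. all: by end_near. Qed.

Variable It : skorohod N T -> \bar R.
Hypothesis hItgood : good_rate_function It.
Hypothesis hItupper : upper_ld_bound E P X It.

Lemma It_exp_upper x (F : set (skorohod N T)) (c : R) : orthant x -> closed F ->
  (c%:E < ereal_inf [set It phi | phi in [set phi | F phi /\ phi 0%R = x]])%E ->
  exp_upper E P x (fun n z => path_event X n z F) c.
Proof.
move=> x0 cF hc; apply: lim_limsup_lt; apply: le_lt_trans (hItupper x0 cF) _.
by rewrite EFinN lteN2.
Qed.

Lemma It_le_Ifun phi : (It phi <= Ifun L phi)%E.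
Proof.
rewrite leNgt; apply/negP => h; have [[It0 lsc] _ _] := hItgood.
move: (Ifun_ge0 hL0 phi) h; case I : (Ifun L phi) => [i| |]// _; last first.
  by move=> /lt_le_trans/(_ (leey _)); rewrite ltxx.
move=> h.
have [a [ia aIt]] : exists a, i < a /\ (a%:E < It phi)%E.
  move: h; case: (It phi) => [b| |]//; last by exists (i + 1); rewrite ltry ltrDl.
  by rewrite lte_fin => ib; exists ((i + b) / 2); rewrite lte_fin; split; lra.
have [V nV hV] := lsc _ _ aIt.
(* The lower bound is for open sets and the upper bound for closed ones: regularity places both
   inside [V]. *)
have [U nU UV] := uniform_regular nV.
have x0 : orthant (phi 0) by apply: skorohod_orthant; exact: mem_0T.
pose c1 := i + (a - i) / 3; pose c2 := a - (a - i) / 3.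
have : c2 <= c1.
  apply: (@exp_lower_upper (phi 0) (fun n z => path_event X n z U°)
     (fun n z => path_event X n z (closure U))) => //.
  - move=> n z w [psi Upsi hpsi]; exists psi => //.
    by apply: subset_closure; exact: interior_subset.
  - apply: (@Ifun_exp_lower phi) => //; first exact: open_interior.
    by rewrite I lte_fin /c1; lra.
  - apply: It_exp_upper => //; first exact: closed_closure.
    apply: (@lt_le_trans _ _ a%:E); first by rewrite lte_fin /c2; lra.
    by apply: le_ereal_inf_tmp => _ [psi [Fpsi _] <-]; apply: ltW; apply: hV; exact: UV.
by rewrite /c1 /c2; lra.
Qed.

Lemma Ifun_good : good_rate_function (@Ifun R N T L).
Proof.
have [_ cpt ac] := hItgood; split; first exact: Ifun_rate.
- move=> V c VE cV c0.
  have -> : [set phi : skorohod N T | V (phi 0) /\ (Ifun L phi <= c%:E)%E] =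
     [set phi : skorohod N T | V (phi 0) /\ (It phi <= c%:E)%E] `&`
     [set phi : skorohod N T | (Ifun L phi <= c%:E)%E].
    apply/seteqP; split=> phi /=; last by move=> [[]].
    by move=> [h1 h2]; split => //; split => //; apply: le_trans h2; exact: It_le_Ifun.
  apply: compact_closedI; first exact: cpt.
  rewrite -[X in closed X]setCK; apply: open_closedC.
  rewrite openE => phi /= /negP; rewrite -ltNge => /Ifun_lsc[V' nV' hV'].
  by apply: filterS nV' => psi /hV' /=; rewrite ltNge => /negP.
- by move=> phi h; apply: ac; apply: le_lt_trans h; exact: It_le_Ifun.
Qed.

End LowerBound.

(** * The local upper bound *)

Lemma ereal_split_gt (R : realType) (a b : \bar R) (c : R) :
  (0 <= a)%E -> (0 <= b)%E -> (c%:E < a + b)%E ->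
  exists c1 c2 : R, [/\ (c1%:E < a)%E, (c2%:E < b)%E & c1 + c2 = c].
Proof.
case: a => [a| |]//; case: b => [b| |]// a0 b0 h.
- rewrite -EFinD lte_fin in h.
  exists (a - (a + b - c) / 2), (b - (a + b - c) / 2).
  by rewrite !lte_fin; split; lra.
(* When only one term is infinite, a negative level lies below the finite one and the infinite one
   takes the rest. *)
- exists (- 1), (c + 1); rewrite ltry; split => //; last by lra.
  by apply: lt_le_trans a0; rewrite lte_fin oppr_lt0.
- exists (c + 1), (- 1); rewrite ltry; split => //; last by lra.
  by apply: lt_le_trans b0; rewrite lte_fin oppr_lt0.
- exists 0, c; rewrite !ltry; split => //; lra.
Qed.

Lemma coord_le_norm (R : realType) (N : nat) (v : 'rV[R]_N) i : `|v ord0 i| <= `|v|.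
Proof. by have /row_norm_leP/(_ i) := lexx `|v|; exact. Qed.

Section UpperTube.
Context {R : realType} {N : nat} {d : measure_display} {Om : measurableType d}.
Context {E : set 'rV[R]_N} {P : 'rV[R]_N -> probability Om R}
  {X : R -> 'rV[R]_N -> Om -> 'rV[R]_N}
  {K : R -> R.-pker (borelRV R N) ~> (borelRV R N)}.
Hypothesis hX : markov_process E P X K.
Context {T : R}.
Context {L : {set 'I_N} -> 'rV[R]_N -> \bar R}.
Hypothesis hL0 : forall La v, (0 <= L La v)%E.
Hypothesis hA3 : local_upper_bound E P X L.
Variable phi : skorohod N T.
Hypothesis ucphi : unif_continuous_on phi.
Implicit Types (s t u v w r c : R) (z : 'rV[R]_N).

(** The ball of starting points has the radius of the tube, so the end of one tube is an admissible
    start for the next; shrinking the radius preserves the bound. *)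
Definition upper_tube u v c := exists2 r, 0 < r &
  \forall n \near \oo, forall z, En E n z -> `|z - phi u| <= r ->
    (P (n%:R *: z) (tube X n 0 (v - u) (fun t => phi (u + t)%R) r z) <=
     (expR (- (n%:R * c)))%:E)%E.

Lemma shift_right_continuous u v : 0 <= u -> v <= T ->
  right_continuous_on (v - u) (fun t => phi (u + t)).
Proof.
move=> u0 vT t /andP[t0 tv]; apply/cvg_at_right_distP => e e0.
have [d' d'0 hd] := ucphi e0; exists (Num.min d' (v - u - t)).
  by rewrite lt_min d'0 subr_gt0.
move=> x /andP[tx]; rewrite -ltrBlDl lt_min => /andP[x1 x2]; apply: hd.
- by rewrite in_itv/=; lra.
- by rewrite in_itv/=; lra.
- by rewrite opprD addrACA subrr add0r distrC gtr0_norm ?subr_gt0.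
Qed.

Lemma upper_tube_shrink u v c r : 0 < r ->
  0 <= u -> u <= v -> v <= T -> upper_tube u v c -> exists2 r', 0 < r' <= r &
  \forall n \near \oo, forall z, En E n z -> `|z - phi u| <= r' ->
    (P (n%:R *: z) (tube X n 0 (v - u) (fun t => phi (u + t)%R) r' z) <=
     (expR (- (n%:R * c)))%:E)%E.
Proof.
move=> r0 u0 uv vT [r1 r10 h]; exists (Num.min r r1).
  by rewrite lt_min r0 r10 ge_min lexx.
apply: filterS2 h (nbhs_infty_gt 0%N) => n h n0 z Ez zr.
have zr1 : `|z - phi u| <= r1 by apply: (le_trans zr); rewrite ge_min lexx orbT.
apply: le_trans (h z Ez zr1).
have rc := shift_right_continuous u0 vT; have vu : 0 <= v - u by rewrite subr_ge0.
apply: le_measure; rewrite ?inE; try by apply: (measurable_tube hX).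
by move=> w hw t ht; apply: le_trans (hw t ht) _; rewrite ge_min lexx orbT.
Qed.

Lemma upper_tube_trivial u v c : 0 <= u -> u <= v -> v <= T -> c <= 0 -> upper_tube u v c.
Proof.
move=> u0 uv vT c0; exists 1 => //.
apply: filterS (nbhs_infty_gt 0%N) => n n0 z Ez _.
apply: (@le_trans _ _ 1%E).
  apply: probability_le1; apply: (measurable_tube hX) => //; first by rewrite subr_ge0.
  exact: shift_right_continuous.
by rewrite lee_fin -expR0 ler_expR oppr_ge0 mulr_ge0_le0.
Qed.

Lemma upper_tube_cat u v w c1 c2 : 0 <= u -> u <= v -> v <= w -> w <= T ->
  upper_tube u v c1 -> upper_tube v w c2 -> upper_tube u w (c1 + c2).
Proof.
move=> u0 uv vw wT h1 [r2 r20 h2].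
have v0 : 0 <= v by exact: le_trans uv.
have vT : v <= T by exact: le_trans wT.
have [r /andP[r0 rr2] {}h1] := upper_tube_shrink r20 u0 uv vT h1.
exists r => //; near=> n => z Ez zr.
have n0 : (0 < n)%N by near: n; exact: nbhs_infty_gt.
set f1 := fun t => phi (u + t); set f2 := fun t => phi (v + t).
have rc1 : right_continuous_on (v - u) f1 by exact: shift_right_continuous.
have rc2 : right_continuous_on (w - v) f2 by exact: shift_right_continuous.
have rc : right_continuous_on (w - u) f1 by exact: shift_right_continuous.
have vu : 0 <= v - u by rewrite subr_ge0.
have wv : 0 <= w - v by rewrite subr_ge0.
have wu : 0 <= w - u by rewrite subr_ge0 (le_trans uv).
have hB : history X (n%:R *: z) (n%:R * (v - u)) (tube X n 0 (v - u) f1 r z).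
  by apply: (history_tube hX) => //; rewrite add0r.
have b0 : (0 <= (expR (- (n%:R * c2)))%:E)%E by rewrite lee_fin expR_ge0.
have hb x : tube X n 0 (v - u) f1 r z x ->
    (P (n%:R *: Zn X n (v - u) z x) (tube X n 0 (w - v) f2 r (Zn X n (v - u) z x))
     <= (expR (- (n%:R * c2)))%:E)%E.
  move=> Bx; have Ex : En E n (Zn X n (v - u) z x) by exact: (Zn_En hX).
  have xr : `|Zn X n (v - u) z x - phi v| <= r.
    by have := Bx (v - u); rewrite vu lexx add0r /f1 subrKC => /(_ isT).
  apply: (@le_trans _ _ (P (n%:R *: Zn X n (v - u) z x)
     (tube X n 0 (w - v) f2 r2 (Zn X n (v - u) z x)))).
    apply: le_measure; rewrite ?inE; try by apply: (measurable_tube hX).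
    by move=> y hy t ht; apply: le_trans (hy t ht) _.
  move: (Zn X n (v - u) z x) Ex (le_trans xr rr2); near: n; exact: h2.
have h12 := tube_le hX n0 vu wv rc2 Ez hB b0 hb.
apply: le_trans (le_trans _ h12) _; last first.
  rewrite mulrDr opprD expRD EFinM muleC.
  apply: lee_wpmul2r => //; move: z Ez zr {hB hb h12}; near: n; exact: h1.
apply: le_measure; rewrite ?inE.
- exact: (measurable_tube hX).
- by apply: measurableI; exact: (measurable_tube hX).
move=> x hx; split=> t /andP[t0 tv].
  by apply: hx; rewrite t0 (le_trans tv)// lerD2r.
have := hx (v - u + t); rewrite add0r /f1 /f2.
have -> : u + (v - u + t) = v + t by ring.
by apply; rewrite addr_ge0//=; lra.
Unshelve. all: by end_near. Qed.

(* The supremum of the admissible c need not be attained, so the rate C bounds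
   the exponents strictly below it. *)
Definition upper_rate u v (C : \bar R) := forall c, (c%:E < C)%E -> upper_tube u v c.

Lemma upper_rate0 u v : 0 <= u -> u <= v -> v <= T -> upper_rate u v 0%E.
Proof.
by move=> u0 uv vT c; rewrite lte_fin => /ltW; exact: upper_tube_trivial.
Qed.

Lemma upper_rate_cat u v w C1 C2 : 0 <= u -> u <= v -> v <= w -> w <= T ->
  (0 <= C1)%E -> (0 <= C2)%E ->
  upper_rate u v C1 -> upper_rate v w C2 -> upper_rate u w (C1 + C2)%E.
Proof.
move=> u0 uv vw wT C10 C20 h1 h2 c /ereal_split_gt[//|//|c1 [c2 [hc1 hc2 <-]]].
by apply: (@upper_tube_cat u v w) => //; [exact: h1|exact: h2].
Qed.

(** A common bound [m] for all coordinates in [La], by compactness of [s, t], is what allows a tube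
    of fixed radius to avoid the faces x_i = 0. *)
Lemma face_lower_bound s t (La : {set 'I_N}) : 0 <= s -> t <= T ->
  (forall i u, i \in La -> s <= u <= t -> 0 < phi u ord0 i) ->
  exists2 m, 0 < m & forall i u, i \in La -> s <= u <= t -> m <= phi u ord0 i.
Proof.
move=> s0 tT pos.
have : \forall m \near (0:R)^'+, forall i : 'I_N, i \in La -> forall u, s <= u <= t ->
    m <= phi u ord0 i.
  apply: filter_forall => i.
  case: (boolP (i \in La)) => iLa; last by apply: nearW.
  pose Q (m u : R) := s <= u <= t -> m <= phi u ord0 i.
  have : \forall m \near (0:R)^'+, `[s, t]%classic `<=` Q m.
    have /compact_near_coveringP := @segment_compact R s t; apply.
    move=> x /= xst; rewrite in_itv/= in xst.
    have p0 := pos _ _ iLa xst; set p := phi x ord0 i in p0.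
    have [d' d'0 hd] := ucphi (divr_gt0 p0 (ltr0n _ 2)).
    exists (ball x d', [set m | m < p / 2]) => /=.
      by split; [exact: nbhsx_ballx|apply: nbhs_right_lt; rewrite divr_gt0].
    move=> [y m] /= [xy mp] yst.
    have : `|phi x - phi y| < p / 2.
      by apply: hd => //; rewrite in_itv/=; lra.
    move=> /(le_lt_trans (coord_le_norm _ i)); rewrite !mxE -/p ltr_norml => /andP[_].
    by lra.
  apply: filterS => m h _ u ust; apply: h => //=.
move=> /nbhs_ballP[e /= e0 he].
exists (e / 2); first by rewrite divr_gt0.
move=> i u iLa ust; apply: (he (e / 2)) => //=; last by rewrite divr_gt0.
by rewrite /ball/= sub0r normrN gtr0_norm; lra.
Qed.

Lemma upper_rate_face s t (La : {set 'I_N}) : 0 <= s -> s < t -> t <= T ->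
  face La (phi s) -> face La (phi t) ->
  (forall i u, i \in La -> s <= u <= t -> 0 < phi u ord0 i) ->
  upper_rate s t ((t - s)%:E * L La ((t - s)^-1 *: (phi t - phi s)))%E.
Proof.
move=> s0 st tT Fs Ft pos c hc.
have ts : 0 < t - s by rewrite subr_gt0.
have [m m0 hm] := face_lower_bound s0 tT pos.
pose A delta n z := [set w | (`|Zn X n (t - s) z w - phi t| < delta)%R /\
                             ((t - s)%:E < hitting_time X La n z w)%E].
have := hA3 ts Fs Ft; rewrite -/(A _).
rewrite (@lim_right0_nondecreasing _ (fun delta => limsup_log_prob E P (phi s) delta (A delta))); last first.
  move=> a b a0 ab; apply: limsup_log_prob_homo => // n z w /= [h1 h2]; split => //.
  exact: lt_le_trans ab.
move=> A3.
have /ereal_inf_lt[_ [delta d0 <-]] :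
    (ereal_inf [set limsup_log_prob E P (phi s) delta (A delta) |
       delta in [set e | (0 < e)%R]] < (- c)%:E)%E.
  by apply: le_lt_trans A3 _; rewrite EFinN lteN2.
move=> /(limsup_lt d0)[e e0 h].
(* The three bounds put the starting point in the ball where the (A3) estimate holds, the endpoint
   within [delta] of [phi t], and the coordinates in [La] above [m / 2]. *)
pose r := Num.min (e / 2) (Num.min (delta / 2) (m / 2)).
have r0 : 0 < r by rewrite !lt_min !divr_gt0.
have re : r < e by apply: le_lt_trans (_ : _ <= e / 2) _; [rewrite ge_min lexx|lra].
have rd : r < delta.
  by apply: le_lt_trans (_ : _ <= delta / 2) _; [rewrite /r !ge_min lexx orbT|move: d0 => /=; lra].
have rm : r <= m / 2 by rewrite /r !ge_min lexx !orbT.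
exists r => //; apply: filterS2 h (nbhs_infty_gt 0%N) => n h n0 z Ez zr.
have rc : right_continuous_on (t - s) (fun x => phi (s + x)).
  exact: shift_right_continuous.
rewrite -(mu_ext_tube hX) ?(ltW ts)//; apply: le_trans (h z Ez (le_lt_trans zr re)).
apply: le_outer_measure => w hw; split.
  have := hw (t - s); rewrite (ltW ts) lexx add0r subrKC => /(_ isT).
  by move=> /le_lt_trans; apply.
have low x i : i \in La -> 0 <= x <= t - s -> m / 2 <= Zn X n x z w ord0 i.
  move=> iLa xts; have := hw x xts; rewrite add0r => /(row_norm_leP _ (ltW r0))/(_ i).
  rewrite mxE [X in _ + X]mxE ler_norml => /andP[h1 _].
  have : m <= phi (s + x) ord0 i by apply: hm => //; lra.
  lra.
(* The tube gives no control after [t - s], while the hitting time has to be strictly larger; right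
   continuity at [t - s] supplies the extra time [d1]. *)
have /cvg_at_right_distP/(_ (m / 4) _)[|d1 d10 hd1] :=
    @Zn_right_continuous _ _ _ _ _ _ _ _ hX n 0 z w n0 (lexx _) Ez (t - s) (ltW ts).
  by rewrite divr_gt0.
apply: (@lt_le_trans _ _ (t - s + d1)%:E); first by rewrite lte_fin ltrDl.
apply: le_ereal_inf_tmp => _ [x [x0 [i iLa Zx]] <-].
rewrite lee_fin leNgt; apply/negP => xd.
case: (leP x (t - s)) => xts.
  have xts' : 0 <= x <= t - s by rewrite x0.
  by have := low x i iLa xts'; rewrite Zx; lra.
have xts' : t - s < x < t - s + d1 by rewrite xts.
have := le_lt_trans (coord_le_norm _ i) (hd1 x xts').
rewrite !add0r mxE [X in _ + X]mxE Zx subr0 ltr_norml => /andP[_ h1].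
have lt' : 0 <= t - s <= t - s by rewrite (ltW ts)/=.
by have := low _ i iLa lt'; lra.
Qed.

End UpperTube.

Arguments upper_tube {R N d Om} E P X {T} phi u v c.
Arguments upper_rate {R N d Om} E P X {T} phi u v C.

(** * Choice of the intervals to which (A3) is applied *)

Section Cells.
Context {R : realType} {N : nat} {T : R}.
Hypothesis T0 : 0 < T.
Variable phi : skorohod N T.
Hypothesis ucphi : unif_continuous_on phi.
Implicit Types (a b s t u x e : R).

(** Only the endpoints lie in the face; in between, further coordinates may become positive, which
    (A3) permits since it only forbids hitting x_i = 0 for i in [La]. *)
Definition constant_face s t := s < t -> exists La : {set 'I_N},
  [/\ face La (phi s), face La (phi t) &
      forall i u, i \in La -> s <= u <= t -> 0 < phi u ord0 i].

(* s and t are the extreme points of the cell at which exactly the coordinates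
   positive on the whole cell are positive; both are equal to b if there is no
   such point. *)
Lemma cell_subinterval a b : 0 <= a -> a <= b -> b <= T -> exists s t,
  [/\ a <= s, s <= t, t <= b, constant_face s t &
   forall u, a <= u <= b ->
    (forall i, 0 < phi u ord0 i -> forall x, a <= x <= b -> 0 < phi x ord0 i) ->
    s <= u <= t].
Proof.
move=> a0 ab bT.
pose La : {set 'I_N} := finset (fun i => `[< forall x, a <= x <= b -> 0 < phi x ord0 i >]).
have LaP i : (i \in La) <-> (forall x, a <= x <= b -> 0 < phi x ord0 i).
  by rewrite inE; split => /asboolP.
have mem x : a <= x <= b -> x \in `[0, T].
  by move=> /andP[ax xb]; rewrite in_itv/= (le_trans a0 ax) (le_trans xb).
pose A : set R := [set u | a <= u <= b /\ forall i, i \notin La -> phi u ord0 i = 0].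
have AP u : a <= u <= b ->
    (forall i, 0 < phi u ord0 i -> forall x, a <= x <= b -> 0 < phi x ord0 i) -> A u.
  move=> uab h; split => // i iLa; apply/eqP; rewrite eq_le.
  rewrite (skorohod_orthant phi (mem _ uab)) andbT leNgt; apply: contra iLa => /h.
  by move/LaP.
have faceA u : A u -> face La (phi u).
  move=> [uab h]; split; first exact: (@skorohod_orthant _ _ _ phi u (mem _ uab)).
  apply/setP => i; rewrite inE; case: (boolP (i \in La)) => [/LaP|/h ->]; first exact.
  by rewrite ltxx.
have [[u0 Au0]|nA] := pselect (A !=set0); last first.
  exists b, b; split=> //; first by rewrite /constant_face ltxx.
  by move=> u uab h; exfalso; apply: nA; exists u; exact: AP.
(* [A] is closed, so its infimum and supremum belong to it. *)
have clA v : a <= v <= b -> (forall e, 0 < e -> exists2 u, A u & `|v - u| < e) -> A v.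
  move=> vab h; split => // i iLa; apply/eqP; rewrite -normr_eq0; apply/negPn/negP => nz.
  have pos : 0 < `|phi v ord0 i| by rewrite lt_neqAle eq_sym nz normr_ge0.
  have [d d0 hd] := ucphi pos; have [u Au vu] := h d d0.
  have [uab /(_ i iLa) phiu] := Au.
  have := le_lt_trans (coord_le_norm _ i) (hd _ _ (mem _ vab) (mem _ uab) vu).
  by rewrite !mxE phiu subr0 ltxx.
have lbA : lbound A a by move=> u [/andP[]].
have ubA : ubound A b by move=> u [/andP[]].
have hinf : has_inf A by split; [exists u0|exists a].
have hsup : has_sup A by split; [exists u0|exists b].
have infu u : A u -> inf A <= u by apply: ge_inf; exists a.
have supu u : A u -> u <= sup A by apply: sup_upper_bound.
have ainf : a <= inf A by apply: lb_le_inf => //; exists u0.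
have supb : sup A <= b by apply: ge_sup => //; exists u0.
have infsup : inf A <= sup A by apply: le_trans (infu _ Au0) (supu _ Au0).
have Ainf : A (inf A).
  apply: clA => [|e e0]; first by rewrite ainf (le_trans infsup).
  have [u Au ue] := inf_adherent e0 hinf; exists u => //.
  by rewrite distrC ger0_norm ?subr_ge0 ?infu// ltrBlDl.
have Asup : A (sup A).
  apply: clA => [|e e0]; first by rewrite supb (le_trans ainf).
  have [u Au ue] := sup_adherent e0 hsup; exists u => //.
  by rewrite ger0_norm ?subr_ge0 ?supu// ltrBlDl -ltrBlDr.
exists (inf A), (sup A); split => //.
- move=> _; exists La; split; [exact: faceA|exact: faceA|].
  move=> i u /LaP h /andP[u1 u2]; apply: h.
  by rewrite (le_trans ainf u1) (le_trans u2).
- by move=> u uab h; have Au := AP u uab h; rewrite infu// supu.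
Qed.

Definition grid (m k : nat) : R := k%:R * (T / m.+1%:R).

Lemma grid0 m : grid m 0 = 0. Proof. by rewrite /grid mul0r. Qed.

Lemma gridS m k : grid m k.+1 = grid m k + T / m.+1%:R.
Proof. by rewrite /grid -natr1 mulrDl mul1r. Qed.

Lemma grid_max m : grid m m.+1 = T.
Proof. by rewrite /grid mulrC divfK// pnatr_eq0. Qed.

Lemma grid_ge0 m k : 0 <= grid m k.
Proof. by rewrite /grid mulr_ge0// divr_ge0// ltW. Qed.

Lemma grid_le m k : (k <= m.+1)%N -> grid m k <= T.
Proof.
by move=> km; rewrite -(grid_max m) /grid ler_wpM2r ?divr_ge0 ?(ltW T0)// ler_nat.
Qed.

Lemma grid_cell m x : 0 <= x <= T -> exists2 k, (k < m.+1)%N &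
  grid m k <= x <= grid m k.+1.
Proof.
move=> /andP[x0]; rewrite le_eqVlt => /predU1P[->|xT].
  by exists m => //; rewrite grid_max lexx grid_le.
have h0 : 0 < T / m.+1%:R by rewrite divr_gt0.
have /andP[h1 h2] := truncn_itv (divr_ge0 x0 (ltW h0)).
exists (Num.truncn (x / (T / m.+1%:R))); last first.
  by rewrite /grid -ler_pdivlMr// h1/= -ler_pdivrMr// ltW.
rewrite -(ltr_nat R); apply: le_lt_trans h1 _.
by rewrite ltr_pdivrMr// mulrC divfK// pnatr_eq0.
Qed.

Lemma positive_nearby x : x \in `[0, T] -> exists2 d, 0 < d &
  forall i u, 0 < phi x ord0 i -> u \in `[0, T] -> `|x - u| < d -> 0 < phi u ord0 i.
Proof.
move=> xT.
have : \forall d \near (0:R)^'+, forall i, 0 < phi x ord0 i ->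
    forall u, u \in `[0, T] -> `|x - u| < d -> 0 < phi u ord0 i.
  apply: filter_forall => i.
  case: (boolP (0 < phi x ord0 i)) => [p0|_]; last by apply: nearW.
  have [d d0 hd] := ucphi p0; near=> d' => _ u uT xu.
  have xu' : `|x - u| < d by apply: lt_trans xu _; near: d'; exact: nbhs_right_lt.
  have := le_lt_trans (coord_le_norm _ i) (hd _ _ xT uT xu').
  by rewrite !mxE ltr_norml => /andP[_]; rewrite ltrBlDr -ltrBlDl subrr.
move=> /nbhs_ballP[e /= e0 he].
exists (e / 2); first by rewrite divr_gt0.
move=> i u p0 uT xu; apply: (he (e / 2)) => //=; last by rewrite divr_gt0.
by rewrite /ball/= sub0r normrN gtr0_norm; lra.
Unshelve. all: by end_near. Qed.

(* Almost the whole of [0, T] is kept: a point of a fine enough cell has its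
   positive coordinates positive on the whole cell, so the indicator of the
   union of the [s k, t k] tends to 1 pointwise and Fatou's lemma applies. *)
Lemma cells_cover (eps : R) (M : nat) : 0 < eps -> exists m (s t : nat -> R),
  [/\ (M <= m)%N,
   forall k, (k < m.+1)%N -> [/\ grid m k <= s k, s k <= t k,
      t k <= grid m k.+1 & constant_face (s k) (t k)] &
   T - eps < \sum_(k < m.+1) (t k - s k)].
Proof.
move=> eps0.
have /choice[c hc] : forall mk : nat * nat, exists c : R * R, (mk.2 < mk.1.+1)%N ->
   [/\ grid mk.1 mk.2 <= c.1, c.1 <= c.2, c.2 <= grid mk.1 mk.2.+1,
     constant_face c.1 c.2 &
   forall u, grid mk.1 mk.2 <= u <= grid mk.1 mk.2.+1 ->
    (forall i, 0 < phi u ord0 i -> forall x, grid mk.1 mk.2 <= x <= grid mk.1 mk.2.+1 ->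
        0 < phi x ord0 i) ->
    c.1 <= u <= c.2].
  move=> [m k] /=.
  case: (boolP (k < m.+1)%N) => km; last by exists (0, 0).
  have [||s [t h]] := @cell_subinterval (grid m k) (grid m k.+1) (grid_ge0 _ _).
  - by rewrite gridS lerDl divr_ge0// ltW.
  - exact: grid_le.
  by exists (s, t).
pose S m k := `[(c (m, k)).1, (c (m, k)).2]%classic.
(* Adjacent intervals may share an endpoint, which [g] then counts twice; only its lower bound 1 in
   the limit and its integral are used. *)
pose g m x : \bar R := (\sum_(k < m.+1) (\1_(S m k) x)%:E)%E.
have mS m k : measurable (S m k) by exact: measurable_itv.
have mi m (k : 'I_m.+1) : measurable_fun `[0, T] (fun x => (\1_(S m k) x)%:E : \bar R).
  by apply/measurable_EFinP; exact: measurable_indic.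
have mg m : measurable_fun `[0, T] (g m).
  by apply: emeasurable_sum => k; exact: mi.
have g0 m x : `[0, T]%classic x -> (0 <= g m x)%E.
  by move=> _; apply: sume_ge0 => k _; rewrite lee_fin.
have g1 x : `[0, T]%classic x -> (1 <= limn_einf (g ^~ x))%E.
  move=> xT; apply: limn_einf_ge; have [d d0 hd] := positive_nearby xT.
  near=> m.
  have md : T / m.+1%:R < d.
    rewrite ltr_pdivrMr// mulrC -ltr_pdivrMr//.
    apply: (@lt_le_trans _ _ m%:R); last by rewrite ler_nat.
    by near: m; exact: nbhs_infty_gtr.
  have [|k km /andP[k1 k2]] := @grid_cell m x; first by move: xT; rewrite /= in_itv.
  have [_ _ _ _ hk] := hc (m, k) km.
  have xS : S m k x.
    rewrite /S/= in_itv/=; apply: hk => /=; first by rewrite k1.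
    move=> i p0 u /andP[u1 u2]; apply: hd p0 _ _.
      by rewrite in_itv/= (le_trans (grid_ge0 _ _) u1) (le_trans u2)// grid_le.
    apply: le_lt_trans md; rewrite ler_norml.
    by move: k1 k2 u1 u2; rewrite gridS; move: (grid m k) (_ / _) => y h; lra.
  rewrite /g (bigD1 (Ordinal km))//= indicE mem_set//.
  by rewrite leeDl// sume_ge0// => j _; rewrite lee_fin.
have ig m : (\int[lebesgue_measure]_(x in `[0%R, T]) g m x <=
    (\sum_(k < m.+1) ((c (m, nat_of_ord k)).2 - (c (m, nat_of_ord k)).1))%:E)%E.
  rewrite ge0_integral_sum//=; last by move=> k; exact: mi.
  rewrite -sumEFin; apply: lee_sum => k _.
  rewrite (@integral_indic _ _ _ lebesgue_measure _ (measurable_itv _) _ (mS m k)).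
  have [gs st tg _ _] := hc (m, nat_of_ord k) (ltn_ord k).
  rewrite setIidl; last first.
    move=> x; rewrite /S/= !in_itv/= => /andP[x1 x2].
    rewrite (le_trans (grid_ge0 m k) (le_trans gs x1)) (le_trans x2 (le_trans tg _))//.
    by apply: grid_le; exact: ltn_ord.
  move: st.
  have := lebesgue_measure_itv `[(c (m, nat_of_ord k)).1, (c (m, nat_of_ord k)).2].
  rewrite /S/= => ->; rewrite le_eqVlt lte_fin => /predU1P[->|->].
    by rewrite ltxx subrr.
  by [].
have : ((T - eps)%:E < limn_einf (fun m => \int[lebesgue_measure]_(x in `[0%R, T]) g m x))%E.
  apply: lt_le_trans (fatou lebesgue_measure (measurable_itv _) mg g0).
  apply: (@lt_le_trans _ _ (\int[lebesgue_measure]_(x in `[0%R, T]) cst 1 x)%E).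
    rewrite integral_cst//= mul1e; have := lebesgue_measure_itv `[0, T].
    by rewrite /= lte_fin T0 => ->; rewrite sube0 lte_fin; lra.
  apply: ge0_le_integral => //.
    apply: (measurableT_comp (@oppe_measurable R setT)).
    apply: measurable_fun_limn_esup => m.
    exact: (measurableT_comp (@oppe_measurable R setT) (mg m)).
move=> /limn_einf_gt h.
have [m [hm Mm]] : exists m,
    ((T - eps)%:E < \int[lebesgue_measure]_(x in `[0%R, T]) g m x)%E /\ (M <= m)%N.
  near \oo => m; exists m; split; first by near: m.
  by near: m; exact: nbhs_infty_ge.
exists m, (fun k => (c (m, k)).1), (fun k => (c (m, k)).2); split => //.
  by move=> k km; have [] := hc (m, k) km.
by have := lt_le_trans hm (ig m); rewrite lte_fin.
Unshelve. all: by end_near. Qed.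

End Cells.

Lemma duration_cat (R : realType) (N : nat) (s1 s2 : seq (R * 'rV[R]_N)) :
  duration (s1 ++ s2) = duration s1 + duration s2.
Proof. by elim: s1 => [|[h q] s1 IH] /=; rewrite ?add0r// IH addrA. Qed.

(** * The polygonal skeleton of a path *)

Section Skeleton.
Context {R : realType} {N : nat} {d : measure_display} {Om : measurableType d}.
Context {E : set 'rV[R]_N} {P : 'rV[R]_N -> probability Om R}
  {X : R -> 'rV[R]_N -> Om -> 'rV[R]_N}
  {K : R -> R.-pker (borelRV R N) ~> (borelRV R N)}.
Hypothesis hX : markov_process E P X K.
Context {T : R}.
Hypothesis T0 : 0 < T.
Context {L : {set 'I_N} -> 'rV[R]_N -> \bar R}.
Hypothesis hL0 : forall La v, (0 <= L La v)%E.
Hypothesis hA3 : local_upper_bound E P X L.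
Variable phi : skorohod N T.
Hypothesis ucphi : unif_continuous_on phi.
Variables (r C : R).
Hypotheses (r0 : 0 < r) (r1 : r <= 1) (C0 : 0 <= C)
  (hC : forall v, `|v| <= r -> (L [set: 'I_N]%SET v <= C%:E)%E).
Variables (kappa : R) (M : nat) (a s t : nat -> R).
Hypothesis kappa0 : 0 < kappa.
Hypothesis hcell : forall k, (k < M)%N -> [/\ a k <= s k, s k <= t k,
  t k <= a k.+1 & constant_face phi (s k) (t k)].
Hypothesis ha : forall k, (k <= M)%N -> 0 <= a k <= T.

(** The size of the detour over a gap. It dominates the displacement, as [detour_cost] requires; it
    dominates the length of the gap, so that the skeleton never runs ahead of [phi]; and [kappa]
    keeps it positive when the gap is empty. *)
Definition gap_left k := s k - a k + `|phi (s k) - phi (a k)| + kappa.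
Definition gap_right k := a k.+1 - t k + `|phi (a k.+1) - phi (t k)| + kappa.
Definition gaps k := gap_left k + gap_right k.

Definition crossing k : seq (R * 'rV[R]_N) :=
  if s k < t k then [:: (t k - s k, phi (t k))] else [::].

(* The intervals [s k, t k] are traversed at constant velocity; the gaps are
   bridged through the interior of the orthant. *)
Fixpoint skeleton k j : seq (R * 'rV[R]_N) :=
  if j is j'.+1 then
    detour r (gap_left k) (phi (a k)) (phi (s k)) ++
    crossing k ++
    detour r (gap_right k) (phi (t k)) (phi (a k.+1)) ++
    skeleton k.+1 j'
  else [::].

Let bounds k : (k < M)%N -> [/\ 0 <= a k, a k <= s k, s k <= t k,
  t k <= a k.+1 & a k.+1 <= T].
Proof.
move=> kM; have [h1 h2 h3 _] := hcell kM; split => //.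
  by have /andP[] := ha (ltnW kM).
by have /andP[] := ha kM.
Qed.

Let orth k : (k < M)%N -> [/\ orthant (phi (a k)), orthant (phi (s k)),
  orthant (phi (t k)) & orthant (phi (a k.+1))].
Proof.
move=> kM; have [h1 h2 h3 h4 h5] := bounds kM.
by split; apply: skorohod_orthant; rewrite in_itv/=; lra.
Qed.

Let gap_left_ge k : (k < M)%N -> s k - a k < gap_left k.
Proof.
by move=> kM; rewrite /gap_left -addrA ltrDl ltr_wpDl.
Qed.

Let gap_right_ge k : (k < M)%N -> a k.+1 - t k < gap_right k.
Proof.
by move=> kM; rewrite /gap_right -addrA ltrDl ltr_wpDl.
Qed.

Let gap_left_gt0 k : (k < M)%N -> 0 < gap_left k.
Proof.
move=> kM; apply: le_lt_trans (gap_left_ge kM); rewrite subr_ge0.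
by have [] := bounds kM.
Qed.

Let gap_right_gt0 k : (k < M)%N -> 0 < gap_right k.
Proof.
move=> kM; apply: le_lt_trans (gap_right_ge kM); rewrite subr_ge0.
by have [] := bounds kM.
Qed.

Let detour_long x : 0 < x -> x <= 4 * x / r.
Proof.
move=> x0; rewrite ler_pdivlMr//; have := ler_wpM2l (ltW x0) r1; lra.
Qed.

Lemma skeleton_admissible k j : (k + j <= M)%N -> admissible (skeleton k j).
Proof.
elim: j k => [//|j IH] k; rewrite addnS -addSn => kM.
have kM' : (k < M)%N by rewrite (leq_trans _ kM)// leq_addr.
have [orth1 orth2 orth3 orth4] := orth kM'.
rewrite [skeleton _ _]/=; apply: detour_admissible => //; first exact: gap_left_gt0.
have D : admissible (detour r (gap_right k) (phi (t k)) (phi (a k.+1)) ++ skeleton k.+1 j).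
  by apply: detour_admissible => //; [exact: gap_right_gt0|exact: IH].
by rewrite /crossing; case: ifP => st //; split => //; rewrite subr_gt0.
Qed.

(** As [r <= 1], a detour lasts at least its size, which exceeds the length of the gap it
    replaces. *)
Lemma skeleton_duration k j : (k + j <= M)%N ->
  a (k + j)%N - a k <= duration (skeleton k j).
Proof.
elim: j k => [|j IH] k; first by rewrite addn0 subrr.
rewrite addnS -addSn => kM.
have kM' : (k < M)%N by rewrite (leq_trans _ kM)// leq_addr.
rewrite [skeleton _ _]/= detour_duration.
rewrite duration_cat detour_duration.
have -> : duration (crossing k) = t k - s k.
  rewrite /crossing; case: ltP => st; first by rewrite /= addr0.
  have [_ _ st' _ _] := bounds kM'.
  by have -> : t k = s k by [apply/eqP; rewrite eq_le st st']; rewrite subrr.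
have h1 := detour_long (gap_left_gt0 kM'); have h2 := detour_long (gap_right_gt0 kM').
have h3 := gap_left_ge kM'; have h4 := gap_right_ge kM'.
by have := IH _ kM; lra.
Qed.

Lemma posc_face La (p q : 'rV[R]_N) : face La p -> face La q -> posc (p + q) = La.
Proof.
move=> [p0 <-] [q0 pq]; apply/setP => i; rewrite !inE mxE.
have : (i \in posc q) = (i \in posc p) by rewrite pq.
rewrite !inE; have := p0 i; have := q0 i.
case: (ltP 0 (q ord0 i)) => h1; case: (ltP 0 (p ord0 i)) => h2 //= h3 h4 _.
  by rewrite addr_gt0.
by apply/negbTE; rewrite -leNgt; lra.
Qed.

(** In the probability bound a gap has rate 0, while in the cost it is a detour paid at rate at most
    [C]; the crossings contribute the same amount to both. The inequality is additive because [Cst]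
    may be infinite. *)
Lemma skeleton_cost k j : (k + j <= M)%N -> exists Cst : \bar R,
  [/\ (0 <= Cst)%E, upper_rate E P X phi (a k) (a (k + j)%N) Cst &
  (polycost L (phi (a k)) (skeleton k j) <=
   Cst + (4 * (\sum_(k <= i < k + j) gaps i) / r * C)%:E)%E].
Proof.
elim: j k => [|j IH] k.
  rewrite addn0 => kM; exists 0%E; split => //.
    by apply: (upper_rate0 hX) => //; have /andP[] := ha kM.
  by rewrite big_geq// mulr0 !mul0r adde0.
rewrite addnS -addSn => kM.
have kM' : (k < M)%N by rewrite (leq_trans _ kM)// leq_addr.
have [Cst [C10 C1 C2]] := IH _ kM.
have [a0 as_ st ta aT] := bounds kM'.
have [orth1 orth2 orth3 orth4] := orth kM'.
have /andP[_ aj] : 0 <= a (k.+1 + j)%N <= T by exact: ha.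
have aa : a k.+1 <= a (k.+1 + j)%N.
  clear - hcell kM; elim: j kM => [|j IHj] jM; first by rewrite addn0.
  rewrite addnS in jM *; apply: le_trans (IHj (ltnW jM)) _.
  have [h1 h2 h3 _] := hcell jM; exact: le_trans h1 (le_trans h2 h3).
pose rest := detour r (gap_right k) (phi (t k)) (phi (a k.+1)) ++ skeleton k.+1 j.
have rest_cost : (polycost L (phi (t k)) rest <=
    (4 * gap_right k / r * C)%:E + polycost L (phi (a k.+1)) (skeleton k.+1 j))%E.
  apply: detour_cost => //; first exact: gap_right_gt0.
  by rewrite /gap_right -addrA addrCA lerDl addr_ge0 ?(ltW kappa0)// subr_ge0.
have rate_rest : upper_rate E P X phi (t k) (a (k.+1 + j)%N) Cst.
  rewrite -[Cst]add0e; apply: (upper_rate_cat hX ucphi _ ta) => //.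
  - exact: le_trans (le_trans a0 as_) st.
  - by apply: (upper_rate0 hX) => //; exact: le_trans (le_trans a0 as_) st.
have [Cst' [C'0 C'1 C'2]] : exists Cst', [/\ (0 <= Cst')%E,
    upper_rate E P X phi (s k) (a (k.+1 + j)%N) Cst' &
    (polycost L (phi (s k)) (crossing k ++ rest)
     <= Cst' + (4 * (gap_right k + \sum_(k.+1 <= i < k.+1 + j) gaps i) / r * C)%:E)%E].
  have rest_le : (polycost L (phi (t k)) rest <= Cst +
     (4 * (gap_right k + \sum_(k.+1 <= i < k.+1 + j) gaps i) / r * C)%:E)%E.
    apply: (le_trans rest_cost); apply: le_trans (leeD2l _ C2) _.
    by rewrite addeCA -EFinD leeD2l// lee_fin; lra.
  rewrite /crossing; have [st'|ts] := ltP (s k) (t k); last first.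
    have e : t k = s k by apply/eqP; rewrite eq_le ts st.
    by exists Cst; split => //; rewrite -e.
  have [_ _ _ /(_ st')[La [F1 F2 pos]]] := hcell kM'.
  exists ((t k - s k)%:E * L La ((t k - s k)^-1 *: (phi (t k) - phi (s k))) + Cst)%E.
  have c0 : (0 <= (t k - s k)%:E * L La ((t k - s k)^-1 *: (phi (t k) - phi (s k))))%E.
    by rewrite mule_ge0// lee_fin subr_ge0.
  split; first by rewrite adde_ge0.
  - apply: (upper_rate_cat hX ucphi _ st) => //.
    + exact: le_trans as_.
    + exact: le_trans aa.
    + apply: (upper_rate_face hX) => //; first exact: le_trans as_.
      exact: le_trans aT.
  - by rewrite [polycost _ _ _]/= (posc_face F1 F2) -addeA leeD2l.
exists Cst'; split => //.
  rewrite -[Cst']add0e; apply: (upper_rate_cat hX ucphi _ as_) => //.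
  - exact: le_trans (le_trans st ta) aa.
  - apply: (upper_rate0 hX) => //.
    exact: le_trans (le_trans st ta) aT.
rewrite [skeleton _ _]/=.
apply: le_trans (detour_cost _ r0 (gap_left_gt0 kM') _ hC orth1 orth2) _.
  by rewrite /gap_left -addrA addrCA lerDl addr_ge0 ?(ltW kappa0)// subr_ge0.
apply: le_trans (leeD2l _ C'2) _.
rewrite addeCA -EFinD leeD2l// lee_fin (big_ltn (_ : k < k.+1 + j)%N) ?ltnS ?leq_addr//.
by rewrite /gaps; lra.
Qed.

Lemma tracks_detour (f : R -> 'rV[R]_N) e u x p q l : 0 < x ->
  (forall v, u <= v <= u + 4 * x / r -> v <= T -> `|p - f v| + x <= e /\ `|q - f v| <= e) ->
  tracks f T e (u + 4 * x / r) q l -> tracks f T e u p (detour r x p q ++ l).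
Proof.
move=> x0 h hl.
have h0 : 0 < 2 * x / r by rewrite divr_gt0// mulr_gt0.
have e4 : 4 * x / r = 2 * x / r + 2 * x / r by lra.
have nx v : v \in [set v | u <= v <= u + 4 * x / r /\ v <= T] -> `|p + const_mx x - f v| <= e.
  rewrite inE/= => -[uv vT]; have [h1 _] := h v uv vT; apply: le_trans h1.
  rewrite addrAC (le_trans (ler_normD _ _))// lerD2l.
  by apply/row_norm_leP; [exact: ltW|move=> i; rewrite mxE gtr0_norm].
split=> [v /andP[uv vx] vT|].
  have uvx : u <= v <= u + 4 * x / r by rewrite uv/=; lra.
  have [h1 _] := h v uvx vT; split; first by apply: le_trans h1; rewrite lerDl ltW.
  by apply: nx; rewrite inE.
split=> [v /andP[uv vx] vT|]; last by rewrite -addrA -e4.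
have uvx : u <= v <= u + 4 * x / r by apply/andP; split; lra.
have [_ h1] := h v uvx vT; split => //.
by apply: nx; rewrite inE.
Qed.

(** At time [u] the skeleton enters cell [k] with lag [u - a k]. The lag plus the duration of all
    remaining detours is an invariant bounded by [rho2], so a vertex [phi y] of the skeleton is only
    compared with [phi v] when [y] and [v] differ by at most one mesh plus the lag. *)
Lemma skeleton_tracks e rho1 rho2 k j u : (k + j <= M)%N ->
  (forall x y, x \in `[0, T] -> y \in `[0, T] -> `|x - y| <= rho1 + rho2 ->
     `|phi x - phi y| <= e / 2) ->
  (forall i, (i < M)%N -> a i.+1 - a i <= rho1) ->
  (forall i, (i < M)%N -> gaps i <= e / 2) ->
  a k <= u -> u - a k + 4 * (\sum_(k <= i < k + j) gaps i) / r <= rho2 ->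
  tracks phi T e u (phi (a k)) (skeleton k j).
Proof.
move=> + hmod hmesh hgap; elim: j k u => [//|j IH] k u.
rewrite addnS -addSn => kM au hu.
have kM' : (k < M)%N by rewrite (leq_trans _ kM)// leq_addr.
have [a0 as_ st ta aT] := bounds kM'.
have mesh := hmesh _ kM'; have gap := hgap _ kM'.
have gl := gap_left_gt0 kM'; have gr := gap_right_gt0 kM'.
have gl' := gap_left_ge kM'; have gr' := gap_right_ge kM'.
have sum0 : 0 <= \sum_(k.+1 <= i < k.+1 + j) gaps i.
  rewrite big_nat_cond; apply: sumr_ge0 => i; rewrite andbT => /andP[_ ij].
  have iM : (i < M)%N by exact: leq_trans ij kM.
  by rewrite addr_ge0 ?ltW ?gap_left_gt0 ?gap_right_gt0.
rewrite (big_ltn (_ : k < k.+1 + j)%N) ?ltnS ?leq_addr// in hu.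
have hu' : u - a k + (4 * gap_left k / r + 4 * gap_right k / r) +
    4 * (\sum_(k.+1 <= i < k.+1 + j) gaps i) / r <= rho2.
  by apply: le_trans hu; rewrite /gaps; lra.
have S0 : 0 <= 4 * (\sum_(k.+1 <= i < k.+1 + j) gaps i) / r.
  by rewrite divr_ge0 ?mulr_ge0// ltW.
have b1 := detour_long gl; have b2 := detour_long gr.
have [gL eL] : exists x, x = 4 * gap_left k / r by exists (4 * gap_left k / r).
have [gR eR] : exists x, x = 4 * gap_right k / r by exists (4 * gap_right k / r).
rewrite -eL in b1 hu'; rewrite -eR in b2 hu'.
have near y v : a k <= y <= a k.+1 -> a k <= v -> v <= T ->
    v <= u + gL + (t k - s k) + gR -> `|phi y - phi v| <= e / 2.
  move=> /andP[y1 y2] v1 v2 v3; apply: hmod; rewrite ?in_itv/=; [lra|lra|].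
  by rewrite ler_norml; lra.
rewrite [skeleton _ _]/=.
apply: tracks_detour => //; rewrite -eL.
  move=> v /andP[v1 v2] vT; split.
    have : `|phi (a k) - phi v| <= e / 2 by apply: near => //; lra.
    by move: gap; rewrite /gaps; lra.
  have : `|phi (s k) - phi v| <= e / 2 by apply: near => //; lra.
  by move: (normr_ge0 (phi (s k) - phi v)); lra.
have tail : tracks phi T e (u + gL + (t k - s k)) (phi (t k))
    (detour r (gap_right k) (phi (t k)) (phi (a k.+1)) ++ skeleton k.+1 j).
  apply: tracks_detour => //; rewrite -eR.
    move=> v /andP[v1 v2] vT; split.
      have : `|phi (t k) - phi v| <= e / 2 by apply: near => //; lra.
      by move: gap; rewrite /gaps; lra.
    have : `|phi (a k.+1) - phi v| <= e / 2 by apply: near => //; lra.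
    by move: (normr_ge0 (phi (a k.+1) - phi v)); lra.
  by apply: IH => //; lra.
rewrite /crossing; case: ltP => st'; last first.
  have e' : t k = s k by apply/eqP; rewrite eq_le st st'.
  by move: tail; rewrite e' subrr addr0.
split => // v /andP[v1 v2] vT; split.
  have : `|phi (s k) - phi v| <= e / 2 by apply: near => //; lra.
  by move: (normr_ge0 (phi (s k) - phi v)); lra.
have : `|phi (t k) - phi v| <= e / 2 by apply: near => //; lra.
by move: (normr_ge0 (phi (t k) - phi v)); lra.
Qed.

End Skeleton.

(** * The upper bound *)

Section UpperBound.
Context {R : realType} {N : nat} {d : measure_display} {Om : measurableType d}.
Context {E : set 'rV[R]_N} {P : 'rV[R]_N -> probability Om R}
  {X : R -> 'rV[R]_N -> Om -> 'rV[R]_N}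
  {K : R -> R.-pker (borelRV R N) ~> (borelRV R N)}.
Hypothesis hX : markov_process E P X K.
Context {T : R}.
Hypothesis T0 : 0 < T.
Context {L : {set 'I_N} -> 'rV[R]_N -> \bar R}.
Hypothesis hL0 : forall La v, (0 <= L La v)%E.
Hypothesis hLconv : forall La, convex_ereal (L La).
Hypothesis hA2 : \forall v \near (0 : 'rV[R]_N), (L [set: 'I_N]%SET v < +oo)%E.
Hypothesis hA3 : local_upper_bound E P X L.
Implicit Types (phi psi : skorohod N T) (x z : 'rV[R]_N).

Lemma sum_grid m : \sum_(k < m.+1) (grid (T := T) m k.+1 - grid (T := T) m k) = T.
Proof.
rewrite -(big_mkord xpredT (fun k => grid (T := T) m k.+1 - grid (T := T) m k)).
by rewrite telescope_sumr// grid_max grid0 subr0.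
Qed.

Lemma grid_homo m : {homo @grid R T m : i j / (i <= j)%N >-> i <= j}.
Proof.
by move=> i j ij; rewrite /grid ler_wpM2r ?ler_nat// divr_ge0// ltW.
Qed.

Lemma cells_trivIset m (a b : nat -> R) n :
  (forall k, (k < n)%N -> grid (T := T) m k <= a k /\ b k <= grid (T := T) m k.+1) ->
  trivIset `I_n (fun k => `]a k, b k[%classic).
Proof.
move=> h i j /= iN jN [x [/=]]; rewrite !in_itv/= => /andP[xi1 xi2] /andP[xj1 xj2].
have lt_abs i' j' : (i' < n)%N -> (j' < n)%N -> (i' < j')%N -> a j' < x -> x < b i' -> False.
  move=> /h[_ h1] /h[h2 _] ij ax xb.
  have := lt_le_trans xb (le_trans h1 (le_trans (grid_homo m ij) h2)).
  by move=> /(lt_trans ax); rewrite ltxx.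
by case: (ltngtP i j) => // ij; exfalso; [apply: (lt_abs i j)|apply: (lt_abs j i)].
Qed.

(** The truncated skeleton of a fine subdivision is a piecewise linear path near [phi], so its
    action is at least [local_inf], which exceeds [c]. Removing the cost of the gaps leaves a rate
    still above [c] for a tube around [phi], and this tube contains a Skorohod ball. *)
Lemma local_upper phi (c : R) : absolutely_continuous phi -> (c%:E < Ifun L phi)%E ->
  exists2 delta : R, 0 < delta &
    exp_upper E P (phi 0) (fun n z => path_event X n z (ball phi delta)) c.
Proof.
move=> ac /Ifun_gt[delta0 d00 hc]; have uc := ac_unif_continuous ac.
have [c2 [cc2 hc2]] : exists c2, c < c2 /\ (c2%:E <= local_inf L phi delta0)%E.
  move: hc; case: (local_inf L phi delta0) => [y| |]//; last by exists (c + 1); rewrite leey ltrDl.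
  by rewrite lte_fin => cy; exists y.
have [r [C [r0 r1 C0 hC]]] := convex_bounded_near0 (hLconv _) (hL0 _) hA2.
pose e := delta0 / 2; have e0 : 0 < e by rewrite divr_gt0.
have [rho rho0 hrho] := uc _ (divr_gt0 e0 (ltr0n _ 2)).
have C1 : 0 < C + 1 by rewrite ltr_wpDl.
(* The total size allowed for the gaps: each is then at most [e / 2], the lag 4w/r at most
   [rho / 3], and the cost of all detours below [c2 - c]. *)
pose w := Num.min (e / 2) (Num.min (rho * r / 12) ((c2 - c) * r / (8 * (C + 1)))).
have w0 : 0 < w.
  rewrite !lt_min; apply/and3P; split; [by rewrite divr_gt0|by rewrite divr_gt0// mulr_gt0|].
  by rewrite divr_gt0 ?mulr_gt0// subr_gt0.
have we : w <= e / 2 by rewrite ge_min lexx.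
have wrho : 4 * w / r <= rho / 3.
  have : w <= rho * r / 12 by rewrite /w !ge_min lexx orbT.
  by rewrite ler_pdivrMr//; lra.
have wC : 4 * w / r * C < c2 - c.
  have : w <= (c2 - c) * r / (8 * (C + 1)) by rewrite /w !ge_min lexx !orbT.
  rewrite ler_pdivlMr ?mulr_gt0// mulrAC ltr_pdivrMr//.
  have : 0 < (c2 - c) * r by rewrite mulr_gt0// subr_gt0.
  by nra.
have w40 : 0 < w / 4 by rewrite divr_gt0.
have [d1 d10 hd1] := ac _ w40.
(* Four quarters of [w]: the total length of the gaps, the variation over the left gaps, that over
   the right gaps, and the [m.+1] pairs of [kappa]. *)
pose eps := Num.min d1 (w / 4).
have eps0 : 0 < eps by rewrite lt_min d10.
(* The lower bound on [m] makes the mesh at most [rho / 3]. *)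
have [m [s [t [Mm hcell hsum]]]] :=
  @cells_cover _ _ _ T0 phi uc eps (Num.truncn (3 * T / rho)) eps0.
pose a := grid (T := T) m; pose kappa := w / 8 / m.+1%:R.
have kappa0 : 0 < kappa by rewrite !divr_gt0.
have ha k : (k <= m.+1)%N -> 0 <= a k <= T.
  by move=> km; rewrite /a grid_ge0// grid_le.
have sumgap : \sum_(k < m.+1) (s k - a k) + \sum_(k < m.+1) (a k.+1 - t k) < eps.
  have : \sum_(k < m.+1) (s k - a k) + \sum_(k < m.+1) (a k.+1 - t k) +
      \sum_(k < m.+1) (t k - s k) = T.
    by rewrite -!big_split/= -[RHS](sum_grid m); apply: eq_bigr => k _; rewrite /a; ring.
  by move: hsum; lra.
have sl0 : 0 <= \sum_(k < m.+1) (s k - a k).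
  by apply: sumr_ge0 => k _; rewrite subr_ge0; case: (hcell k (ltn_ord k)).
have sr0 : 0 <= \sum_(k < m.+1) (a k.+1 - t k).
  by apply: sumr_ge0 => k _; rewrite subr_ge0; case: (hcell k (ltn_ord k)).
have epsd : eps <= d1 by rewrite ge_min lexx.
have epsw : eps <= w / 4 by rewrite ge_min lexx orbT.
have vl : \sum_(k < m.+1) `|phi (s k) - phi (a k)| < w / 4.
  apply: (hd1 m.+1 a s); last by lra.
    move=> k km; have [h1 h2 h3 _] := hcell k km; have /andP[h4 _] := ha k (ltnW km).
    have /andP[_ h5] := ha _ km; rewrite h4 h1; split => //.
    exact: le_trans (le_trans h2 h3) h5.
  apply: (@cells_trivIset m) => k km; rewrite lexx; split => //.
  by have [h1 h2 h3 _] := hcell k km; exact: le_trans h3.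
have vr : \sum_(k < m.+1) `|phi (a k.+1) - phi (t k)| < w / 4.
  apply: (hd1 m.+1 t (fun k => a k.+1)); last by lra.
    move=> k km; have [h1 h2 h3 _] := hcell k km; have /andP[h4 _] := ha k (ltnW km).
    have /andP[_ h5] := ha _ km; rewrite h3 h5; split => //; rewrite andbT.
    exact: le_trans h4 (le_trans h1 h2).
  apply: (@cells_trivIset m) => k km; rewrite lexx; split => //.
  by have [h1 h2 h3 _] := hcell k km; exact: le_trans h1 h2.
have gapsW : \sum_(0 <= k < 0 + m.+1) gaps phi kappa a s t k <= w.
  rewrite add0n big_mkord.
  have -> : \sum_(k < m.+1) gaps phi kappa a s t k =
     (\sum_(k < m.+1) (s k - a k) + \sum_(k < m.+1) (a k.+1 - t k)) +
     \sum_(k < m.+1) `|phi (s k) - phi (a k)| +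
     \sum_(k < m.+1) `|phi (a k.+1) - phi (t k)| + \sum_(k < m.+1) (kappa + kappa).
    by rewrite -!big_split/=; apply: eq_bigr => k _; rewrite /gaps /gap_left /gap_right; ring.
  have -> : \sum_(k < m.+1) (kappa + kappa) = w / 4.
    rewrite sumr_const card_ord -[LHS]mulr_natr /kappa.
    have /eqP m0 : m.+1%:R != 0 :> R by rewrite pnatr_eq0.
    by move: m0; move: (m.+1%:R : R) => q /eqP q0; field.
  by move: sumgap; lra.
have gaps0 k : (k < m.+1)%N -> 0 <= gaps phi kappa a s t k.
  move=> km; have [h1 h2 h3 _] := hcell k km; rewrite /gaps /gap_left /gap_right.
  have := normr_ge0 (phi (s k) - phi (a k)); have := normr_ge0 (phi (a k.+1) - phi (t k)).
  by rewrite -/a in h1 h3; lra.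
have gapse k : (k < m.+1)%N -> gaps phi kappa a s t k <= e / 2.
  move=> km; apply: le_trans we; apply: le_trans gapsW.
  rewrite add0n big_mkord (bigD1 (Ordinal km))//= lerDl.
  by apply: sumr_ge0 => j _; exact: gaps0.
have kM : (0 + m.+1 <= m.+1)%N by [].
have [Cst [Cst0 Crate Ccost]] :=
  skeleton_cost hX hL0 hA3 uc r0 hC kappa0 hcell ha kM.
have adm := skeleton_admissible r0 kappa0 hcell ha kM.
have dur := skeleton_duration r0 r1 kappa0 hcell ha kM.
have trk : tracks phi T e 0 (phi (a 0)) (skeleton phi r kappa a s t 0 m.+1).
  apply: (skeleton_tracks (rho1 := rho / 3) (rho2 := rho / 3) r0 r1 kappa0 hcell ha kM) => //.
  - move=> y y' yT y'T yy'; apply: ltW; apply: hrho => //; move: yy'; lra.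
  - move=> i _; rewrite /a gridS addrAC subrr add0r.
    rewrite ler_pdivrMr// mulrC -ler_pdivrMr ?divr_gt0//.
    have -> : T / (rho / 3) = 3 * T / rho by field; rewrite gt_eqF.
    have /andP[_ /ltW/le_trans] := truncn_itv (divr_ge0 (mulr_ge0 (ler0n R 3) (ltW T0)) (ltW rho0)).
    by apply; rewrite ler_nat ltnS.
  - by rewrite /a grid0.
  - rewrite grid0 subrr add0r; apply: le_trans wrho.
    by rewrite ler_wpM2r ?invr_ge0 ?(ltW r0)// ler_wpM2l.
have a00 : a 0%N = 0 by rewrite /a grid0.
have aT : a (0 + m.+1)%N = T by rewrite add0n /a grid_max.
rewrite -/a in Crate Ccost dur trk; rewrite a00 in Crate Ccost dur trk; rewrite aT in Crate dur.
rewrite subr0 in dur.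
have p0 : orthant (phi 0) by apply: skorohod_orthant; rewrite in_itv/= lexx ltW.
have Tdur : 0 < T <= duration (skeleton phi r kappa a s t 0 m.+1) by rewrite T0.
have [s' [s'0 s'T s'L s'E]] := truncate_polypath hL0 p0 adm Tdur.
have [psi [pl psiE]] := skorohod_polypath T0 p0 s'0 s'T.
have hpsi : (dS phi psi < delta0%:E)%E.
  apply: (@unif_dS _ _ _ _ _ e); first by rewrite /e; lra.
  move=> v vT; rewrite psiE// distrC; have /andP[v0 vT'] : 0 <= v <= T by move: vT; rewrite in_itv.
  (* The starting time is treated apart, being excluded from [tracks_polypath]. *)
  rewrite s'E//; move: v0; rewrite le_eqVlt => /predU1P[<-|v0].
    by rewrite polypath0// subrr normr0 ltW.
  have := tracks_polypath adm trk (t := v); rewrite subr0; apply => //.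
  by rewrite v0 add0r (le_trans vT').
(* The action of [psi] is at least [c2], and the detours account for less than [c2 - c] of it. *)
have cCst : (c%:E < Cst)%E.
  have h1 : (c2%:E <= Cst + (4 * (\sum_(0 <= i < 0 + m.+1) gaps phi kappa a s t i) / r * C)%:E)%E.
    apply: (le_trans hc2); apply: (le_trans _ Ccost); apply: (le_trans _ s'L).
    rewrite -(Jfun_polypath hL0 p0 s'0 s'T psiE).
    by apply: ereal_inf_lbound; exists psi.
  have h2 : 4 * (\sum_(0 <= i < 0 + m.+1) gaps phi kappa a s t i) / r * C <= 4 * w / r * C.
    by rewrite ler_wpM2r// ler_wpM2r ?invr_ge0 ?(ltW r0)// ler_wpM2l.
  move: h1 Cst0; case: Cst {Crate Ccost} => [y| |]//; last by rewrite ltry.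
  by rewrite -EFinD lee_fin lte_fin; lra.
have [r2 r20 hr2] := Crate c cCst.
have [delta d0 hdelta] := dS_unif uc r20.
exists delta => //; exists r2 => //.
apply: filterS2 hr2 (nbhs_infty_gt 0%N) => n hn n0 z Ez zr.
have rc : right_continuous_on (T - 0) (fun t => phi (0 + t)).
  exact: shift_right_continuous.
apply: le_trans (hn z Ez (ltW zr)).
rewrite -(mu_ext_tube hX)//; last by rewrite subr0 ltW.
apply: le_outer_measure => v [psi' hpsi' psi'E] y; rewrite subr0 => yT.
rewrite !add0r distrC -psi'E ?in_itv//; apply: ltW; exact: hdelta.
Qed.

Variable It : skorohod N T -> \bar R.
Hypothesis hItgood : good_rate_function It.
Hypothesis hItupper : upper_ld_bound E P X It.

(** All rates strictly below [a] rather than [a] itself: this form is stable under finite unions. *)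
Let negligible_below x (a : R) (G : set (skorohod N T)) :=
  forall c, c < a -> exp_upper E P x (fun n z => path_event X n z G) c.

Lemma exp_upperU x (A B : nat -> 'rV[R]_N -> set Om) (a c : R) : c < a ->
  exp_upper E P x A a -> exp_upper E P x B a ->
  exp_upper E P x (fun n z => A n z `|` B n z) c.
Proof.
move=> ca [e1 e10 h1] [e2 e20 h2]; exists (Num.min e1 e2); first by rewrite lt_min e10.
near=> n => z Ez; rewrite lt_min => /andP[z1 z2].
apply: le_trans (outer_measureU2 _ _ _) _.
apply: (@le_trans _ _ ((expR (- (n%:R * a)))%:E + (expR (- (n%:R * a)))%:E)%E).
  apply: leeD.
    by move: z Ez z1 {z2}; near: n; exact: h1.
  by move: z Ez z2 {z1}; near: n; exact: h2.
(* Then the exponential of n(a - c) is at least 2, the number of terms in the union bound. *)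
have na : 1 <= n%:R * (a - c).
  rewrite -ler_pdivrMr ?subr_gt0// mul1r; near: n; exact: nbhs_infty_ger.
rewrite -EFinD lee_fin -mulr2n -[leLHS]mulr_natl.
have -> : - (n%:R * c) = n%:R * (a - c) + - (n%:R * a) by ring.
rewrite expRD ler_pM2r ?expR_gt0//.
by apply: le_trans (expR_ge1Dx _); lra.
Unshelve. all: by end_near. Qed.

(* Half of the gap between c and a absorbs the factor 2 of the union bound. *)
Lemma negligible_belowU x a G H : negligible_below x a G -> negligible_below x a H ->
  negligible_below x a (G `|` H).
Proof.
move=> hG hH c ca; pose c' := (c + a) / 2.
have c'a : c' < a by rewrite /c'; lra.
have cc' : c < c' by rewrite /c'; lra.
have := exp_upperU cc' (hG _ c'a) (hH _ c'a).
move=> [e e0 he]; exists e => //; apply: filterS he => n h z Ez ze.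
apply: le_trans (h z Ez ze); apply: le_outer_measure => w [psi [Gpsi|Hpsi] psiE].
  by left; exists psi.
by right; exists psi.
Qed.

Lemma exp_upperS x (A B : nat -> 'rV[R]_N -> set Om) (c c' : R) : c' <= c ->
  (forall n z, A n z `<=` B n z) ->
  exp_upper E P x B c -> exp_upper E P x A c'.
Proof.
move=> cc' AB [e e0 he]; exists e => //; apply: filterS he => n h z Ez ze.
apply: le_trans (le_outer_measure _ _ _ (AB n z)) _.
apply: (le_trans (h z Ez ze)); rewrite lee_fin ler_expR lerN2.
by rewrite ler_wpM2l.
Qed.

Lemma Ifun_upper_ld_bound : upper_ld_bound E P X (@Ifun R N T L).
Proof.
move=> x F x0 cF.
(* Real levels below the infimum suffice, whether the infimum is finite or infinite. *)
suff H (a : R) : (a%:E < ereal_inf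
    [set Ifun L phi | phi in [set phi : skorohod N T | F phi /\ phi 0%R = x]])%E ->
    negligible_below x a F.
  set I := ereal_inf _ in H *; set l := lim _.
  have hl (a : R) : (a%:E < I)%E -> (l <= (- a)%:E)%E.
    move=> aI; apply/lee_addgt0Pr => e e0; rewrite -EFinD.
    have -> : - a + e = - (a - e) by ring.
    by apply: lim_limsup_le; apply: (H a aI); rewrite ltrBlDr ltrDl.
  case: I {H} hl => [i| |] hl.
  - rewrite -EFinN; apply/lee_addgt0Pr => e e0; rewrite -EFinD.
    have -> : - i + e = - (i - e) by ring.
    by apply: hl; rewrite lte_fin ltrBlDr ltrDl.
  - rewrite (@eq_ninfty _ l)// => y; rewrite -(opprK y); apply: hl; exact: ltry.
  - exact: leey.
(* Compactness of level sets is assumed for positive levels only; [c >= a] serves outside the level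
   set. *)
move=> aI; pose c := Num.max a 1.
have c0 : 0 < c by rewrite lt_max ltr01 orbT.
have [_ cpt ac] := hItgood.
pose S := [set phi : skorohod N T | [set x] (phi 0) /\ (It phi <= c%:E)%E].
have cS : compact (S `&` F).
  apply: compact_closedI => //; apply: cpt => //; first by move=> y ->.
  exact: compact_set1.
(* Open negligible sets are stable under finite unions, so the families containing all supersets of
   one of them form a filter. For this filter, near covering yields a single negligible open set
   that contains the compact set. *)
pose ideal := [set G : set (skorohod N T) | open G /\ negligible_below x a G].
pose FF := filter_from ideal (fun G => [set H : set (skorohod N T) | G `<=` H]).
have FFF : Filter FF.
  apply: filter_from_filter.
    exists set0; split; first exact: open0.
    move=> y _; exists 1 => //; apply: nearW => n z _ _.
    rewrite (_ : path_event _ _ _ _ = set0); last by apply/seteqP; split => // w [].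
    by rewrite outer_measure0 lee_fin expR_ge0.
  move=> G1 G2 [op1 ng1] [op2 ng2]; exists (G1 `|` G2).
    by split; [exact: openU|exact: negligible_belowU].
  by move=> H GH; split => y Gy; apply: GH; [left|right].
have [G [oG nG] /(_ G (@subset_refl _ G)) SG] : FF [set H | S `&` F `<=` H].
  have /compact_near_coveringP/(_ _ FF (fun H y => H y) FFF) := cS; apply.
  move=> phi [[/= phix Iphi] Fphi].
  have acphi : absolutely_continuous phi by apply: ac; apply: le_lt_trans Iphi _; rewrite ltry.
  have aphi : (a%:E < Ifun L phi)%E.
    by apply: (lt_le_trans aI); apply: ereal_inf_lbound; exists phi.
  have [delta d0 hd] := local_upper acphi aphi.
  rewrite phix in hd.
  exists ((ball phi delta)°, [set H | (ball phi delta)° `<=` H]) => /=; last first.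
    by move=> [psi H] /= [h1 h2]; exact: h2.
  split.
    apply: open_nbhs_nbhs; split; first exact: open_interior.
    exact: nbhsx_ballx.
  exists (ball phi delta)° => //; split; first exact: open_interior.
  move=> y ya; apply: exp_upperS hd; first exact: ltW.
  by move=> n z w [psi hpsi psiE]; exists psi => //; exact: interior_subset.
(* The paths of [F] starting at [x] and lying outside [G] have [It] above [c]. *)
have FG : negligible_below x a (F `&` ~` G).
  move=> y ya; apply: (It_exp_upper hItupper) => //.
    by apply: closedI => //; exact: open_closedC.
  apply: (@lt_le_trans _ _ c%:E).
    by rewrite lte_fin lt_max ya.
  apply: le_ereal_inf_tmp => _ [psi [[Fpsi nGpsi] psix] <-].
  by rewrite leNgt; apply/negP => hlt; apply: nGpsi; apply: SG; split => //; split => //; exact: ltW.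
move=> y ya; apply: (@exp_upperS _ _ (fun n z => path_event X n z (G `|` (F `&` ~` G))) y) => //.
  move=> n z w [psi Fpsi psiE]; exists psi => //.
  by have [Gpsi|nGpsi] := pselect (G psi); [left|right].
exact: (negligible_belowU nG FG).
Qed.

End UpperBound.

Theorem theorem2 (R : realType) (N : nat) (hN : (1 <= N)%N)
  (d : measure_display) (Om : measurableType d)
  (E : set 'rV[R]_N) (hE : E `<=` @orthant R N)
  (P : 'rV[R]_N -> probability Om R)
  (X : R -> 'rV[R]_N -> Om -> 'rV[R]_N)
  (K : R -> R.-pker (borelRV R N) ~> (borelRV R N))
  (hX : markov_process E P X K)
  (happrox : forall x : 'rV[R]_N, orthant x ->
     exists2 u : nat -> 'rV[R]_N,
       (forall n, (1 <= n)%N -> En E n (u n)) & u n @[n --> \oo] --> x)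
  (T : R) (hT : 0 < T)
  (L : {set 'I_N} -> 'rV[R]_N -> \bar R)
  (hL0 : forall La v, (0 <= L La v)%E)
  (hLconv : forall La, convex_ereal (L La))
  (hA1 : local_lower_bound E P X L)
  (hA2 : \forall v \near (0 : 'rV[R]_N), (L [set: 'I_N]%SET v < +oo)%E)
  (hA3 : local_upper_bound E P X L)
  (It : skorohod N T -> \bar R)
  (hItgood : good_rate_function It)
  (hItupper : upper_ld_bound E P X It) :
  sample_path_ldp E P X (@Ifun R N T L) /\ good_rate_function (@Ifun R N T L).
Proof.
have good : good_rate_function (@Ifun R N T L).
  exact: (Ifun_good hE hX hT hL0 hLconv hA1 hA2 happrox hItgood hItupper).
split => //; split.
- exact: Ifun_rate.
- exact: (Ifun_lower_ld_bound hE hX hT hL0 hLconv hA1 hA2).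
- exact: (Ifun_upper_ld_bound hX hT hL0 hLconv hA2 hA3 hItgood hItupper).
Qed.
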